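(* Let $\rho\ge2$, $d=\rho-1$. Let $(\boldsymbol{X}_1,Y_1),(\boldsymbol{X}_2,Y_2),\ldots$ be a random sample (i.i.d. copies) from the $\rho$-dimensional random vector $(\boldsymbol{X},Y)$, with $\boldsymbol{X}$ $d$-dimensional, and assume that $(\boldsymbol{X},Y)$ has continuous distribution function $H$ and underlying copula $A\in\mathcal{C}^\rho$. Let $\hat{A}_n$ be the empirical multilinear copula of the first $n$ observations. Then, setting $N(n):=\lfloor n^s\rfloor$ for some $s$ fulfilling $0<s<\frac{1}{2d}$, and $\hat\zeta^1_n:=\zeta^1(\mathfrak{CB}_{N(n)}(\hat{A}_n))$, $$\lim_{n\to\infty}\hat{\zeta}^1_n=\lim_{n\to\infty}\zeta^1(\mathfrak{CB}_{N(n)}(\hat{A}_n))=\zeta^1(A)$$ holds with probability $1$.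
   Context: Notation: $\mathbb{I}=[0,1]$; $\lambda^k$ is $k$-dimensional Lebesgue measure, $\lambda=\lambda^1$; $\mathcal{C}^\rho$ is the set of $\rho$-dimensional copulas; $\mu_A$ is the probability measure on $\mathbb{I}^\rho$ with distribution function $A$; $A^k$ is the marginal copula of the first $k$ coordinates; $\Pi_\rho$ is the product copula. For a copula $C$ on $\mathbb{I}^{m}$ and $1\le k<m$, the Markov kernel $K_C:\mathbb{I}^k\times\mathcal{B}(\mathbb{I}^{m-k})\to\mathbb{I}$ with respect to the first $k$ coordinates is a (version of the) regular conditional distribution of the last $m-k$ coordinates given the first $k$. Linkage: let $(X_1,\ldots,X_d,Y)\sim A\in\mathcal{C}^\rho$ and let $\boldsymbol{R}=(R_1,\ldots,R_d)$ have i.i.d. coordinates uniform on $\mathbb{I}$, with $\boldsymbol{R}$ independent of $(X_1,\ldots,X_d,Y)$. For $i\ge2$, $r\in\mathbb{I}$ set $F^{r}_{i|1\ldots i-1}(x_i|x_1,\ldots,x_{i-1})=K_{A^i}(x_1,\ldots,x_{i-1},[0,x_i))+r\,K_{A^i}(x_1,\ldots,x_{i-1},\{x_i\})$ and $F_1^{r}(x_1)=x_1$; set $\Phi^{\boldsymbol{r}}(x_1,\ldots,x_d)=(F_1^{r_1}(x_1),F^{r_2}_{2|1}(x_2|x_1),\ldots,F^{r_d}_{d|1\ldots d-1}(x_d|x_1,\ldots,x_{d-1}))$. The linkage $L(A)$ is the distribution function of $(\Phi^{\boldsymbol{R}}(X_1,\ldots,X_d),Y)$; it is a copula whose first $d$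 coordinates are jointly uniform on $\mathbb{I}^d$. Dependence measure: $\zeta^1(A)=3\int_{\mathbb{I}}\int_{\mathbb{I}^d}|K_{L(A)}(\boldsymbol{x},[0,y])-y|\,d\lambda^d(\boldsymbol{x})\,d\lambda(y)$ for $A\in\mathcal{C}^\rho$ (kernel with respect to the first $d$ coordinates); this is $3D_1(A,\Pi_\rho)$, where $D_1(A,B)=\int_{\mathbb{I}}\int_{\mathbb{I}^d}|K_{L(A)}(\boldsymbol{x},[0,y])-K_{L(B)}(\boldsymbol{x},[0,y])|\,d\lambda^d(\boldsymbol{x})\,d\lambda(y)$. Checkerboard approximation: for $A\in\mathcal{C}^\rho$ and $N\in\mathbb{N}$, $\mathfrak{CB}_N(A)$ is the absolutely continuous copula with density $N^\rho\sum_{\boldsymbol{i},j}\mu_A\big(R_N^{\boldsymbol{i}}\times[\frac{j-1}{N},\frac{j}{N}]\big)\mathbf{1}_{R_N^{\boldsymbol{i}}\times[\frac{j-1}{N},\frac{j}{N}]}$, the sum over $\boldsymbol{i}\in\{1,\ldots,N\}^d$, $j\in\{1,\ldots,N\}$, where $R_N^{\boldsymbol{i}}=[\frac{i_1-1}{N},\frac{i_1}{N}]\times\cdots\times[\frac{i_d-1}{N},\frac{i_d}{N}]$. Empirical multilinear copula: with $H_n$ the empirical distribution function of the first $n$ observations and $F_{1,n},\ldots,F_{d,n},G_n$ its univariate margins, let $S_n$ be the subcopula defined on the product of the ranges of these margins by $H_n(\boldsymbol{x},y)=S_n(F_{1,n}(x_1),\ldots,F_{d,n}(x_d),G_n(y))$;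 with probability one there are no ties and the domain is $\{0,\frac1n,\ldots,1\}^\rho$. $\hat{A}_n\in\mathcal{C}^\rho$ is the multilinear interpolation of $S_n$. *)

(* Defs.v *)
From HB Require Import structures.
From mathcomp Require Import all_boot all_order all_algebra.
From mathcomp Require Import finmap.
From mathcomp Require Import all_classical all_reals all_analysis.
Set Implicit Arguments.
Unset Strict Implicit.
Unset Printing Implicit Defensive.
Import Order.TTheory GRing.Theory Num.Theory.
Import numFieldNormedType.Exports.
Local Open Scope classical_set_scope.
Local Open Scope ring_scope.

(* Points of R^m are m-tuples, with the product sigma-algebra of the library.
   In dimension d.+1 the first d entries are the x-coordinates and the last
   entry is y. Coordinates are numbered from 0. *)

Section lebesgue_cube.
Context {R : realType}.

(* uniform_prob lives on measurableTypeR R, which has the sigma-algebra of R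
   under another display. *)
Definition cons_coord m (p : measurableTypeR R * m.-tuple R) : m.+1.-tuple R :=
  [tuple of (p.1 : R) :: p.2].

Lemma measurable_cons_coord m : measurable_fun setT (@cons_coord m).
Proof.
apply: (@measurable_cons _ _ _ R (fun p : measurableTypeR R * m.-tuple R => p.1 : R)).
- by move=> _ B mB; exact: measurable_fst.
- exact: measurable_snd.
Qed.

HB.instance Definition _ m :=
  isMeasurableFun.Build _ _ _ _ (@cons_coord m) (@measurable_cons_coord m).

(* Lebesgue measure on [0, 1]^m, as the m-fold product of Lebesgue measure on
   [0, 1]. *)
Fixpoint lebesgue_cube m : probability (m.-tuple R) R :=
  if m is m'.+1 return probability (m.-tuple R) R
  then distribution (uniform_prob (@ltr01 R) \x lebesgue_cube m')%E (@cons_coord m')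
  else dirac [tuple].

End lebesgue_cube.
Arguments lebesgue_cube {R} m.

Section copula.
Context {R : realType}.

Definition cube m : set (m.-tuple R) :=
  [set x | forall i, 0 <= tnth x i <= 1].

Definition lower_orthant m (u : m.-tuple R) : set (m.-tuple R) :=
  [set x | forall i, tnth x i <= tnth u i].

Definition first_coords m k (x : m.-tuple R) : k.-tuple R :=
  [tuple nth 0 x j | j < k].

Definition last_coord m (x : m.+1.-tuple R) : R := tnth x ord_max.

(* Only the values of C on the cube matter. *)
Definition has_df_on_cube m (C : m.-tuple R -> R)
    (mu : probability (m.-tuple R) R) : Prop :=
  mu (@cube m) = 1%E /\
  forall u, cube u -> mu (lower_orthant u) = (C u)%:E.

Definition is_copula m (C : m.-tuple R -> R) : Prop :=
  exists2 mu : probability (m.-tuple R) R, has_df_on_cube C mu &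
    forall i (t : R), 0 <= t <= 1 -> mu [set x | tnth x i <= t] = t%:E.

Definition copula_measure m (C : m.-tuple R -> R) : probability (m.-tuple R) R :=
  xget (point : {classic probability (m.-tuple R) R}) [set mu | has_df_on_cube C mu].

(* The coordinates with index >= k are set to 1. *)
Definition copula_margin m k (A : m.-tuple R -> R) (u : k.-tuple R) : R :=
  A [tuple nth 1 u j | j < m].

Definition is_markov_kernel k (C : k.+1.-tuple R -> R)
    (K : R.-pker (k.-tuple R) ~> R) : Prop :=
  forall (E : set (k.-tuple R)) (F : set R), measurable E -> measurable F ->
    copula_measure C
      [set x | E (first_coords k x) /\ F (last_coord x)] =
    (\int[copula_measure C]_(x in [set x | E (first_coords k x)])
        K (first_coords k x) F)%E.

Definition default_kernel k : R.-pker (k.-tuple R) ~> R :=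
  kdirac (measurable_cst (0 : R)).

Definition markov_kernel k (C : k.+1.-tuple R -> R) : R.-pker (k.-tuple R) ~> R :=
  xget (@default_kernel k : {classic R.-pker (k.-tuple R) ~> R})
    [set K | is_markov_kernel C K].

Definition cond_df m (A : m.-tuple R -> R) k (r : R) (x : k.-tuple R) (t : R) : R :=
  let K := markov_kernel (@copula_margin m k.+1 A) in
  fine (K x `[0, t[%classic) + r * fine (K x [set t]).

Definition rosenblatt d (A : d.+1.-tuple R -> R) (r x : d.-tuple R) : d.-tuple R :=
  [tuple if i == 0%N :> nat then tnth x i
         else cond_df A (tnth r i) (first_coords i x) (tnth x i) | i < d].

(* The law of ((X, Y), R) is the product of mu_A and Lebesgue measure on
   [0, 1]^d. *)
Definition linkage d (A : d.+1.-tuple R -> R) (u : d.+1.-tuple R) : R :=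
  fine ((copula_measure A \x lebesgue_cube d)%E
    [set p | cube p.2 /\
      lower_orthant u
        [tuple of rcons (rosenblatt A p.2 (first_coords d p.1)) (last_coord p.1)]]).

Definition zeta1 d (A : d.+1.-tuple R -> R) : R :=
  3 * fine (\int[lebesgue_measure]_(y in `[0%R, 1%R])
              \int[lebesgue_cube d]_(x in @cube d)
                `|markov_kernel (linkage A) x `[0%R, y]%classic - y%:E|)%E.

Definition grid_cell m N (i : m.-tuple 'I_N) : set (m.-tuple R) :=
  [set x | forall j,
     (tnth i j)%:R / N%:R <= tnth x j <= (tnth i j).+1%:R / N%:R].

Definition checkerboard_density m N (A : m.-tuple R -> R) (x : m.-tuple R) : R :=
  N%:R ^+ m *
  \sum_(i : m.-tuple 'I_N) fine (copula_measure A (grid_cell i)) * \1_(grid_cell i) x.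

Definition checkerboard m N (A : m.-tuple R -> R) (u : m.-tuple R) : R :=
  fine (\int[lebesgue_cube m]_(x in @cube m `&` lower_orthant u)
          (checkerboard_density N A x)%:E)%E.

Definition empirical_df m n (z : nat -> m.-tuple R) (x : m.-tuple R) : R :=
  (\sum_(k < n) \1_(lower_orthant x) (z k)) / n%:R.

Definition empirical_margin m n (z : nat -> m.-tuple R) (i : 'I_m) (t : R) : R :=
  (\sum_(k < n) (tnth (z k) i <= t)%R%:R) / n%:R.

(* S_n(v) is the value H_n(x) at any x whose coordinates are sent to v by the
   margins; it is meaningful for v in the product of their ranges. *)
Definition empirical_subcopula m n (z : nat -> m.-tuple R) (v : m.-tuple R) : R :=
  empirical_df n z
    (xget point [set x | forall i, empirical_margin n z i (tnth x i) = tnth v i]).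

(* Multilinear interpolation of a function S given on the product of closed
   sets D i. When lo = hi the weight is 0 / 0 = 0, and both choices give the
   same node. *)
Definition multilinear_interpolation m (D : 'I_m -> set R) (S : m.-tuple R -> R)
    (u : m.-tuple R) : R :=
  let lo i := sup [set v | D i v /\ v <= tnth u i] in
  let hi i := inf [set v | D i v /\ tnth u i <= v] in
  let w i := (tnth u i - lo i) / (hi i - lo i) in
  \sum_(b : {ffun 'I_m -> bool})
    (\prod_i (if b i then w i else 1 - w i)) *
    S [tuple if b i then hi i else lo i | i < m].

Definition empirical_copula m n (z : nat -> m.-tuple R) : m.-tuple R -> R :=
  multilinear_interpolation (fun i => range (empirical_margin n z i))
    (empirical_subcopula n z).

End copula.

Section random_sample.
Context {R : realType} (disp : measure_display) (Omega : measurableType disp).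
Variable P : probability Omega R.

Definition mutually_independent m (Z : nat -> {RV P >-> m.-tuple R}) : Prop :=
  forall (J : {fset nat}) (B : nat -> set (m.-tuple R)),
    (forall k, measurable (B k)) ->
    P (\bigcap_(k in [set` J]) (Z k @^-1` B k)) =
    (\prod_(k <- J) P (Z k @^-1` B k))%E.

Definition identically_distributed m (X Y : {RV P >-> m.-tuple R}) : Prop :=
  forall B, measurable B -> distribution P X B = distribution P Y B.

Definition random_sample m (X : {RV P >-> m.-tuple R})
    (Z : nat -> {RV P >-> m.-tuple R}) : Prop :=
  mutually_independent Z /\ forall k, identically_distributed (Z k) X.

Definition joint_df m (X : {RV P >-> m.-tuple R}) (x : m.-tuple R) : R :=
  fine (P (X @^-1` lower_orthant x)).

Definition margin_df m (X : {RV P >-> m.-tuple R}) (i : 'I_m) (t : R) : R :=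
  fine (P [set w | tnth (X w) i <= t]).

(* The topology of R^m is that of row vectors. *)
Definition continuous_df m (X : {RV P >-> m.-tuple R}) : Prop :=
  continuous (fun x : 'rV[R]_m => joint_df X [tuple x ord0 i | i < m]).

Definition underlying_copula m (X : {RV P >-> m.-tuple R}) (A : m.-tuple R -> R) : Prop :=
  is_copula A /\
  forall x, joint_df X x = A [tuple margin_df X i (tnth x i) | i < m].

End random_sample.

(* Main.v *)
(* For a copula A with mass mu, call deviation of E at level y the number
   mu(X in E, Y <= y) - y mu(X in E). The inner integral of zeta1 at level y is
   twice the supremum of the deviations over all measurable E: the linkage is
   the law of (U, Y), where U is the (randomized) Rosenblatt transform of X, U is
   uniform on the cube, the event {U in E'} with E' := {K(u, [0, y]) >= y}
   attains half of the integral, and every event {X in E} is a.s. of the form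
   {U in E'}. This description no longer mentions kernels.

   For a checkerboard the supremum is attained on a union of cells, so that it is
   the sum of the positive parts of the deviations of the N^d cells. If C is
   within e of A uniformly, these cellwise deviations for CB_N(C) and for A
   differ in total by O(1/N + N^d e); and since every measurable set is
   approximated by unions of cells, the cellwise supremum for A tends to the full
   one as N goes to infinity. Dominated convergence in y gives
   zeta1(CB_N(C)) -> zeta1(A) as soon as N -> oo and N^d e -> 0.

   Let V be the sample transformed by the continuous margins F_i, which is an
   i.i.d. sample of mu. Without ties, the multilinear interpolation is a mixture
   of uniform laws on cells of mesh 1/n selected by the ranks, hence a copula, and
   it is uniformly close to A when the empirical distribution function of V is.
   Chernoff's bound on the grid of mesh 1/n together with Borel-Cantelli bounds
   the error a.s. by O(n^-g) for every g < 1/2; with sd < g < 1/2 and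
   N(n)^d <= n^(sd) the theorem follows. *)
Require Import Defs.
From HB Require Import structures.
From mathcomp Require Import all_boot all_order all_algebra.
From mathcomp Require Import finmap.
From mathcomp Require Import all_classical all_reals all_analysis.
From mathcomp Require Import measurable_realfun.
From mathcomp Require Import ring lra.
Set Implicit Arguments.
Unset Strict Implicit.
Unset Printing Implicit Defensive.
Set SsrOldRewriteGoalsOrder.
Import Order.TTheory GRing.Theory Num.Theory.
Import numFieldNormedType.Exports.
Local Open Scope classical_set_scope.
Local Open Scope ring_scope.

(** * Real-valued probabilities *)

(** [copula_measure] and [markov_kernel] are [xget] choices: nothing is known about them before an
    object of the required kind has been exhibited. For measures the definition of a copula supplies
    one, and its values on the cube determine it. For kernels one has to be built. Radon-Nikodym
    derivatives give conditional probabilities of {Y <= q} for each rational q, their generalized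
    inverse in an auxiliary uniform variable T gives a conditional quantile Q(x, T), and the kernel
    at x is the law of Q(x, T).

    Conditional laws may have atoms, hence the randomization in the Rosenblatt transform. Uniformity
    of U and recovery of X from U both come from one fact: the randomized transform falls below a
    threshold c(z) with conditional probability c(z).

    The rate is governed by N^d and not by N^(d+1): heights are compared only on the grid, where the
    checkerboard agrees with C, and between two grid heights monotonicity loses 1/N over all columns
    together. Each of the N^d columns costs a multiple of 2^d e, one factor 2 per lower bound of the
    column. *)

Section probability_as_real.
Context {R : realType} d (T : measurableType d).
Implicit Types (mu : probability T R) (E F : set T).

Definition pr mu E : R := fine (mu E).

Lemma prE mu E : measurable E -> mu E = (pr mu E)%:E.
Proof. by move=> mE; rewrite /pr fineK// fin_num_measure. Qed.

Lemma pr_ge0 mu E : 0 <= pr mu E.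
Proof. exact: fine_ge0. Qed.

Lemma pr_le1 mu E : measurable E -> pr mu E <= 1.
Proof. by move=> mE; rewrite -lee_fin -prE// probability_le1. Qed.

Lemma prT mu : pr mu setT = 1.
Proof. by rewrite /pr probability_setT. Qed.

Lemma pr0 mu : pr mu set0 = 0.
Proof. by rewrite /pr measure0. Qed.

Lemma le_pr mu E F : measurable E -> measurable F -> E `<=` F -> pr mu E <= pr mu F.
Proof. by move=> mE mF EF; rewrite -lee_fin -!prE// le_measure// inE. Qed.

Lemma prDI mu E F : measurable E -> measurable F ->
  pr mu E = pr mu (E `&` F) + pr mu (E `\` F).
Proof.
move=> mE mF; apply: EFin_inj; rewrite EFinD.
rewrite -(prE mu (measurableI _ _ mE mF)) -(prE mu (measurableD mE mF)) -prE//.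
by rewrite addeC; exact: (measureDI mu mE mF).
Qed.

Lemma prC mu E : measurable E -> pr mu (~` E) = 1 - pr mu E.
Proof.
move=> mE; have := @prDI mu _ _ (@measurableT _ T) mE.
by rewrite setTI setTD prT => ->; rewrite addrAC subrr add0r.
Qed.

Lemma prD mu E F : measurable E -> measurable F -> F `<=` E ->
  pr mu (E `\` F) = pr mu E - pr mu F.
Proof.
move=> mE mF FE; rewrite (prDI mu mE mF) (setIidr FE); ring.
Qed.

Lemma prU mu E F : measurable E -> measurable F -> E `&` F = set0 ->
  pr mu (E `|` F) = pr mu E + pr mu F.
Proof.
move=> mE mF EF; apply: EFin_inj; rewrite EFinD -!prE//; last first.
  exact: measurableU.
by rewrite measureU.
Qed.

Lemma prU_le mu E F : measurable E -> measurable F ->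
  pr mu (E `|` F) <= pr mu E + pr mu F.
Proof.
move=> mE mF; rewrite -lee_fin EFinD -!prE//; last exact: measurableU.
exact: measureU2.
Qed.

Lemma pr_sub0 mu E F : measurable E -> measurable F -> E `<=` F ->
  pr mu F = 0 -> pr mu E = 0.
Proof.
by move=> mE mF EF F0; apply/eqP; rewrite eq_le pr_ge0 andbT -F0 le_pr.
Qed.

(** The usual way to neglect a null set below: G is mostly the cube, and sets that agree inside it
    get equal mass. *)
Lemma pr_eq_on mu G E F : measurable G -> measurable E -> measurable F ->
  pr mu G = 1 -> E `&` G = F `&` G -> pr mu E = pr mu F.
Proof.
move=> mG mE mF G1 EF.
have h H : measurable H -> pr mu H = pr mu (H `&` G).
  move=> mH; rewrite (prDI mu mH mG) -[RHS]addr0; congr (_ + _).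
  apply: (@pr_sub0 _ _ (~` G)) => //; [exact: measurableD|exact: measurableC|].
  by rewrite prC// G1 subrr.
by rewrite h// EF -h.
Qed.

Lemma pr_setI1 mu E F : measurable E -> measurable F ->
  pr mu F = 1 -> pr mu (E `&` F) = pr mu E.
Proof.
move=> mE mF F1; apply: (@pr_eq_on _ F) => //; first exact: measurableI.
by rewrite -setIA setIid.
Qed.

Lemma pr_bigcup_cvg mu (F : (set T)^nat) : (forall n, measurable (F n)) ->
  nondecreasing_seq F -> pr mu (F n) @[n --> \oo] --> pr mu (\bigcup_n F n).
Proof.
move=> mF ndF; have mU : measurable (\bigcup_n F n) by exact: bigcupT_measurable.
have : mu (F n) @[n --> \oo] --> mu (\bigcup_n F n).
  exact: nondecreasing_cvg_mu.
by rewrite (prE mu mU) => /fine_cvgP[].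
Qed.

Lemma pr_bigcap_cvg mu (F : (set T)^nat) : (forall n, measurable (F n)) ->
  nonincreasing_seq F -> pr mu (F n) @[n --> \oo] --> pr mu (\bigcap_n F n).
Proof.
move=> mF niF; have mU : measurable (\bigcap_n F n) by exact: bigcapT_measurable.
have foo : (mu (F 0%N) < +oo)%E by rewrite ltey_eq fin_num_measure.
have : mu (F n) @[n --> \oo] --> mu (\bigcap_n F n).
  exact: nonincreasing_cvg_mu.
by rewrite (prE mu mU) => /fine_cvgP[].
Qed.

End probability_as_real.

Section law.
Context {R : realType} d d' (T : measurableType d) (T' : measurableType d').

(** The measurability proof is an argument, so that the image law of an unbundled function can be
    formed; [distribution] expects a bundled one. *)
Definition law (P : probability T R) (f : T -> T') (mf : measurable_fun setT f)
    : probability T' R :=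
  distribution P (HB.pack_for {mfun T >-> T'} f (isMeasurableFun.Build _ _ _ _ f mf)).

Lemma lawE P f mf E : @law P f mf E = P (f @^-1` E).
Proof. by []. Qed.

Lemma pr_law P f mf E : pr (@law P f mf) E = pr P (f @^-1` E).
Proof. by []. Qed.

Lemma ge0_integral_law P f (mf : measurable_fun setT f) D (g : T' -> \bar R) :
  measurable D -> measurable_fun D g -> (forall y, (0 <= g y)%E) ->
  (\int[law P mf]_(y in D) g y = \int[P]_(x in f @^-1` D) g (f x))%E.
Proof.
by move=> mD mg g0; apply: (@ge0_integral_pushforward _ _ _ _ _ f mf P).
Qed.

End law.
Section product_probability.
Context {R : realType} d d' (T : measurableType d) (T' : measurableType d').
Variables (P : probability T R) (Q : probability T' R).

Lemma prX A B : measurable A -> measurable B ->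
  pr (P \x Q)%E (A `*` B) = pr P A * pr Q B.
Proof.
move=> mA mB; apply: EFin_inj; rewrite EFinM -!prE//; last exact: measurableX.
exact: product_measure1E.
Qed.

Lemma pr_productE E : measurable E ->
  (P \x Q)%E E = (\int[P]_x Q (xsection E x))%E.
Proof. by []. Qed.

Lemma pr_productE2 E : measurable E ->
  (P \x Q)%E E = (\int[Q]_y P (ysection E y))%E.
Proof.
move=> mE; rewrite (@product_measure_unique _ _ _ _ _ P Q (P \x^ Q)%E)//.
by move=> A B mA mB; exact: product_measure2E.
Qed.

End product_probability.

Section measurable_finite.
Context d (T : measurableType d).

Lemma measurable_forall (I : finType) (Q : I -> set T) :
  (forall i, measurable (Q i)) -> measurable [set x | forall i, Q i x].
Proof.
move=> mQ; rewrite (_ : [set x | _] = \bigcap_(i in [set: I]) Q i).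
  by apply: fin_bigcap_measurable.
by apply/seteqP; split => [x h i _|x h i]; exact: h.
Qed.

Lemma measurable_forall_le (I : finType) (Q : I -> T -> Prop) (P : pred I) :
  (forall i, P i -> measurable [set x | Q i x]) ->
  measurable [set x | forall i, P i -> Q i x].
Proof.
move=> mQ; apply: (@measurable_forall _ (fun i x => P i -> Q i x)) => i.
have [Pi|Pi] := boolP (P i).
  rewrite (_ : (fun x => _) = [set x | Q i x]); first exact: mQ.
  by apply/seteqP; split => [x /(_ isT)//|x h _].
rewrite (_ : (fun x => _) = setT); first exact: measurableT.
by apply/seteqP; split.
Qed.

End measurable_finite.

(** * Laws on tuples and their orthants *)

Section tuple_probability.
Context {R : realType}.

Lemma measurable_tnth_preimage m (i : 'I_m) (B : set R) : measurable B ->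
  measurable [set x : m.-tuple R | B (tnth x i)].
Proof.
by move=> mB; rewrite -[X in measurable X]setTI; exact: (measurable_tnth i).
Qed.

Lemma measurable_box m (B : 'I_m -> set R) : (forall i, measurable (B i)) ->
  measurable [set x : m.-tuple R | forall i, B i (tnth x i)].
Proof.
move=> mB; apply: (@measurable_forall _ _ _ (fun i (x : m.-tuple R) => B i (tnth x i))) => i.
exact: measurable_tnth_preimage.
Qed.

Lemma measurable_setle (t : R) : measurable [set x : R | x <= t].
Proof. by rewrite -set_itvNyc; exact: measurable_itv. Qed.

Lemma measurable_setlt (t : R) : measurable [set x : R | x < t].
Proof. by rewrite -set_itvNyo; exact: measurable_itv. Qed.

Lemma measurable_setcc (a b : R) : measurable [set x : R | a <= x <= b].
Proof. by rewrite -set_itvcc; exact: measurable_itv. Qed.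

Lemma measurable_lower_orthant m (u : m.-tuple R) : measurable (lower_orthant u).
Proof.
by apply: (@measurable_box _ (fun i => [set x | x <= tnth u i])) => i; exact: measurable_setle.
Qed.

Lemma measurable_cube m : measurable (@cube R m).
Proof.
by apply: (@measurable_box _ (fun i => [set x | 0 <= x <= 1])) => i; exact: measurable_setcc.
Qed.

Lemma measurable_first_coords m k : (k <= m)%N ->
  measurable_fun setT (@first_coords R m k).
Proof.
move=> km; apply/measurable_fun_tnthP => i.
have im : (i < m)%N by exact: leq_trans (ltn_ord i) km.
rewrite (_ : _ \o _ = fun x : m.-tuple R => tnth x (Ordinal im)).
  exact: measurable_tnth.
by apply/funext => x /=; rewrite tnth_mktuple (tnth_nth 0).
Qed.

Lemma measurable_last_coord m : measurable_fun setT (@last_coord R m).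
Proof. exact: measurable_tnth. Qed.

Lemma measurable_rcons d (T : measurableType d) m (f : T -> m.-tuple R) (g : T -> R) :
  measurable_fun setT f -> measurable_fun setT g ->
  measurable_fun setT (fun x => [tuple of rcons (f x) (g x)]).
Proof.
move=> mf mg; apply/measurable_fun_tnthP => i.
have [im|im] := ltnP i m.
  rewrite (_ : _ \o _ = fun x => tnth (f x) (Ordinal im)).
    by apply: (measurableT_comp (f := fun x => tnth x (Ordinal im))) => //; exact: measurable_tnth.
  apply/funext => x /=; rewrite (tnth_nth 0) [RHS](tnth_nth 0) /= nth_rcons size_tuple.
  by rewrite im.
rewrite (_ : _ \o _ = g)//.
apply/funext => x /=; rewrite (tnth_nth 0) /= nth_rcons size_tuple.
rewrite ltnNge im /=; have -> : (i == m :> nat) by rewrite eqn_leq im -ltnS ltn_ord.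
by [].
Qed.

Lemma lower_orthant_gen m : (@measurable _ (m.-tuple R)) =
  <<s range (@lower_orthant R m) >>.
Proof.
apply/seteqP; split; last first.
  apply: smallest_sub; first exact: sigma_algebra_measurable.
  by move=> _ [u _ <-]; exact: measurable_lower_orthant.
pose G := g_sigma_algebraType (range (@lower_orthant R m)).
apply: smallest_sub; first exact: smallest_sigma_algebra.
rewrite -bigcup_seq; apply: bigcup_sub => /= i _.
move=> _ [B mB <-].
suff : measurable_fun (setT : set G) (fun x : G => tnth (x : m.-tuple R) i).
  by move=> /(_ measurableT _ mB).
apply: (@measurability _ _ _ _ _ _ (@RGenOInfty.G R)).
  exact: RGenOInfty.measurableE.
move=> _ [_ [t ->] <-]; rewrite setTI.
(* Corner t at i and n elsewhere: as n grows these orthants fill the half-space of points whose i-th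
   coordinate is at most t. *)
pose u n : m.-tuple R := [tuple if j == i then t else n%:R | j < m].
rewrite (_ : _ @^-1` _ = ~` (\bigcup_n lower_orthant (u n))).
  apply: measurableC; apply: bigcupT_measurable => n.
  by apply: sub_sigma_algebra; exists (u n).
apply/seteqP; split => [x /= + [n _ /(_ i)]|x /= h].
  by rewrite tnth_mktuple eqxx in_itv /= andbT ltNge => /negP.
rewrite in_itv /= andbT ltNge; apply/negP => xt; apply: h.
(* A sum of bounds for all coordinates dominates each of them at once. *)
exists (\sum_j (Num.truncn `|tnth x j|).+1)%N => // j; rewrite tnth_mktuple.
case: eqP => [->//|_]; rewrite (bigD1 j)//= natrD.
rewrite (le_trans (ler_norm _))// (le_trans (ltW (truncnS_gt _)))//.
by rewrite lerDl.
Qed.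

Lemma lower_orthantI m (u v : m.-tuple R) : lower_orthant u `&` lower_orthant v =
  lower_orthant [tuple Num.min (tnth u i) (tnth v i) | i < m].
Proof.
apply/seteqP; split => [x [xu xv] i|x xuv].
  by rewrite tnth_mktuple le_min xu xv.
by split => i; have := xuv i; rewrite tnth_mktuple le_min => /andP[].
Qed.

Lemma lower_orthant_cover m :
  \bigcup_n (lower_orthant [tuple n%:R | i < m] : set (m.-tuple R)) = setT.
Proof.
apply/seteqP; split => // x _.
exists (\sum_j (Num.truncn `|tnth x j|).+1)%N => // j; rewrite tnth_mktuple.
rewrite (bigD1 j)//= natrD.
rewrite (le_trans (ler_norm _))// (le_trans (ltW (truncnS_gt _)))//.
by rewrite lerDl.
Qed.

Lemma tuple_probability_unique m (mu nu : probability (m.-tuple R) R) :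
  (forall u, mu (lower_orthant u) = nu (lower_orthant u)) ->
  forall E, measurable E -> mu E = nu E.
Proof.
move=> h E mE.
apply: (@measure_unique _ _ _ (range (@lower_orthant R m))
  (fun n => lower_orthant [tuple n%:R | i < m])) => //.
- exact: lower_orthant_gen.
- by move=> _ _ [u _ <-] [v _ <-]; rewrite lower_orthantI; eexists.
- exact: lower_orthant_cover.
- by move=> _ [u _ <-]; exact: h.
- by move=> n; rewrite ltey_eq fin_num_measure//; exact: measurable_lower_orthant.
Qed.

Lemma preimage_tuple_unique d d' (T : measurableType d) (T' : measurableType d') m
    (P : probability T R) (Q : probability T' R)
    (f : T -> m.-tuple R) (g : T' -> m.-tuple R) :
  measurable_fun setT f -> measurable_fun setT g ->
  (forall u, P (f @^-1` lower_orthant u) = Q (g @^-1` lower_orthant u)) ->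
  forall E, measurable E -> P (f @^-1` E) = Q (g @^-1` E).
Proof.
by move=> mf mg h E mE; exact: (@tuple_probability_unique _ (law P mf) (law Q mg)).
Qed.

(** All mass lies in the cube: capping the corner at 1 changes nothing there, and a corner with a
    negative entry leaves no point of the cube. Hence the values of C on the cube determine the
    law. *)
Lemma has_df_on_cubeE m C (rho : probability (m.-tuple R) R) : has_df_on_cube C rho ->
  forall u, pr rho (lower_orthant u) =
    if [forall i, 0 <= tnth u i] then C [tuple Num.min (tnth u i) 1 | i < m] else 0.
Proof.
move=> [rc rC] u; have mc := @measurable_cube m.
have mo := @measurable_lower_orthant m.
have rc1 : pr rho (@cube R m) = 1 by rewrite /pr rc.
case: ifPn => [/forallP u0|/forallPn [i ui]].
  set v := (X in C X); have cv : cube v.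
    move=> i; rewrite tnth_mktuple le_min u0 ler01 /=.
    by rewrite ge_min lexx orbT.
  rewrite -[RHS]/(fine (C v)%:E) -(rC _ cv); apply: pr_eq_on (rc1) _ => //.
  apply/seteqP; split => x [xu xc]; split => // i.
    by rewrite tnth_mktuple le_min xu /=; have /andP[] := xc i.
  by have := xu i; rewrite tnth_mktuple le_min => /andP[].
rewrite -[RHS](pr0 rho); apply: pr_eq_on (rc1) _ => //.
rewrite set0I; apply/seteqP; split => // x [/(_ i) xu /(_ i) /andP[x0 _]].
by move: ui; rewrite (le_trans x0 xu).
Qed.

Lemma has_df_on_cube_orthant m C (mu nu : probability (m.-tuple R) R) :
  has_df_on_cube C mu -> has_df_on_cube C nu ->
  forall E, measurable E -> mu E = nu E.
Proof.
move=> hmu hnu; apply: tuple_probability_unique => u.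
rewrite !prE ?(has_df_on_cubeE hmu) ?(has_df_on_cubeE hnu)//; exact: measurable_lower_orthant.
Qed.

Lemma copula_measureP m C (nu : probability (m.-tuple R) R) :
  has_df_on_cube C nu -> has_df_on_cube C (copula_measure C).
Proof. by move=> h; exact: (@xgetPex _ point _ (ex_intro _ nu h)). Qed.

Lemma copula_measureE m C (nu : probability (m.-tuple R) R) E :
  has_df_on_cube C nu -> measurable E -> copula_measure C E = nu E.
Proof.
by move=> h mE; apply: has_df_on_cube_orthant mE; [exact: copula_measureP h|].
Qed.

Lemma is_copula_measure m (C : m.-tuple R -> R) : is_copula C ->
  has_df_on_cube C (copula_measure C) /\
  forall i t, 0 <= t <= 1 -> pr (copula_measure C) [set x | tnth x i <= t] = t.
Proof.
case=> mu h hm; split; first exact: copula_measureP h.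
move=> i t t01; rewrite /pr (copula_measureE h) ?hm//.
exact: (measurable_tnth_preimage i (measurable_setle t)).
Qed.

End tuple_probability.

(** * Lebesgue measure on the cube *)

Section lebesgue_cube_theory.
Context {R : realType}.

(* uniform_prob is a measure on measurableTypeR R, not on R: going through 1-tuples
   changes the display. *)
Definition unif : probability R R := law (lebesgue_cube 1) (measurable_tnth ord0).

Lemma unifE (B : set R) : measurable B -> unif B = uniform_prob (@ltr01 R) B.
Proof.
move=> mB; rewrite /unif lawE /=.
rewrite /distribution /pushforward /=.
rewrite (_ : _ @^-1` _ = B `*` setT).
  by rewrite product_measure1E//= diracT mule1.
by apply/seteqP; split => [[x y] //=|[x y] []].
Qed.

(** The distribution function of the uniform law on [0, 1]. Checkerboards and multilinear
    interpolation are both expressed through it. *)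
Definition clamp (t : R) : R := Num.min (Num.max t 0) 1.

Lemma clamp_ge0 t : 0 <= clamp t.
Proof. by rewrite /clamp le_min ler01 le_max lexx orbT. Qed.

Lemma clamp_le1 t : clamp t <= 1.
Proof. by rewrite /clamp ge_min lexx orbT. Qed.

Lemma clamp_id t : 0 <= t <= 1 -> clamp t = t.
Proof. by move=> /andP[t0 t1]; rewrite /clamp max_l// min_l. Qed.

Lemma clamp_lt0 t : t <= 0 -> clamp t = 0.
Proof. by move=> t0; rewrite /clamp max_r// min_l. Qed.

Lemma clamp_gt1 t : 1 <= t -> clamp t = 1.
Proof. by move=> t1; rewrite /clamp min_r// le_max t1. Qed.

Lemma pr_unif_cc (a b : R) : 0 <= a -> a <= b -> b <= 1 ->
  pr unif [set x | a <= x <= b] = b - a.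
Proof.
move=> a0 ab b1; rewrite /pr unifE; last exact: measurable_setcc.
rewrite /uniform_prob integral_uniform_pdf setIidl; last first.
  by move=> x /= /andP[ax xb]; rewrite in_itv /= (le_trans a0 ax) (le_trans xb b1).
rewrite (eq_integral (fun=> 1%:E)); last first.
  move=> x; rewrite inE /= => /andP[ax xb]; rewrite /uniform_pdf (le_trans a0 ax) (le_trans xb b1) /=.
  by rewrite subr0 invr1.
rewrite integral_cst//=; last exact: measurable_setcc.
rewrite -set_itvcc lebesgue_measure_itv/= lte_fin mul1e.
by move: ab; rewrite le_eqVlt => /orP[/eqP ->|ab]; rewrite ?ltxx ?subrr// ab.
Qed.

Lemma pr_unif_le (t : R) : pr unif [set x | x <= t] = clamp t.
Proof.
have h01 : pr unif [set x | 0 <= x <= 1] = 1 by rewrite pr_unif_cc// subr0.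
have m01 := measurable_setcc (0 : R) 1.
rewrite -(pr_setI1 (measurable_setle t) m01 h01).
have [t0|t0] := ltP t 0.
  rewrite clamp_lt0 ?ltW// (_ : _ `&` _ = set0) ?pr0//.
  by apply/seteqP; split => // x [/= xt /andP[x0 _]]; move: (le_lt_trans x0 (le_lt_trans xt t0)); rewrite ltxx.
have [t1|t1] := lerP t 1.
  rewrite clamp_id ?t0// -[RHS]subr0 -(pr_unif_cc (lexx 0) t0 t1); congr pr.
  apply/seteqP; split => [x [/= xt /andP[x0 x1]]|x /= /andP[x0 xt]]; first by rewrite x0 xt.
  by rewrite x0 xt (le_trans xt t1).
rewrite clamp_gt1 ?ltW// -[RHS]h01; congr pr.
apply/seteqP; split => [x [] //|x /= /andP[x0 x1]]; split; last by rewrite x0 x1.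
by rewrite (le_trans x1)// ltW.
Qed.

Lemma pr_unif01 : pr unif [set x | 0 <= x <= 1] = 1.
Proof. by rewrite pr_unif_cc// subr0. Qed.

Lemma pr_unif_seg (a b : R) : a <= b ->
  pr unif [set x | a <= x <= b] = clamp b - clamp a.
Proof.
move=> ab.
have h01 : pr unif [set x | 0 <= x <= 1] = 1 by rewrite pr_unif_cc// subr0.
rewrite -(pr_setI1 (measurable_setcc a b) (measurable_setcc 0 1) h01).
rewrite (_ : _ `&` _ = [set x | Num.max a 0 <= x <= Num.min b 1]); last first.
  apply/seteqP; split => [x [/= /andP[xa xb] /andP[x0 x1]]|x /=].
    by rewrite ge_max le_min xa xb x0 x1.
  by rewrite ge_max le_min => /andP[/andP[-> ->] /andP[-> ->]].
have [ab'|ab'] := leP (Num.max a 0) (Num.min b 1).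
  rewrite pr_unif_cc// ?le_max ?lexx ?orbT//; last by rewrite ge_min lexx orbT.
  move: ab'; rewrite ge_max !le_min => /andP[/andP[_ a1] /andP[b0 _]].
  by rewrite /clamp (max_l b0) (min_l (_ : Num.max a 0 <= 1))// ge_max a1 ler01.
rewrite (_ : [set x | _] = set0); last first.
  by apply/seteqP; split => // x /= /andP[h1 h2]; move: ab'; rewrite ltNge (le_trans h1 h2).
rewrite pr0; apply/esym/eqP; rewrite subr_eq0; apply/eqP.
move: ab'; rewrite gt_min !lt_max => /orP[]/orP[h|h].
- by move: ab; rewrite leNgt h.
- by rewrite !clamp_lt0// ?ltW// (le_lt_trans ab h).
- by rewrite !clamp_gt1// ltW// (lt_le_trans h ab).
- by move: h; rewrite ltNge ler01.
Qed.

Lemma pr_lebesgue_cube_box m (B : 'I_m -> set R) : (forall i, measurable (B i)) ->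
  pr (lebesgue_cube m) [set x | forall i, B i (tnth x i)] = \prod_i pr unif (B i).
Proof.
move=> mB; apply: EFin_inj; rewrite -prE; last exact: measurable_box.
elim: m B mB => [|m IH] B mB.
  by rewrite big_ord0 (_ : [set x | _] = setT) ?probability_setT//; apply/seteqP; split => // x _ [].
rewrite big_ord_recl EFinM -(IH (fun i => B (lift ord0 i)))//.
rewrite -prE// unifE//= /distribution /pushforward /=.
rewrite -product_measure1E//=;
  [|exact: (mB ord0)|exact: (@measurable_box _ _ (fun i => B (lift ord0 i)))].
congr ((_ \x _)%E _); apply/seteqP; split => [[x y] /= h|[x y] /= [h1 h2] i].
  by split; [exact: (h ord0)|move=> i; have := h (lift ord0 i); rewrite tnthS].
by have [j ->|->//] := unliftP ord0 i; rewrite tnthS; exact: h2.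
Qed.

Lemma pr_lebesgue_cube_cube m : pr (lebesgue_cube m) (@cube R m) = 1.
Proof.
rewrite (@pr_lebesgue_cube_box _ (fun i => [set x | 0 <= x <= 1])).
  by rewrite big1// => i _; rewrite pr_unif01.
by move=> i; exact: measurable_setcc.
Qed.

Lemma pr_lebesgue_cube_orthant m (u : m.-tuple R) :
  pr (lebesgue_cube m) (lower_orthant u) = \prod_i clamp (tnth u i).
Proof.
rewrite (@pr_lebesgue_cube_box _ (fun i => [set x | x <= tnth u i])).
  by apply: eq_bigr => i _; rewrite pr_unif_le.
by move=> i; exact: measurable_setle.
Qed.

Definition rcons_pair m (p : m.-tuple R * R) : m.+1.-tuple R :=
  [tuple of rcons p.1 p.2].

Lemma measurable_rcons_pair m : measurable_fun setT (@rcons_pair m).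
Proof. by apply: measurable_rcons. Qed.

Lemma tnth_rcons_max m (x : m.-tuple R) (t : R) : tnth [tuple of rcons x t] ord_max = t.
Proof. by rewrite (tnth_nth 0) /= nth_rcons size_tuple ltnn eqxx. Qed.

Lemma tnth_rcons_widen m (x : m.-tuple R) (t : R) (i : 'I_m) :
  tnth [tuple of rcons x t] (widen_ord (leqnSn m) i) = tnth x i.
Proof. by rewrite !(tnth_nth 0) /= nth_rcons size_tuple ltn_ord. Qed.

Lemma forall_ordS m (Q : 'I_m.+1 -> Prop) :
  (forall i, Q i) <-> (forall i : 'I_m, Q (widen_ord (leqnSn m) i)) /\ Q ord_max.
Proof.
split => [h|[h1 h2] i]; first by split => // i; exact: h.
have [im|im] := ltnP i m.
  by have := h1 (Ordinal im); congr Q; exact: val_inj.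
suff -> : i = ord_max by [].
by apply: val_inj => /=; apply/eqP; rewrite eqn_leq im -ltnS ltn_ord.
Qed.

(** [lebesgue_cube] grows at the front, while conditioning adds coordinates at the end. The two
    decompositions are matched through orthants, whose masses are the same product of clamps. *)
Lemma first_coords_lebesgue_cube m k (km : (k < m)%N) (E : set (k.+1.-tuple R)) :
  measurable E ->
  lebesgue_cube m (@first_coords R m k.+1 @^-1` E) =
  (lebesgue_cube k \x unif)%E (@rcons_pair k @^-1` E).
Proof.
move=> mE.
apply: (preimage_tuple_unique (P := lebesgue_cube m) (Q := (lebesgue_cube k \x unif)%E)
  (measurable_first_coords km) (@measurable_rcons_pair k) _ mE) => u.
(* Coordinates of index above k are unconstrained and contribute the factor 1. *)
pose B (i : 'I_m) := [set x | (i < k.+1)%N -> x <= nth 0 u i].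
have mB i : measurable (B i).
  rewrite /B; case: ltnP => ik; last first.
    by rewrite (_ : [set x | _] = setT)//; apply/seteqP; split.
  rewrite (_ : [set x | _] = [set x | x <= nth 0 u i]); first exact: measurable_setle.
  by apply/seteqP; split => [x h|x h _]; [exact: h isT|exact: h].
have -> : first_coords k.+1 @^-1` lower_orthant u = [set x | forall i, B i (tnth x i)].
  apply/seteqP; split => [x h i ik|x h i].
    have := h (Ordinal ik); rewrite /first_coords tnth_mktuple (tnth_nth 0 u) /=.
    by rewrite (tnth_nth 0).
  have im : (i < m)%N by exact: leq_trans (ltn_ord i) km.
  rewrite tnth_mktuple; have := h (Ordinal im) (ltn_ord i).
  by rewrite (tnth_nth 0 x) (tnth_nth 0 u).
have mu' := @measurable_lower_orthant R.
set u1 := [tuple tnth u (widen_ord (leqnSn k) i) | i < k].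
have -> : @rcons_pair k @^-1` lower_orthant u =
    lower_orthant u1 `*` [set x | x <= tnth u ord_max].
  apply/seteqP; split => [[x t] /= /forall_ordS[h1 h2]|[x t] /= [h1 h2]].
    split => /=; last by move: h2; rewrite /rcons_pair tnth_rcons_max.
    by move=> i; have := h1 i; rewrite /rcons_pair tnth_rcons_widen tnth_mktuple.
  apply/forall_ordS; rewrite /rcons_pair tnth_rcons_max; split => // i.
  by rewrite tnth_rcons_widen; have := h1 i; rewrite tnth_mktuple.
rewrite !prE; last 2 first.
- by apply: measurableX; [exact: mu'|exact: measurable_setle].
- exact: measurable_box.
rewrite prX; [|exact: mu'|exact: measurable_setle].
rewrite pr_lebesgue_cube_box// pr_lebesgue_cube_orthant pr_unif_le; congr EFin.
under [in RHS]eq_bigr do rewrite tnth_mktuple.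
transitivity (\prod_(i < k.+1) clamp (tnth u i)); last first.
  by rewrite big_ord_recr.
transitivity (\prod_(i < m | (i < k.+1)%N) clamp (nth 0 u i)).
  rewrite [RHS]big_mkcond; apply: eq_bigr => i _; rewrite /B; case: ifPn => ik.
    by rewrite -pr_unif_le; congr pr; apply/seteqP; split => [x h|x h _]; [exact: h isT|exact: h].
  by rewrite -[RHS](prT unif); congr (pr _ _); apply/seteqP; split.
rewrite -(big_mkord (fun i => (i < k.+1)%N) (fun i => clamp (nth 0 u i))).
rewrite (big_cat_nat _ (n := k.+1))//= [X in _ * X]big_nat_cond [X in _ * X]big_pred0; last first.
  by move=> i; apply/negP => /andP[/andP[h _]]; rewrite ltnS leqNgt h.
rewrite mulr1 big_mkord big_mkcond; apply: eq_bigr => i _; rewrite ltn_ord.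
by rewrite (tnth_nth 0).
Qed.

End lebesgue_cube_theory.

Section graphs.
Context {R : realType} d (T : measurableType d).

Lemma measurable_set_le (f g : T -> R) : measurable_fun setT f -> measurable_fun setT g ->
  measurable [set x | f x <= g x].
Proof.
move=> mf mg; have := @measurable_fun_ler _ _ _ _ _ _ mf mg measurableT [set true] Logic.I.
by rewrite setTI; congr measurable; apply/seteqP; split.
Qed.

Lemma measurable_set_lt (f g : T -> R) : measurable_fun setT f -> measurable_fun setT g ->
  measurable [set x | f x < g x].
Proof.
move=> mf mg; have := @measurable_fun_ltr _ _ _ _ _ _ mf mg measurableT [set true] Logic.I.
by rewrite setTI; congr measurable; apply/seteqP; split.
Qed.

End graphs.

Section under_graph.
Context {R : realType} d (T : measurableType d).

Lemma measurable_preimage_fst d' (T' : measurableType d') (E : set T) : measurable E ->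
  measurable [set p : T * T' | E p.1].
Proof. by move=> mE; rewrite -[X in measurable X]setTI; exact: measurable_fst. Qed.

Lemma measurable_under_graph (h : T -> R) (E : set T) : measurable_fun setT h ->
  measurable E -> measurable [set p : T * R | E p.1 /\ p.2 <= h p.1].
Proof.
move=> mh mE; apply: measurableI; first exact: measurable_preimage_fst.
apply: (measurable_set_le (f := snd) (g := h \o fst)) => //.
exact: measurableT_comp.
Qed.

(** The section at x is the half-line below [h x], of uniform mass [h x]. Integrals of densities
    thus become probabilities of sets, to which the calculus of [pr] applies. *)
Lemma pr_under_graph (P : probability T R) (h : T -> R) (E : set T) :
  measurable_fun setT h -> (forall x, 0 <= h x <= 1) -> measurable E ->
  (P \x unif)%E [set p : T * R | E p.1 /\ p.2 <= h p.1] =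
  (\int[P]_(x in E) (h x)%:E)%E.
Proof.
move=> mh h01 mE; rewrite [LHS]pr_productE; last exact: measurable_under_graph.
rewrite [RHS]integral_mkcond; apply: eq_integral => x _; rewrite patchE.
case: ifPn => [/set_mem Ex|/negP xE].
  rewrite -(clamp_id (h01 x)) -pr_unif_le -prE; last exact: measurable_setle.
  by congr (unif _); apply/seteqP; split => t; rewrite /xsection /= inE /= => -[].
rewrite (_ : xsection _ _ = set0) ?measure0//; apply/seteqP; split => // t.
by rewrite /xsection /= inE /= => -[Ex _]; apply: xE; rewrite inE.
Qed.

End under_graph.

(** * Disintegration *)

Section conditional_probability.
Context {R : realType} d d1 (T : measurableType d) (T1 : measurableType d1).
Variables (mu : probability T R) (f : T -> T1) (mf : measurable_fun setT f).
Variables (D : set T) (mD : measurable D).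

Definition restricted_law (E : set T1) : \bar R := mu (f @^-1` E `&` D).

Let mpre E : measurable E -> measurable (f @^-1` E).
Proof. by move=> mE; rewrite -[X in measurable X]setTI; exact: mf. Qed.

Let nu00 : restricted_law set0 = 0%E.
Proof. by rewrite /restricted_law preimage_set0 set0I measure0. Qed.

Let nu0_ge0 E : (0 <= restricted_law E)%E.
Proof. exact: measure_ge0. Qed.

Let nu0_sigma : semi_sigma_additive restricted_law.
Proof.
move=> F mF tF mU; rewrite /restricted_law preimage_bigcup.
apply: (@measure_semi_sigma_additive _ _ _ (mrestr mu mD) (fun n => f @^-1` F n)) => //.
- by move=> n; exact: mpre.
- by apply/trivIsetP => i j _ _ ij; rewrite -preimage_setI; move/trivIsetP : tF => ->//; rewrite preimage_set0.
- by rewrite -preimage_bigcup; exact: mpre.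
Qed.

HB.instance Definition _ := isMeasure.Build _ _ _ restricted_law nu00 nu0_ge0 nu0_sigma.

Let nu0_fin : fin_num_fun restricted_law.
Proof. by move=> E mE; rewrite fin_num_measure//; apply: measurableI => //; exact: mpre. Qed.

HB.instance Definition _ := @Measure_isFinite.Build _ _ _ restricted_law nu0_fin.

(* h is the Radon-Nikodym derivative of restricted_law; the area under its graph,
   measured by the product with unif, is its integral. *)
Lemma conditional_probability : exists h : T1 -> R,
  [/\ measurable_fun setT h, forall x, 0 <= h x <= 1 &
   forall E, measurable E ->
     pr (law mu mf \x unif)%E [set p | E p.1 /\ p.2 <= h p.1] = pr mu (f @^-1` E `&` D)].
Proof.
have dom : restricted_law `<< law mu mf.
  apply/null_content_dominatesP => E mE E0.
  apply/eqP; rewrite -measure_le0 -E0 -[leRHS]/(mu (f @^-1` E)); apply: le_measure; rewrite ?inE//=.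
  - by apply: measurableI => //; exact: mpre.
  - exact: mpre.
have [g [g0 gfin gint gE]] := radon_nikodym_sigma_finite dom.
have mg : measurable_fun setT (fine \o g) by apply: measurableT_comp => //; exact: measurable_int gint.
(* The derivative is at most 1 only almost everywhere; the cap makes the bound hold everywhere. *)
pose h x := Num.min (fine (g x)) 1.
have mh : measurable_fun setT h by apply: measurable_minr.
have h01 x : 0 <= h x <= 1 by rewrite /h le_min ler01 ge_min lexx orbT fine_ge0.
exists h; split => // E mE; congr fine.
rewrite [LHS](pr_under_graph (law mu mf) mh h01 mE) -[RHS]/(restricted_law E).
have mEh E' : measurable_fun E' (EFin \o h) by apply/measurable_EFinP; exact: measurable_funTS.
have mEg E' : measurable_fun E' g by apply: measurable_funTS; exact: measurable_int gint.
have h0 x : (0 <= (h x)%:E)%E by rewrite lee_fin; case/andP: (h01 x).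
apply/eqP; rewrite eq_le; apply/andP; split.
  rewrite gE//; apply: ge0_le_integral => // x _.
  by rewrite -[leRHS]fineK// lee_fin /h ge_min lexx.
(* Where the cap is active, h equals 1 and its integral is the full mass of that part of E, which
   dominates the restricted mass. Elsewhere h is the derivative itself. *)
pose B := [set x | 1 < fine (g x)].
have mB : measurable B by apply: measurable_set_lt.
have mEB := measurableI _ _ mE mB; have mED := measurableD mE mB.
have EE : E = (E `&` B) `|` (E `\` B) by rewrite setUIDK.
rewrite {1}EE measureU//; last by rewrite setDE setIACA setICr setI0.
rewrite [in leRHS]EE ge0_integral_setU//=; last first.
  by apply/disj_set2P; rewrite setDE setIACA setICr setI0.
apply: leeD.
  apply: (@le_trans _ _ (law mu mf (E `&` B))).
    rewrite -[leRHS]/(mu (f @^-1` (E `&` B))); apply: le_measure; rewrite ?inE//=; last exact: mpre.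
    by apply: measurableI => //; exact: mpre.
  rewrite -[leLHS]mul1e -integral_cst//.
  apply: ge0_le_integral => // x [_ Bx]; rewrite lee_fin /h le_min lexx andbT.
  exact: ltW.
rewrite gE//; apply: ge0_le_integral => // x [_ Bx].
by rewrite -[leLHS]fineK// lee_fin /h le_min lexx /= leNgt; apply/negP.
Qed.

End conditional_probability.

Lemma pr_bigcup_rat0 {R : realType} d (T : measurableType d) (mu : probability T R)
    (N : rat -> set T) : (forall q, measurable (N q)) -> (forall q, pr mu (N q) = 0) ->
  pr mu (\bigcup_q N q) = 0.
Proof.
move=> mN N0; pose g n : option rat := choice.unpickle n.
have gK q : g (choice.pickle q) = Some q by exact: choice.pickleK.
clearbody g; pose F n := if g n is Some q then N q else set0.
have FE : \bigcup_q N q = \bigcup_n F n.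
  apply/seteqP; split => [p [q _ Nq]|p [n _]].
    by exists (choice.pickle q) => //; rewrite /F gK.
  by rewrite /F; case: (g n) => [q Nq|[]]; exists q.
have mF n : measurable (F n) by rewrite /F; case: (g n).
have neg : (mu : {measure set T -> \bar R}).-negligible (\bigcup_n F n).
  apply: (@negligible_bigcup _ _ _ mu) => n; apply/negligibleP => //.
  rewrite /F; case: (g n) => [q|]; last by rewrite measure0.
  by transitivity (pr mu (N q))%:E; [exact: prE|rewrite N0].
have mUF : measurable (\bigcup_n F n) by exact: bigcupT_measurable.
by rewrite FE; move/(negligibleP mu mUF) : neg => h0; rewrite -[RHS]/(fine 0%E); congr fine.
Qed.

Section conditional_quantile.
Context {R : realType} (k : nat).
Variables (mu : probability (k.+1.-tuple R) R).
Hypothesis mu01 : pr mu [set x | 0 <= last_coord x <= 1] = 1.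

Let fc := @first_coords R k.+1 k.

Let mfc : measurable_fun setT fc.
Proof. exact: measurable_first_coords. Qed.

Let mle (t : R) : measurable [set x : k.+1.-tuple R | last_coord x <= t].
Proof. exact: (measurable_tnth_preimage ord_max (measurable_setle t)). Qed.

Let mlt (t : R) : measurable [set x : k.+1.-tuple R | last_coord x < t].
Proof. exact: (measurable_tnth_preimage ord_max (measurable_setlt t)). Qed.

Let m01 : measurable [set x : k.+1.-tuple R | 0 <= last_coord x <= 1].
Proof. exact: (measurable_tnth_preimage ord_max (measurable_setcc 0 1)). Qed.

Let mu1 := law mu mfc.

Let h (q : rat) : k.-tuple R -> R :=
  sval (cid (conditional_probability mu mfc (mle (ratr q)))).

Let mh q : measurable_fun setT (h q).
Proof. by rewrite /h; case: cid => ? []. Qed.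

Let prh q E : measurable E ->
  pr (mu1 \x unif)%E [set p | E p.1 /\ p.2 <= h q p.1] =
  pr mu (fc @^-1` E `&` [set x | last_coord x <= ratr q]).
Proof. by rewrite /h; case: cid => ? [? ?]; exact. Qed.

(* The element 1 keeps the infimum below from being taken over the empty set. *)
Let S (p : k.-tuple R * R) : set R :=
  [set r | r = 1 \/ exists2 q : rat, r = ratr q & 0 <= r <= 1 /\ p.2 <= h q p.1].

(** The generalized inverse of [q |-> h q x], with [h q] a version of the conditional probability of
    Y <= q. The versions are not made monotone in q; the pairs at which they are in the wrong order
    are shown to be null. *)
Definition cond_quantile (p : k.-tuple R * R) : R := inf (S p).

Let S1 p : S p 1. Proof. by left. Qed.

Let S_lb p : lbound (S p) 0.
Proof. by move=> r [->|[q _ [/andP[]]]]. Qed.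

Lemma cond_quantile_lt p t : cond_quantile p < t <-> exists2 r, S p r & r < t.
Proof.
split => [|[r Sr rt]].
  by move/inf_lt => /(_ (ex_intro _ 1 (S1 p))).
by apply: le_lt_trans rt; apply: ge_inf => //; exists 0; exact: S_lb.
Qed.

Let G t := [set p | cond_quantile p < t].

(** The strict inequality turns the event into a countable union over rationals, hence a measurable
    set. *)
Let GE t : G t = [set p | 1 < t] `|`
  \bigcup_(q : rat) ([set p | 0 <= (ratr q : R) <= 1 /\ (ratr q : R) < t] `&` [set p | p.2 <= h q p.1]).
Proof.
apply/seteqP; split => [p /cond_quantile_lt[r [->|[q -> [q01 pq]] rt]]|p [/= t1|[q _ [[q01 qt] pq]]]].
- by left.
- by right; exists q.
- by apply/cond_quantile_lt; exists 1.
- by apply/cond_quantile_lt; exists (ratr q) => //; right; exists q.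
Qed.

Let measurable_cst_set d (T : measurableType d) (Q : Prop) : measurable [set _ : T | Q].
Proof.
have [q|q] := pselect Q.
  by rewrite (_ : [set _ | _] = setT)//; apply/seteqP; split.
by rewrite (_ : [set _ | _] = set0)//; apply/seteqP; split.
Qed.

Let mgraph q : measurable [set p : k.-tuple R * R | p.2 <= h q p.1].
Proof.
apply: (measurable_set_le (f := snd) (g := h q \o fst)) => //.
exact: measurableT_comp.
Qed.

Let mG t : measurable (G t).
Proof.
rewrite GE; apply: measurableU; first exact: measurable_cst_set.
apply: bigcupT_measurable_rat => q; apply: measurableI; [exact: measurable_cst_set|].
exact: mgraph.
Qed.

Lemma measurable_cond_quantile : measurable_fun setT cond_quantile.
Proof.
apply: (@measurability _ _ _ _ _ _ (@RGenInftyO.G R)).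
  exact: RGenInftyO.measurableE.
move=> _ [_ [t ->] <-]; by rewrite setTI; have := mG t; rewrite /G -set_itvNyo.
Qed.

Let mpre (E : set (k.-tuple R)) : measurable E -> measurable (fc @^-1` E).
Proof. by move=> mE; rewrite -[X in measurable X]setTI; exact: mfc. Qed.

(** With g the conditional probability of Y < t, each [h q] with q < t lies below g almost
    everywhere. Up to a null set, Q(x, r) < t therefore forces r <= g x, and the area under g is the
    wanted mass. *)
Let quantile_law_le E t : measurable E -> t <= 1 ->
  pr (mu1 \x unif)%E [set p | E p.1 /\ cond_quantile p < t] <=
  pr mu (fc @^-1` E `&` [set x | last_coord x < t]).
Proof.
move=> mE t1.
have [g [mg g01 gE]] := conditional_probability mu mfc (mlt t).
have mE1 : measurable [set p : k.-tuple R * R | E p.1] by exact: measurable_preimage_fst.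
(* The pairs at which the versions for Y <= q and for Y < t are in the wrong order. *)
pose N q : set (k.-tuple R * R) := [set _ | (ratr q : R) < t] `&` [set p | g p.1 < p.2 <= h q p.1].
have mN q : measurable (N q).
  apply: measurableI; first exact: measurable_cst_set.
  rewrite (_ : [set p | _] = [set p | g p.1 < p.2] `&` [set p | p.2 <= h q p.1]).
    apply: measurableI; last exact: mgraph.
    apply: (measurable_set_lt (g := snd) (f := g \o fst)) => //.
    exact: measurableT_comp.
  by apply/seteqP; split => p /=; [move/andP|move=> [-> ->]].
have N0 q : pr (mu1 \x unif)%E (N q) = 0.
  have [qt|qt] := ltP (ratr q) t; last first.
    by rewrite (_ : N q = set0) ?pr0//; apply/seteqP; split => // p [/=]; rewrite ltNge qt.
  apply/eqP; rewrite eq_le pr_ge0 andbT.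
  (* Over B the region between the two graphs has area P(X in B, Y <= q) - P(X in B, Y < t), which
     cannot be positive. *)
  pose B := [set x | g x < h q x].
  have mB : measurable B by exact: measurable_set_lt.
  have mBh := measurable_under_graph (mh q) mB.
  have mBg := measurable_under_graph mg mB.
  have -> : N q = [set p | B p.1 /\ p.2 <= h q p.1] `\` [set p | B p.1 /\ p.2 <= g p.1].
    apply/seteqP; split => [p [_ /= /andP[gp ph]]|p [[Bp ph] h']].
      split; first by split => //; rewrite /B /= (lt_le_trans gp).
      by move=> [_]; rewrite leNgt gp.
    split => //=; rewrite ph andbT ltNge; apply/negP => pg.
    by apply: h'; split.
  rewrite prD//; last by move=> p [Bp pg]; split => //; exact: le_trans pg (ltW Bp).
  rewrite prh// (gE _ mB) subr_le0.
  apply: le_pr; [by apply: measurableI => //; exact: mpre..|].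
  by apply: setIS => x /= /le_lt_trans; exact.
have mU : measurable (\bigcup_q N q) by exact: bigcupT_measurable_rat.
have U0 : pr (mu1 \x unif)%E (\bigcup_q N q) = 0.
  exact: pr_bigcup_rat0.
have mEg := measurable_under_graph mg mE.
apply: (@le_trans _ _ (pr (mu1 \x unif)%E
    ([set p | E p.1 /\ p.2 <= g p.1] `|` \bigcup_q N q))).
  apply: le_pr; [by apply: measurableI => //; exact: mG|exact: measurableU|].
  move=> p [Ep]; rewrite -[X in X -> _]/(G t p) GE => -[/=|[q _ [/= [_ qt] pq]]].
    by rewrite ltNge t1.
  have [pg|gp] := leP p.2 (g p.1); first by left.
  by right; exists q => //; split => //=; rewrite gp pq.
apply: (le_trans (prU_le _ _ _)) => //.
by rewrite U0 addr0 (gE _ mE).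
Qed.

(** The event Y < t is exhausted by the events Y <= t - 1/(n+1), and a rational between t - 1/(n+1)
    and t is a competitor in the infimum. When t - 1/(n+1) is negative the event is null, as Y lives
    on [0, 1]. *)
Let quantile_law_ge E t : measurable E -> t <= 1 ->
  pr mu (fc @^-1` E `&` [set x | last_coord x < t]) <=
  pr (mu1 \x unif)%E [set p | E p.1 /\ cond_quantile p < t].
Proof.
move=> mE t1.
have mE1 : measurable [set p : k.-tuple R * R | E p.1] by exact: measurable_preimage_fst.
pose F n := fc @^-1` E `&` [set x | last_coord x <= t - n.+1%:R^-1].
have mF n : measurable (F n) by apply: measurableI => //; exact: mpre.
have FE : fc @^-1` E `&` [set x | last_coord x < t] = \bigcup_n F n.
  apply/seteqP; split => [x [Ex /= xt]|x [n _ [Ex /= xt]]]; last first.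
    by split => //=; apply: le_lt_trans xt _; rewrite gtrBl invr_gt0.
  have : 0 < t - last_coord x by rewrite subr_gt0.
  set e := (t - last_coord x) => e0.
  exists (Num.truncn e^-1) => //; split => //=.
  rewrite lerBrDr -lerBrDl -/e -[leRHS]invrK lef_pV2 ?posrE ?invr_gt0//.
  by apply: ltW; exact: truncnS_gt.
have Fcvg : pr mu (F n) @[n --> \oo] --> pr mu (\bigcup_n F n).
  apply: pr_bigcup_cvg => // m n mn; apply/subsetPset => x [Ex /= xt]; split => //=.
  by rewrite (le_trans xt)// lerD2l lerN2 lef_pV2 ?posrE// ler_nat.
rewrite FE -(cvg_lim _ Fcvg)//; apply: limr_le.
  by apply/cvg_ex; eexists; exact: Fcvg.
apply: nearW => n.
have mQ : measurable [set p | E p.1 /\ cond_quantile p < t].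
  by apply: measurableI => //; exact: mG.
have [tn|tn] := ltP (t - n.+1%:R^-1) 0.
  rewrite (_ : pr mu (F n) = 0) ?pr_ge0//.
  rewrite -[RHS](pr0 mu); apply: pr_eq_on mu01 _ => //.
  rewrite set0I; apply/seteqP; split => // x [[_ /= xt] /andP[x0 _]].
  by move: (le_lt_trans x0 (le_lt_trans xt tn)); rewrite ltxx.
have /rat_in_itvoo[q /itvP qt] : t - n.+1%:R^-1 < t by rewrite gtrBl invr_gt0.
apply: (@le_trans _ _ (pr mu (fc @^-1` E `&` [set x | last_coord x <= ratr q]))).
  apply: le_pr => //; first by apply: measurableI => //; exact: mpre.
  by move=> x [Ex /= xt]; split => //=; rewrite (le_trans xt)// qt.
rewrite -(prh q mE); apply: (le_pr _ (measurable_under_graph (mh q) mE) mQ).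
move=> p [Ep ph]; split => //; apply/cond_quantile_lt; exists (ratr q); last by rewrite qt.
right; exists q => //; split => //.
by rewrite (le_trans tn) ?qt//= (le_trans _ t1)// qt.
Qed.

Let quantile_law_lt E t : measurable E ->
  pr (mu1 \x unif)%E [set p | E p.1 /\ cond_quantile p < t] =
  pr mu (fc @^-1` E `&` [set x | last_coord x < t]).
Proof.
move=> mE; have [t1|t1] := lerP t 1.
  by apply/eqP; rewrite eq_le quantile_law_le ?quantile_law_ge.
transitivity (pr mu (fc @^-1` E)).
  rewrite (_ : [set p | _] = E `*` setT); last first.
    apply/seteqP; split => [p []//|p [Ep _]]; split => //.
    by apply/cond_quantile_lt; exists 1.
  by rewrite prX// prT mulr1.
apply: pr_eq_on mu01 _ => //; [exact: mpre|by apply: measurableI => //; exact: mpre|].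
apply/seteqP; split => [x [Ex x01]|x [[Ex _] x01]]; split => //; split => //=.
by move: x01 => /= /andP[_ x1]; exact: le_lt_trans x1 t1.
Qed.

Definition rcons_quantile (p : k.-tuple R * R) : k.+1.-tuple R :=
  [tuple of rcons p.1 (cond_quantile p)].

Lemma measurable_rcons_quantile : measurable_fun setT rcons_quantile.
Proof. by apply: measurable_rcons => //; exact: measurable_cond_quantile. Qed.

(** Closed orthants are decreasing limits of the events with strict levels t + 1/(n+1) treated
    above, and orthants determine the law. Hence (X, Q(X, T)), with T uniform and independent of X,
    is distributed as mu. *)
Lemma rcons_quantile_law G' : measurable G' ->
  (mu1 \x unif)%E (rcons_quantile @^-1` G') = mu G'.
Proof.
move=> mG'; rewrite -[RHS]/(mu (id @^-1` G')).
apply: (preimage_tuple_unique (P := (mu1 \x unif)%E) (Q := mu)) mG' => //.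
  exact: measurable_rcons_quantile.
move=> u; rewrite preimage_id.
pose u1 := [tuple tnth u (widen_ord (leqnSn k) i) | i < k].
pose E := lower_orthant u1; have mE := measurable_lower_orthant u1.
pose t := tnth u ord_max.
pose A n := [set p | E p.1 /\ cond_quantile p < t + n.+1%:R^-1].
pose B n := fc @^-1` E `&` [set x | last_coord x < t + n.+1%:R^-1].
have mE1 : measurable [set p : k.-tuple R * R | E p.1] by exact: measurable_preimage_fst.
have mA n : measurable (A n) by apply: measurableI => //; exact: mG.
have mB n : measurable (B n) by apply: measurableI => //; exact: mpre.
have lim (r : R) : (forall n, r < t + n.+1%:R^-1) -> r <= t.
  move=> rt; rewrite leNgt; apply/negP => tr.
  have e0 : 0 < r - t by rewrite subr_gt0.
  have := rt (Num.truncn (r - t)^-1); rewrite -ltrBlDl ltNge => /negP; apply.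
  rewrite -[leRHS]invrK lef_pV2 ?posrE ?invr_gt0//.
  by apply: ltW; exact: truncnS_gt.
have ltn n (r : R) : r <= t -> r < t + n.+1%:R^-1.
  by move=> /le_lt_trans; apply; rewrite ltrDl invr_gt0.
have -> : rcons_quantile @^-1` lower_orthant u = \bigcap_n A n.
  apply/seteqP; split => [p /forall_ordS[h1 h2] n _|p hp].
    split => [i|]; last by apply: ltn; move: h2; rewrite tnth_rcons_max.
    by have := h1 i; rewrite tnth_rcons_widen tnth_mktuple.
  apply/forall_ordS; split => [i|]; last first.
    by rewrite tnth_rcons_max; apply: lim => n; have [] := hp n I.
  by have [/(_ i) + _] := hp 0%N I; rewrite tnth_rcons_widen tnth_mktuple.
have first_ord (x : k.+1.-tuple R) i : tnth (first_coords k x) i = tnth x (widen_ord (leqnSn k) i).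
  by rewrite tnth_mktuple (tnth_nth 0).
have -> : lower_orthant u = \bigcap_n B n.
  apply/seteqP; split => [x /forall_ordS[h1 h2] n _|x hx].
    split => [i|]; last exact: ltn.
    by rewrite first_ord tnth_mktuple.
  apply/forall_ordS; split => [i|]; last first.
    by apply: lim => n; have [] := hx n I.
  by have [/(_ i) + _] := hx 0%N I; rewrite first_ord tnth_mktuple.
have le m n : (m <= n)%N -> t + n.+1%:R^-1 <= t + m.+1%:R^-1.
  by move=> mn; rewrite lerD2l lef_pV2 ?posrE// ler_nat.
have cA : pr (mu1 \x unif)%E (A n) @[n --> \oo] --> pr (mu1 \x unif)%E (\bigcap_n A n).
  apply: pr_bigcap_cvg => // m n /le mn; apply/subsetPset => p [Ep pt]; split => //.
  exact: lt_le_trans pt mn.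
have cB : pr mu (B n) @[n --> \oo] --> pr mu (\bigcap_n B n).
  apply: pr_bigcap_cvg => // m n /le mn; apply/subsetPset => p [Ep pt]; split => //.
  exact: lt_le_trans pt mn.
rewrite !prE; [|exact: bigcapT_measurable..].
have cA' : pr mu (B n) @[n --> \oo] --> pr (mu1 \x unif)%E (\bigcap_n A n).
  rewrite (_ : (fun n => pr mu (B n)) = (fun n => pr (mu1 \x unif)%E (A n)))//.
  by apply/funext => n; rewrite quantile_law_lt.
by rewrite (cvg_unique _ cA' cB).
Qed.

(** The law of Q(x, T) for uniform T. It is a probability for every x, so no exceptional set has to
    be repaired. *)
Definition quantile_kernel (x : k.-tuple R) : {measure set R -> \bar R} :=
  law unif (measurableT_comp measurable_cond_quantile (pair1_measurable x)).

Let measurable_quantile_kernel U : measurable U ->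
  measurable_fun setT (quantile_kernel ^~ U).
Proof.
move=> mU; have mQU : measurable (cond_quantile @^-1` U).
  by rewrite -[X in measurable X]setTI; exact: measurable_cond_quantile.
rewrite (_ : quantile_kernel ^~ U = unif \o xsection (cond_quantile @^-1` U)).
  exact: measurable_fun_xsection.
by apply/funext => x /=; congr (unif _); apply/seteqP; split => t; rewrite /xsection /= inE.
Qed.

HB.instance Definition _ := isKernel.Build _ _ _ _ R
  quantile_kernel measurable_quantile_kernel.

HB.instance Definition _ := Kernel_isProbability.Build _ _ _ _ R
  quantile_kernel (fun x => probability_setT (law unif _)).

(** The law of (X, Q(X, T)) on a rectangle, integrated over T first. *)
Lemma kernel_exists : exists K : R.-pker (k.-tuple R) ~> R,
  forall E F, measurable E -> measurable F ->
    mu [set x | E (first_coords k x) /\ F (last_coord x)] =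
    (\int[mu]_(x in [set x | E (first_coords k x)]) K (first_coords k x) F)%E.
Proof.
exists quantile_kernel => E F mE mF.
have mX : measurable [set x : k.+1.-tuple R | E (first_coords k x) /\ F (last_coord x)].
  have mlF : measurable [set x : k.+1.-tuple R | F (last_coord x)].
    exact: (measurable_tnth_preimage ord_max mF).
  exact: (measurableI _ _ (mpre mE) mlF).
have mQF : measurable (cond_quantile @^-1` F).
  by rewrite -[X in measurable X]setTI; exact: measurable_cond_quantile.
rewrite -(rcons_quantile_law mX).
rewrite (_ : _ @^-1` _ = [set p | E p.1] `&` cond_quantile @^-1` F); last first.
  have fE p : first_coords k (rcons_quantile p) = p.1.
    apply: eq_from_tnth => i; rewrite tnth_mktuple (tnth_nth 0) /= nth_rcons size_tuple.
    by rewrite ltn_ord.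
  have lE p : last_coord (rcons_quantile p) = cond_quantile p by exact: tnth_rcons_max.
  by apply/seteqP; split => p; rewrite /= fE lE.
have mKF : measurable_fun E (quantile_kernel ^~ F).
  by apply: measurable_funTS; exact: measurable_quantile_kernel.
apply: (@eq_trans _ _ (\int[mu1]_(x in E) quantile_kernel x F)%E); last first.
  by apply: (ge0_integral_law mu mfc mE mKF) => x; exact: measure_ge0.
rewrite [LHS]pr_productE; last by apply: measurableI => //; exact: measurable_preimage_fst.
rewrite [RHS]integral_mkcond; apply: eq_integral => x _; rewrite patchE.
case: ifPn => [/set_mem Ex|/negP xE].
  by congr (unif _); apply/seteqP; split => t; rewrite /xsection /= inE /= => //; case.
rewrite (_ : xsection _ _ = set0); last first.
  apply/seteqP; split => // t.
  by rewrite /xsection /= inE /= => -[Ex _]; apply: xE; rewrite inE.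
exact: measure0.
Qed.

End conditional_quantile.

(** * The randomized probability integral transform *)

Section randomized_probability_integral_transform.
Context {R : realType} (mu : probability R R).
Hypothesis mu01 : pr mu [set x | 0 <= x <= 1] = 1.

(** The shape of [cond_df] for a single law: the mass below s plus the fraction q of the atom at s.
    The interval starts at 0 because mu is carried by [0, 1]. *)
Definition randomized_df (s q : R) : R :=
  pr mu `[0, s[%classic + q * pr mu [set s].

Let c s := pr mu [set x | x <= s].
Let l s := pr mu [set x | x < s].

Let m01 := measurable_setcc (0 : R) 1.

Let coE s : pr mu `[0, s[%classic = l s.
Proof.
apply: pr_eq_on mu01 _ => //; [exact: measurable_setlt|].
apply/seteqP; split => x; rewrite /= in_itv /= => -[xs x01]; split => //; first by case/andP: xs.
by case/andP: x01 => ->.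
Qed.

Let cE s : c s = l s + pr mu [set s].
Proof.
rewrite -prU//; [|exact: measurable_setlt|].
  congr pr; apply/seteqP; split => x /=; rewrite le_eqVlt.
    by case/predU1P => [->|]; [right|left].
  by case=> [->|->]; rewrite ?orbT// eqxx.
by apply/seteqP; split => // x [/= + xs]; rewrite xs ltxx.
Qed.

Let c_mono s t : s <= t -> c s <= c t.
Proof.
by move=> st; apply: le_pr; [exact: measurable_setle..|move=> x /= /le_trans; exact].
Qed.

Let c_lt0 s : s < 0 -> c s = 0.
Proof.
move=> s0; rewrite -(pr0 mu); apply: pr_eq_on mu01 _ => //; first exact: measurable_setle.
rewrite set0I; apply/seteqP; split => // x [/= xs /andP[x0 _]].
by move: (le_lt_trans x0 (le_lt_trans xs s0)); rewrite ltxx.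
Qed.

Let c1 : c 1 = 1.
Proof.
apply/eqP; rewrite eq_le pr_le1 /=; last exact: measurable_setle.
rewrite -[leLHS]mu01; apply: le_pr => //; first exact: measurable_setle.
by move=> x /= /andP[].
Qed.

Let c_right s t : (forall n, t <= c (s + n.+1%:R^-1)) -> t <= c s.
Proof.
move=> h; have E : [set x | x <= s] = \bigcap_n [set x | x <= s + n.+1%:R^-1].
  apply/seteqP; split => [x /= xs n _ /=|x xn /=].
    by rewrite (le_trans xs)// lerDl.
  rewrite leNgt; apply/negP => sx; have e0 : 0 < x - s by rewrite subr_gt0.
  have := xn (Num.truncn (x - s)^-1) I => /=; rewrite -lerBlDl leNgt => /negP; apply.
  rewrite -[ltRHS]invrK ltf_pV2 ?posrE ?invr_gt0//; exact: truncnS_gt.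
have : pr mu [set x | x <= s + n.+1%:R^-1] @[n --> \oo] --> c s.
  rewrite /c E; apply: pr_bigcap_cvg => [n|m n mn]; first exact: measurable_setle.
  apply/subsetPset => x /= /le_trans; apply.
  by rewrite lerD2l lef_pV2 ?posrE// ler_nat.
move=> cv; rewrite -(cvg_lim _ cv)//; apply: limr_ge; first by apply/cvg_ex; eexists; exact: cv.
exact: nearW.
Qed.

Let l_left s t : (forall r, r < s -> c r <= t) -> l s <= t.
Proof.
move=> h; have E : [set x | x < s] = \bigcup_n [set x | x <= s - n.+1%:R^-1].
  apply/seteqP; split => [x /= xs|x [n _ /= xn]]; last first.
    by rewrite (le_lt_trans xn)// gtrBl invr_gt0.
  have e0 : 0 < s - x by rewrite subr_gt0.
  exists (Num.truncn (s - x)^-1) => //=.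
  rewrite lerBrDr -lerBrDl -[leRHS]invrK lef_pV2 ?posrE ?invr_gt0//.
  by apply: ltW; exact: truncnS_gt.
have : pr mu [set x | x <= s - n.+1%:R^-1] @[n --> \oo] --> l s.
  rewrite /l E; apply: pr_bigcup_cvg => [n|m n mn]; first exact: measurable_setle.
  apply/subsetPset => x /= /le_trans; apply.
  by rewrite lerD2l lerN2 lef_pV2 ?posrE// ler_nat.
move=> cv; rewrite -(cvg_lim _ cv)//; apply: limr_le; first by apply/cvg_ex; eexists; exact: cv.
by apply: nearW => n; apply: h; rewrite gtrBl invr_gt0.
Qed.

Lemma randomized_df_le s q t : q <= 1 -> s <= t -> randomized_df s q <= c t.
Proof.
move=> q1 st; rewrite /randomized_df coE; apply: le_trans (c_mono st).
by rewrite cE lerD2l ler_piMl// pr_ge0.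
Qed.

(** Let s0 be the infimum of the points where the distribution function exceeds t. For q in [0, 1]
    the transform is at most t to the left of s0 and above t to the right. At s0 the randomizer
    accepts the fraction [(t - a) / pp] of the atom, if there is one, which completes the mass a of
    the left part to t. *)
Lemma randomized_df_uniform t : 0 <= t <= 1 ->
  measurable [set p | randomized_df p.1 p.2 <= t] ->
  pr (mu \x unif)%E [set p | randomized_df p.1 p.2 <= t] = t.
Proof.
move=> /andP[t0 t1] mW; set W := [set p | _].
pose H : set (R * R) := setT `*` [set q | 0 <= q <= 1].
have mH : measurable H by apply: measurableX.
have H1 : pr (mu \x unif)%E H = 1 by rewrite prX// prT mul1r pr_unif01.
move: t1; rewrite le_eqVlt => /predU1P[t1|t1].
  rewrite t1 -[RHS]H1; apply: pr_eq_on H1 _ => //.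
  apply/seteqP; split => [p []//|p [_ Hp]]; split => //.
  have [_ /= /andP[q0 q1]] := Hp; rewrite /W /= t1.
  by rewrite (le_trans (randomized_df_le q1 (lexx _)))// pr_le1//; exact: measurable_setle.
pose S := [set s | t < c s].
have S1 : S 1 by rewrite /S /= c1.
have Slb : has_lbound S.
  exists 0 => s; rewrite /S /= => ts; rewrite leNgt; apply/negP => s0.
  by move: ts; rewrite c_lt0// ltNge t0.
pose s0 := inf S.
have below r : r < s0 -> c r <= t.
  by move=> rs; rewrite leNgt; apply/negP => tr; move: rs; rewrite ltNge ge_inf.
have above r : s0 < r -> exists2 s, s < r & t < c s.
  by move=> /(inf_lt (ex_intro _ 1 S1))[s Ss sr]; exists s.
have tc : t <= c s0.
  apply: c_right => n; have [|s sr ts] := above (s0 + n.+1%:R^-1).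
    by rewrite ltrDl invr_gt0.
  by rewrite (le_trans (ltW ts))// c_mono// ltW.
have lt : l s0 <= t by exact: l_left.
set a := l s0; set pp := pr mu [set s0].
pose Q := [set q : R | 0 <= q <= 1 /\ a + q * pp <= t].
have mQ : measurable Q.
  apply: measurableI => //; apply: (measurable_set_le (f := fun q : R => a + q * pp) (g := cst t)) => //.
  by apply: measurable_funD => //; apply: measurable_funM.
have WH : W `&` H = ([set x | x < s0] `*` [set q | 0 <= q <= 1]) `|` ([set s0] `*` Q).
  apply/seteqP; split => [[s q] [/= Wsq [_ /= q01]]|[s q] [[/= ss q01]|[/= -> [q01 qt]]]].
  - have /andP[q0 q1] := q01.
    have [ss|ss|ss] := ltgtP s s0; [by left| |].
      exfalso; have [r rs tr] := above _ ss.
      move: Wsq; rewrite /W /= leNgt => /negP; apply; apply: (lt_le_trans tr).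
      rewrite /randomized_df coE (@le_trans _ _ (l s))// ?lerDl ?mulr_ge0 ?pr_ge0//.
      apply: le_pr; [exact: measurable_setle|exact: measurable_setlt|].
      by move=> x /= /le_lt_trans; exact.
    by right; rewrite ss; split => //; split => //; move: Wsq; rewrite /W /= /randomized_df coE ss.
  - have /andP[q0 q1] := q01; split; last by split.
    by rewrite /W /= (le_trans (randomized_df_le q1 (lexx _)))// below.
  - by split; [rewrite /W /= /randomized_df coE|split].
rewrite -(pr_setI1 mW mH H1) WH prU; last 3 first.
- by apply: measurableX => //; exact: measurable_setlt.
- exact: measurableX.
- apply/seteqP; split => // -[s q] [[/= ss _] [/= ss' _]].
  by move: ss; rewrite ss' ltxx.
rewrite !prX//; last exact: measurable_setlt.
rewrite pr_unif01 mulr1 -/a -/pp.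
have pp0 : 0 <= pp by exact: pr_ge0.
have ct : t <= a + pp by move: tc; rewrite cE.
move: pp0; rewrite le_eqVlt => /predU1P[pp0|pp0].
  rewrite -pp0 mul0r addr0; apply/eqP; rewrite eq_le lt /=.
  by move: ct; rewrite -pp0 addr0.
have -> : Q = [set q | 0 <= q <= (t - a) / pp].
  have r1 : (t - a) / pp <= 1 by rewrite ler_pdivrMr// mul1r lerBlDl.
  apply/seteqP; split => [q [/andP[q0 q1] qt]|q /= /andP[q0 qt]] /=.
    by rewrite q0 ler_pdivlMr// lerBrDl.
  split; first by rewrite q0 (le_trans qt).
  by rewrite -lerBrDl -ler_pdivlMr.
rewrite pr_unif_cc//; last 2 first.
- by rewrite divr_ge0 ?subr_ge0// ltW.
- by rewrite ler_pdivrMr// mul1r lerBlDl.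
by rewrite subr0 mulrC divfK ?gt_eqF// addrC subrK.
Qed.

End randomized_probability_integral_transform.

Section kernel_as_probability.
Context {R : realType} d (T : measurableType d) (K : R.-pker T ~> R).

(** An alias of [K x] that carries the structure of a probability, as [pr] requires. *)
Definition kprob (x : T) : set R -> \bar R := K x.

HB.instance Definition _ x := Measure.on (kprob x).
HB.instance Definition _ x := Measure_isProbability.Build _ _ R (kprob x) (prob_kernel x).

Section precomposition.
Context d' (S : measurableType d') (f : S -> T) (mf : measurable_fun setT f).

Definition kernel_comp (s : S) : {measure set R -> \bar R} := K (f s).

Let measurable_kernel_comp U : measurable U -> measurable_fun setT (kernel_comp ^~ U).
Proof.
by move=> mU; apply: (measurableT_comp (f := K ^~ U)) => //; exact: measurable_kernel.
Qed.

HB.instance Definition _ := isKernel.Build _ _ _ _ R kernel_comp measurable_kernel_comp.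
HB.instance Definition _ := Kernel_isProbability.Build _ _ _ _ R kernel_comp (fun s => prob_kernel (f s)).

Lemma measurable_kernel_section (B : set (S * R)) : measurable B ->
  measurable_fun setT (fun s => K (f s) (xsection B s)).
Proof.
move=> mB; apply: (@measurable_fun_xsection_finite_kernel _ _ _ _ _ kernel_comp).
by rewrite inE.
Qed.

Lemma measurable_kprob_section (B : set (S * R)) : measurable B ->
  measurable_fun setT (fun s => pr (kprob (f s)) (xsection B s)).
Proof.
by move=> mB; apply: measurableT_comp => //; exact: measurable_kernel_section.
Qed.

(** Both the interval below [g s] and the singleton of [g s] are sections at s of measurable sets,
    so measurability of a kernel along sections applies to each. *)
Lemma measurable_randomized_df (g q : S -> R) : measurable_fun setT g -> measurable_fun setT q ->
  measurable_fun setT (fun s => randomized_df (kprob (f s)) (g s) (q s)).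
Proof.
move=> mg mq; apply: measurable_funD; last (apply: measurable_funM => //).
- have mB : measurable [set p : S * R | 0 <= p.2 /\ p.2 < g p.1].
    apply: measurableI; first exact: (measurable_set_le (f := cst 0) (g := snd)).
    by apply: (measurable_set_lt (f := snd) (g := g \o fst)) => //; exact: measurableT_comp.
  have := measurable_kprob_section mB; congr (measurable_fun _ _); apply/funext => s.
  congr pr; apply/seteqP; split => t; rewrite /xsection /= inE /= in_itv /=; first by case=> -> ->.
  by case/andP.
- have mB : measurable [set p : S * R | p.2 <= g p.1 /\ g p.1 <= p.2].
    apply: measurableI.
      by apply: (measurable_set_le (f := snd) (g := g \o fst)) => //; exact: measurableT_comp.
    by apply: (measurable_set_le (g := snd) (f := g \o fst)) => //; exact: measurableT_comp.
  have := measurable_kprob_section mB; congr (measurable_fun _ _); apply/funext => s.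
  congr pr; apply/seteqP; split => t; rewrite /xsection /= inE /=; first by case=> h1 h2; apply/eqP; rewrite eq_le h1 h2.
  by move=> ->.
Qed.

End precomposition.
End kernel_as_probability.

Section disintegration.
Context {R : realType} d (T : measurableType d) (K : R.-pker T ~> R).
Variables (mu : probability T R) (nu : probability (T * R)%type R).
Hypothesis nuE : forall E F, measurable E -> measurable F ->
  nu (E `*` F) = (\int[mu]_(z in E) K z F)%E.

(** The semidirect product of mu and K, which agrees with nu on rectangles and hence everywhere. *)
Definition kernel_measure (G : set (T * R)) : \bar R := (\int[mu]_z K z (xsection G z))%E.

Let m0 : kernel_measure set0 = 0%E.
Proof. by rewrite /kernel_measure integral0_eq// => z _; rewrite xsection0 measure0. Qed.

Let m_ge0 G : (0 <= kernel_measure G)%E.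
Proof. by apply: integral_ge0 => z _; exact: measure_ge0. Qed.

Let mK (G : set (T * R)) : measurable G -> measurable_fun setT (fun z => K z (xsection G z)).
Proof. by move=> mG; exact: (measurable_kernel_section K (f := id)). Qed.

Let m_sigma : semi_sigma_additive kernel_measure.
Proof.
move=> F mF tF mUF.
rewrite [X in _ --> X](_ : _ = \sum_(n <oo) kernel_measure (F n))%E.
  by apply/cvg_closeP; split; [exact: is_cvg_nneseries|rewrite closeE].
rewrite -integral_nneseries//; last by move=> n; exact: mK.
apply: eq_integral => x _; apply/esym/cvg_lim => //=; rewrite xsection_bigcup.
apply: (measure_sigma_additive _ (trivIset_xsection tF)) => ?.
exact: measurable_xsection.
Qed.

HB.instance Definition _ := isMeasure.Build _ _ _ kernel_measure m0 m_ge0 m_sigma.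

Lemma kernel_disintegration G : measurable G ->
  nu G = (\int[mu]_z K z (xsection G z))%E.
Proof.
pose C : set (set (T * R)) :=
  [set C | exists A, measurable A /\ exists B, measurable B /\ C = A `*` B].
have CI : setI_closed C.
  move=> /= _ _ [X1 [mX1 [X2 [mX2 ->]]]] [Y1 [mY1 [Y2 [mY2 ->]]]].
  rewrite -setXI; exists (X1 `&` Y1); split; first exact: measurableI.
  by exists (X2 `&` Y2); split => //; exact: measurableI.
move=> mG; rewrite -[RHS]/(kernel_measure G).
apply: (measure_unique C (fun=> setT)) => //.
- rewrite measurable_prod_measurableType //; congr (<<s _ >>).
  rewrite predeqE; split => [[A mA [B mB <-]]|[A [mA [B [mB ->]]]]].
    by exists A; split => //; exists B.
  by exists A => //; exists B.
- by move=> _; exists setT; split => //; exists setT; split => //; rewrite setXTT.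
- by rewrite bigcup_const.
- move=> A [A1 [mA1 [A2 [mA2 ->]]]]; rewrite [LHS]nuE//.
  rewrite /= /kernel_measure integral_mkcond; apply: eq_integral => z _; rewrite patchE.
  by case: ifPn => zA; [rewrite in_xsectionX|rewrite notin_xsectionX// measure0].
- by move=> _; rewrite ltey_eq fin_num_measure.
Qed.

Hypothesis nu01 : pr nu [set p | 0 <= p.2 <= 1] = 1.

(** The kernel is controlled only through integrals, so full mass of nu on the strip yields the
    property for almost every z. *)
Lemma kernel_ae01 : {ae mu, forall z, pr (kprob K z) [set x | 0 <= x <= 1] = 1}.
Proof.
have m01 := measurable_setcc (0 : R) 1; have m01C := measurableC m01.
have h : (\int[mu]_z `|K z (~` [set x | (0 <= x <= 1)%R])| = 0)%E.
  transitivity (nu (setT `*` ~` [set x : R | 0 <= x <= 1])).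
    by rewrite nuE//; apply: eq_integral => z _; rewrite gee0_abs.
  rewrite (_ : _ `*` _ = ~` [set p | 0 <= p.2 <= 1]); last first.
    by apply/seteqP; split => [p []|p ?].
  have m2 : measurable [set p : T * R | 0 <= p.2 <= 1].
    by rewrite -[X in measurable X]setTI; exact: (measurable_snd measurableT _ m01).
  by rewrite prE ?prC ?nu01 ?subrr//; exact: measurableC.
have mKC : measurable_fun setT (K ^~ (~` [set x | 0 <= x <= 1])) by exact: measurable_kernel.
move/(ae_eq_integral_abs mu measurableT mKC) : h.
apply: filterS => z /(_ I) /= h.
have : pr (kprob K z) (~` [set x | 0 <= x <= 1]) = 0 by rewrite /pr h.
by rewrite prC// => /eqP; rewrite subr_eq0 => /eqP <-.
Qed.

Lemma measurable_randomized_df_le (c : T -> R) (E : set T) :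
  measurable_fun setT c -> measurable E ->
  measurable [set p : (T * R) * R | E p.1.1 /\ randomized_df (kprob K p.1.1) p.1.2 p.2 <= c p.1.1].
Proof.
move=> mc mE.
have mF : measurable_fun setT (fun p : (T * R) * R => randomized_df (kprob K p.1.1) p.1.2 p.2).
  apply: (@measurable_randomized_df _ _ _ K _ _ (fun p : (T * R) * R => p.1.1)
    _ (fun p : (T * R) * R => p.1.2) snd) => //; exact: measurableT_comp.
apply: measurableI.
  rewrite -[X in measurable X]setTI.
  by apply: (measurableT_comp (f := fst) (g := fst)).
apply: measurable_set_le => //.
by apply: (measurableT_comp (f := c)) => //; exact: measurableT_comp.
Qed.

(** Given z, the transform is uniform by [randomized_df_uniform], so it stays below [c z] with
    conditional probability [c z]. Constant c will give uniformity and independence of the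
    transformed coordinates; [c z = K z [0, t]] will recover the original one. *)
Lemma randomized_df_law (c : T -> R) (E : set T) :
  measurable_fun setT c -> (forall z, 0 <= c z <= 1) -> measurable E ->
  (nu \x unif)%E [set p | E p.1.1 /\ randomized_df (kprob K p.1.1) p.1.2 p.2 <= c p.1.1] =
  (\int[mu]_(z in E) (c z)%:E)%E.
Proof.
move=> mc c01 mE; set W := [set p | _].
have mW : measurable W by exact: measurable_randomized_df_le.
rewrite pr_productE2//.
(* Reordered as ((z, q), s), so that for fixed z and q the kernel acts on the last variable. *)
pose B : set ((T * R) * R) := [set p | W ((p.1.1, p.2), p.1.2)].
have mB : measurable B.
  have ms : measurable_fun setT (fun p : (T * R) * R => ((p.1.1, p.2), p.1.2)).
    apply: measurable_fun_pair; last exact: measurableT_comp.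
    by apply: measurable_fun_pair => //; exact: measurableT_comp.
  by rewrite -[X in measurable X]setTI; exact: ms.
pose f (p : T * R) := K p.1 (xsection B p).
have mf : measurable_fun setT f by exact: (measurable_kernel_section K (f := fst)).
transitivity (\int[unif]_q \int[mu]_z f (z, q))%E.
  apply: eq_integral => q _.
  rewrite kernel_disintegration; last exact: measurable_ysection.
  apply: eq_integral => z _; congr (K z _); apply/seteqP.
  by split => s; rewrite /xsection /ysection /= ?inE; [move/set_mem|move=> h; apply/mem_set].
rewrite -fubini_tonelli//.
rewrite [RHS]integral_mkcond; apply: ge0_ae_eq_integral => //.
- exact: measurable_fun_fubini_tonelli_F.
- by apply/(measurable_restrictT _ mE).1; apply/measurable_EFinP; exact: measurable_funTS.
- by move=> z _; apply: integral_ge0 => q _; exact: measure_ge0.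
- by move=> z _; rewrite patchE; case: ifPn => // _; rewrite lee_fin; case/andP: (c01 z).
apply: filterS kernel_ae01 => z K01 _.
rewrite patchE; case: ifPn => [/set_mem Ez|/negP zE]; last first.
  rewrite integral0_eq// => q _; rewrite /f (_ : xsection B _ = set0) ?measure0//.
  by apply/seteqP; split => // s; rewrite /xsection /= inE => -[/= Ez _]; apply: zE; rewrite inE.
pose W' := [set p | randomized_df (kprob K z) p.1 p.2 <= c z].
have mW' : measurable W'.
  apply: (measurable_set_le (f := fun p : R * R => randomized_df (kprob K z) p.1 p.2) (g := cst (c z))) => //.
  exact: (@measurable_randomized_df _ _ _ K _ _ (cst z) _ fst snd).
rewrite -(randomized_df_uniform K01 (c01 z) mW') -/W' -prE// [RHS](pr_productE2 _ _ mW').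
apply: eq_integral => q _; rewrite /f; congr (K z _); apply/seteqP; split => s;
  rewrite /xsection /ysection /= !inE /=; first by case.
by move=> h; split.
Qed.

End disintegration.

(** * Coordinates, margins and their kernels *)

Section tuple_coordinates.
Context {R : realType}.

Lemma measurable_nth m j : measurable_fun setT (fun x : m.-tuple R => nth 0 x j).
Proof.
have [jm|jm] := ltnP j m.
  rewrite (_ : (fun x => _) = fun x : m.-tuple R => tnth x (Ordinal jm)).
    exact: measurable_tnth.
  by apply/funext => x; rewrite (tnth_nth 0).
rewrite (_ : (fun x => _) = cst 0)//.
by apply/funext => x; rewrite nth_default// size_tuple.
Qed.

Lemma first_coords_first_coords m k j (x : m.-tuple R) : (j <= k)%N ->
  first_coords j (first_coords k x) = first_coords j x.
Proof.
move=> jk; apply: eq_from_tnth => i; rewrite !tnth_mktuple.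
rewrite -[LHS](tnth_nth 0 (first_coords k x) (Ordinal (leq_trans (ltn_ord i) jk))).
by rewrite tnth_mktuple.
Qed.

Lemma nth_first_coords m k j (x : m.-tuple R) : (j < k)%N ->
  nth 0 (first_coords k x) j = nth 0 x j.
Proof.
move=> jk; rewrite -[LHS](tnth_nth 0 (first_coords k x) (Ordinal jk)).
by rewrite tnth_mktuple.
Qed.

Lemma first_coords_rcons k (x : k.-tuple R) t : first_coords k [tuple of rcons x t] = x.
Proof.
apply: eq_from_tnth => i; rewrite tnth_mktuple /= nth_rcons size_tuple ltn_ord.
by rewrite (tnth_nth 0).
Qed.

Definition coords_pair m k (x : m.-tuple R) : k.-tuple R * R := (first_coords k x, nth 0 x k).

Lemma measurable_coords_pair m k : (k <= m)%N -> measurable_fun setT (@coords_pair m k).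
Proof.
move=> km; apply: measurable_fun_pair; first exact: measurable_first_coords.
exact: measurable_nth.
Qed.

Lemma coords_pair_first_coords m k (x : m.-tuple R) :
  coords_pair k (first_coords k.+1 x) = coords_pair k x.
Proof.
by rewrite /coords_pair (first_coords_first_coords x (leqnSn k)) (nth_first_coords x (ltnSn k)).
Qed.

Lemma coords_pair_rcons k (p : k.-tuple R * R) : coords_pair k (rcons_pair p) = p.
Proof.
case: p => z t; rewrite /coords_pair /rcons_pair (first_coords_rcons z t) /=.
by rewrite nth_rcons size_tuple ltnn eqxx.
Qed.

Lemma coords_pairE k (x : k.+1.-tuple R) : coords_pair k x = (first_coords k x, last_coord x).
Proof. by rewrite /coords_pair /last_coord (tnth_nth 0). Qed.

Lemma lebesgue_cube_split m k (km : (k < m)%N) (G : set (k.-tuple R * R)) :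
  measurable G ->
  lebesgue_cube m (@coords_pair m k @^-1` G) = (lebesgue_cube k \x unif)%E G.
Proof.
move=> mG; pose E := @coords_pair k.+1 k @^-1` G.
have mE : measurable E.
  by rewrite -[X in measurable X]setTI; exact: (@measurable_coords_pair k.+1 k).
have e3 : @coords_pair m k @^-1` G = @first_coords R m k.+1 @^-1` E.
  by apply/funext => x; exact: (congr1 G (esym (coords_pair_first_coords k x))).
have e2 : @rcons_pair R k @^-1` E = G.
  by apply/funext => x; exact: (congr1 G (coords_pair_rcons x)).
have e1 := first_coords_lebesgue_cube km mE.
by rewrite e2 in e1; rewrite e3.
Qed.

End tuple_coordinates.

Section products_of_laws.
Context {R : realType} d d' d'' (T : measurableType d) (T' : measurableType d')
  (S : measurableType d'').

Lemma product_law (P : probability T R) (Q : probability S R) (f : T -> T')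
    (mf : measurable_fun setT f) (W : set (T' * S)) : measurable W ->
  (law P mf \x Q)%E W = (P \x Q)%E [set p | W (f p.1, p.2)].
Proof.
move=> mW; rewrite pr_productE2// pr_productE2; last first.
  rewrite -[X in measurable X]setTI.
  have mg : measurable_fun setT (fun p : T * S => (f p.1, p.2)).
    by apply: measurable_fun_pair => //; exact: measurableT_comp.
  exact: mg.
by apply: eq_integral => y _; rewrite lawE; congr (P _).
Qed.

End products_of_laws.

Section margins.
Context {R : realType} m (A : m.-tuple R -> R) (mu : probability (m.-tuple R) R).
Hypothesis muA : has_df_on_cube A mu.

(** On the cube an upper bound 1 for the remaining coordinates is no constraint. *)
Lemma copula_margin_df k (km : (k <= m)%N) :
  has_df_on_cube (@copula_margin R m k A) (law mu (measurable_first_coords km)).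
Proof.
have mc := @measurable_cube R; have [mu1 muC] := muA.
have mu1' : pr mu (@cube R m) = 1 by rewrite /pr mu1.
have mf := measurable_first_coords (R := R) km.
have mpre (E : set (k.-tuple R)) : measurable E -> measurable (@first_coords R m k @^-1` E).
  by move=> mE; rewrite -[X in measurable X]setTI; exact: mf.
split => [|u cu].
  have h : (mu (@cube R m) <= mu (@first_coords R m k @^-1` @cube R k))%E.
    apply: le_measure; rewrite ?inE; [exact: mc|exact: mpre|].
    move=> x cx i; rewrite tnth_mktuple.
    by rewrite -(tnth_nth 0 x (Ordinal (leq_trans (ltn_ord i) km))); exact: cx.
  apply/eqP; rewrite eq_le; apply/andP; split; first by apply: probability_le1; exact: mc.
  by apply: le_trans h; rewrite mu1.
rewrite /copula_margin; set v := (X in A X).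
have cv : cube v.
  move=> i; rewrite tnth_mktuple; have [ik|ik] := ltnP i k.
    by rewrite -(tnth_nth 1 u (Ordinal ik)); exact: cu.
  by rewrite nth_default ?size_tuple// ler01 lexx.
rewrite -(muC _ cv) lawE.
have mo := @measurable_lower_orthant R.
rewrite (prE mu (mpre _ (mo k u))) (prE mu (mo m v)).
congr EFin; apply: (pr_eq_on (mc m) (mpre _ (mo k u)) (mo m v) mu1').
apply/seteqP; split => x [/= xu cx]; split => // i.
  rewrite tnth_mktuple; have [ik|ik] := ltnP i k.
    have := xu (Ordinal ik); rewrite tnth_mktuple /= -(tnth_nth 0 x i).
    by rewrite (tnth_nth 1 u).
  by rewrite nth_default ?size_tuple//; case/andP: (cx i).
rewrite tnth_mktuple -(tnth_nth 0 x (Ordinal (leq_trans (ltn_ord i) km))).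
by have := xu (Ordinal (leq_trans (ltn_ord i) km)); rewrite tnth_mktuple /= (tnth_nth 1 u).
Qed.

End margins.

(** Existence of a kernel guarantees that [xget] returns a genuine one and not the default. *)
Lemma markov_kernelP {R : realType} k (C : k.+1.-tuple R -> R) (nu : probability (k.+1.-tuple R) R) :
  has_df_on_cube C nu -> is_markov_kernel C (markov_kernel C).
Proof.
move=> h; have [K hK] : exists K, is_markov_kernel C K.
  apply: kernel_exists; have [c1 _] := copula_measureP h.
  have m01 : measurable [set x : k.+1.-tuple R | 0 <= last_coord x <= 1].
    exact: (measurable_tnth_preimage ord_max (measurable_setcc 0 1)).
  apply/eqP; rewrite eq_le pr_le1//=.
  rewrite -lee_fin -prE// -[leLHS]c1; apply: le_measure; rewrite ?inE//.
    exact: measurable_cube.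
  by move=> x /(_ ord_max).
exact: (@xgetPex _ (@default_kernel R k : {classic R.-pker (k.-tuple R) ~> R}) _ (ex_intro _ K hK)).
Qed.

Section margin_kernels.
Context {R : realType} m (A : m.-tuple R -> R) (mu : probability (m.-tuple R) R).
Hypothesis muA : has_df_on_cube A mu.
Context k (km : (k < m)%N).

Let K := markov_kernel (@copula_margin R m k.+1 A).
Let mfk := measurable_first_coords (R := R) (ltnW km).
Let mfk1 := measurable_first_coords (R := R) km.

(** The chosen kernel belongs to the copula measure of a margin. Pushing mu forward in two stages
    turns its defining identity into one about mu. *)
Lemma margin_kernelP (E : set (k.-tuple R)) (F : set R) : measurable E -> measurable F ->
  law mu (measurable_coords_pair (ltnW km)) (E `*` F) =
  (\int[law mu mfk]_(z in E) K z F)%E.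
Proof.
move=> mE mF; have h := copula_margin_df muA km.
have := markov_kernelP h mE mF; rewrite -/K.
pose EF : set (k.+1.-tuple R) := [set x | E (first_coords k x) /\ F (last_coord x)].
have mfk' := measurable_first_coords (R := R) (leqnSn k).
have mpre : measurable (@first_coords R k.+1 k @^-1` E).
  by rewrite -[X in measurable X]setTI; exact: mfk'.
have mEF : measurable EF.
  exact: (measurableI _ _ mpre (measurable_tnth_preimage ord_max mF)).
have mKF : measurable_fun setT (K ^~ F) by exact: measurable_kernel.
rewrite (copula_measureE h mEF) (eq_measure_integral (law mu mfk1)); last first.
  by move=> B mB _; exact: (copula_measureE h mB).
rewrite [X in _ = X -> _](@ge0_integral_law _ _ _ _ _ mu _ mfk1 _
  (fun y => K (first_coords k y) F)); last 3 first.
- exact: mpre.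
- by apply: measurable_funTS; exact: (measurableT_comp (f := K ^~ F) mKF mfk').
- by move=> y; exact: measure_ge0.
move=> e; rewrite [RHS](@ge0_integral_law _ _ _ _ _ mu _ mfk); last 3 first.
- exact: mE.
- exact: measurable_funTS.
- by move=> y; exact: measure_ge0.
transitivity (law mu mfk1 EF).
  have -> : EF = @coords_pair R k.+1 k @^-1` (E `*` F).
    by apply/funext => y; exact: (congr1 (E `*` F) (esym (coords_pairE y))).
  have e0 : @coords_pair R m k @^-1` (E `*` F) =
      @first_coords R m k.+1 @^-1` (@coords_pair R k.+1 k @^-1` (E `*` F)).
    by apply/funext => x; exact: (congr1 (E `*` F) (esym (coords_pair_first_coords k x))).
  exact: (congr1 mu e0).
have ff x : first_coords k (@first_coords R m k.+1 x) = first_coords k x.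
  exact: (first_coords_first_coords x (leqnSn k)).
have -> : @first_coords R m k @^-1` E =
    @first_coords R m k.+1 @^-1` (@first_coords R k.+1 k @^-1` E).
  by apply/seteqP; split => x; rewrite /preimage /= ff.
by rewrite e; apply: eq_integral => x _; rewrite ff.
Qed.

Lemma coords_pair_law01 : pr (law mu (measurable_coords_pair (ltnW km))) [set p | 0 <= p.2 <= 1] = 1.
Proof.
have [c1 _] := muA; rewrite pr_law.
have mS : measurable [set x : m.-tuple R | 0 <= nth 0 x k <= 1].
  by have := @measurable_nth R m k measurableT _ (measurable_setcc 0 1); rewrite setTI.
apply/eqP; rewrite eq_le pr_le1//= -lee_fin -prE// -[leLHS]c1.
apply: le_measure; rewrite ?inE//; first exact: measurable_cube.
by move=> x /(_ (Ordinal km)); rewrite (tnth_nth 0).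
Qed.

Lemma cond_df_law (c : k.-tuple R -> R) (E : set (k.-tuple R)) :
  measurable_fun setT c -> (forall z, 0 <= c z <= 1) -> measurable E ->
  (mu \x unif)%E [set p | E (first_coords k p.1) /\
     cond_df A p.2 (first_coords k p.1) (nth 0 p.1 k) <= c (first_coords k p.1)] =
  (\int[law mu mfk]_(z in E) (c z)%:E)%E.
Proof.
move=> mc c01 mE.
rewrite -(randomized_df_law margin_kernelP coords_pair_law01 mc c01 mE).
have mW := measurable_randomized_df_le K mc mE.
by rewrite (product_law mu unif _ mW).
Qed.

End margin_kernels.

Section almost_everywhere.
Context {R : realType} d (T : measurableType d) (P : probability T R).

Lemma ae_forall_rat (Q : rat -> T -> Prop) :
  (forall q, {ae P, forall x, Q q x}) -> {ae P, forall x, forall q, Q q x}.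
Proof.
move=> h; pose g n : option rat := choice.unpickle n.
have gK q : g (choice.pickle q) = Some q by exact: choice.pickleK.
clearbody g.
have : {ae P, forall x, forall n, if g n is Some q then Q q x else True}.
  apply: ae_foralln => n; case: (g n) => [q|]; first exact: h.
  exact: filterE.
by apply: filterS => x hx q; have := hx (choice.pickle q); rewrite gK.
Qed.

Lemma pr_ae_eq (G H : set T) : measurable G -> measurable H ->
  {ae P, forall x, G x <-> H x} -> pr P G = pr P H.
Proof.
move=> mG mH [N [mN N0 GHN]].
have N1 : pr P (~` N) = 1.
  by rewrite prC// (_ : pr P N = 0) ?subr0// -[RHS]/(fine 0%E); congr fine.
apply: pr_eq_on N1 _ => //; first exact: measurableC.
have GH x : (~` N) x -> (G x <-> H x).
  by move=> Nx; apply: contrapT => h; apply: Nx; exact: GHN.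
by apply/seteqP; split => x [Gx Nx]; split => //; exact/(GH _ Nx).
Qed.

Lemma ae_pr1 (G : set T) : measurable G -> pr P G = 1 -> {ae P, forall x, G x}.
Proof.
move=> mG G1; exists (~` G); split; [exact: measurableC| |by move=> x].
transitivity (pr P (~` G))%:E; first by apply: prE; exact: measurableC.
by rewrite prC// G1 subrr.
Qed.

(** Replaces the converse inclusion by a comparison of masses. This is how a level of X_i will be
    read off U_i, where only one inclusion is visible pointwise. *)
Lemma ae_sub_eq (G H : set T) : measurable G -> measurable H ->
  {ae P, forall x, G x -> H x} -> pr P H <= pr P G -> {ae P, forall x, G x <-> H x}.
Proof.
move=> mG mH GH HG.
have mHG := measurableD mH mG.
have GHI : pr P (H `&` G) = pr P G.
  apply: pr_ae_eq => //; first exact: measurableI.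
  by apply: filterS GH => x GHx; split => [[]//|Gx]; split => //; exact: GHx.
have D0 : pr P (H `\` G) = 0.
  apply/eqP; rewrite eq_le pr_ge0 andbT.
  by have := prDI P mH mG; rewrite GHI => /eqP; rewrite addrC -subr_eq => /eqP <-; rewrite subr_le0.
have : {ae P, forall x, (~` (H `\` G)) x}.
  by apply: ae_pr1; [exact: measurableC|rewrite prC// D0 subr0].
apply: filterS2 GH => x GHx nHG; split => // Hx; apply: contrapT => nG.
by apply: nHG.
Qed.

End almost_everywhere.

(** * Rosenblatt transform and linkage *)

Section rosenblatt_transform.
Context {R : realType} (d : nat) (A : d.+1.-tuple R -> R).
Hypothesis cA : is_copula A.

Let mu := copula_measure A.
Let muA : has_df_on_cube A mu.
Proof. by have [] := is_copula_measure cA. Qed.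

Let mcube m : measurable (@cube R m). Proof. exact: measurable_cube. Qed.

Lemma copula_measure_cube : pr mu (@cube R d.+1) = 1.
Proof. by have [h _] := muA; rewrite /pr h. Qed.

Let mu_margin i t : 0 <= t <= 1 -> pr mu [set x | tnth x i <= t] = t.
Proof. by move=> t01; have [_ ->] := is_copula_measure cA. Qed.

Definition rosenblatt_coord i (r : R) (z : i.-tuple R) (t : R) : R :=
  if i == 0%N then t else cond_df A r z t.

Let first_law i (im : (i <= d.+1)%N) := law mu (measurable_first_coords im).

Lemma measurable_rosenblatt_coord i d' (S : measurableType d') (f : S -> i.-tuple R) (q g : S -> R) :
  measurable_fun setT f -> measurable_fun setT q -> measurable_fun setT g ->
  measurable_fun setT (fun s => rosenblatt_coord (q s) (f s) (g s)).
Proof.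
move=> mf mq mg; rewrite /rosenblatt_coord; case: (i == 0%N) => //.
exact: (measurable_randomized_df (markov_kernel (@copula_margin R d.+1 i.+1 A)) mf mg mq).
Qed.

(** For positive i this is [cond_df_law]. For i = 0 the condition is the empty tuple, c is a
    constant, and what remains is uniformity of the first margin. *)
Lemma rosenblatt_coord_law i (im : (i <= d.+1)%N) (id : (i < d.+1)%N)
    (c : i.-tuple R -> R) (E : set (i.-tuple R)) :
  measurable_fun setT c -> (forall z, 0 <= c z <= 1) -> measurable E ->
  (mu \x unif)%E [set p | E (first_coords i p.1) /\
     rosenblatt_coord p.2 (first_coords i p.1) (nth 0 p.1 i) <= c (first_coords i p.1)] =
  (\int[first_law im]_(z in E) (c z)%:E)%E.
Proof.
move=> mc c01 mE; rewrite /first_law.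
have -> : im = ltnW id by exact: bool_irrelevance.
case: i id c E mc c01 mE {im} => [|i] id c E mc c01 mE; last exact: cond_df_law.
have z0 (z : 0.-tuple R) : z = [tuple] by exact: tuple0.
have [E0|E0] := pselect (E [tuple]); last first.
  have -> : E = set0 by apply/seteqP; split => // z; rewrite (z0 z).
  by rewrite integral_set0 (_ : [set p | _] = set0) ?measure0//; apply/seteqP; split => // p [].
have ET : E = setT by apply/seteqP; split => // z _; rewrite (z0 z).
set s := c [tuple]; have s01 : 0 <= s <= 1 by exact: c01.
transitivity s%:E; last first.
  rewrite ET (eq_integral (fun=> s%:E)); last by move=> z _; rewrite (z0 z).
  by rewrite integral_cst//= probability_setT mule1.
have mS : measurable [set x : d.+1.-tuple R | tnth x ord0 <= s].
  exact: (measurable_tnth_preimage ord0 (measurable_setle s)).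
rewrite (_ : [set p | _] = [set x : d.+1.-tuple R | tnth x ord0 <= s] `*` setT); last first.
  apply/seteqP; split => [[x q] [_ h]|[x q] [h _]].
    by split => //; move: h; rewrite /= (tnth_nth 0) (z0 (first_coords _ _)).
  split; first by rewrite ET.
  by move: h; rewrite /= (tnth_nth 0) (z0 (first_coords _ _)).
transitivity (pr (mu \x unif)%E ([set x : d.+1.-tuple R | tnth x ord0 <= s] `*` setT))%:E.
  by apply: prE; exact: measurableX.
by rewrite prX// prT mulr1 mu_margin.
Qed.

Definition rosenblatt_space : probability (d.+1.-tuple R * d.-tuple R)%type R :=
  (mu \x lebesgue_cube d)%E.

Definition rosenblatt_var (p : d.+1.-tuple R * d.-tuple R) : d.-tuple R :=
  rosenblatt A p.2 (first_coords d p.1).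

Lemma rosenblatt_varE p (j : 'I_d) :
  tnth (rosenblatt_var p) j =
  rosenblatt_coord (nth 0 p.2 j) (first_coords j p.1) (nth 0 p.1 j).
Proof.
rewrite /rosenblatt_var /rosenblatt tnth_mktuple /rosenblatt_coord.
rewrite (first_coords_first_coords p.1 (ltnW (ltn_ord j))).
by rewrite [tnth (first_coords _ _) _]tnth_mktuple (tnth_nth 0).
Qed.

Lemma measurable_rosenblatt_var : measurable_fun setT rosenblatt_var.
Proof.
apply/measurable_fun_tnthP => j.
have jd : (j <= d.+1)%N by rewrite ltnW// ltnW// ltnS.
rewrite (_ : _ \o _ = fun p : d.+1.-tuple R * d.-tuple R =>
  rosenblatt_coord (nth 0 p.2 j) (first_coords j p.1) (nth 0 p.1 j)); last first.
  by apply/funext => p; exact: rosenblatt_varE.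
apply: measurable_rosenblatt_coord.
- by apply: measurableT_comp => //; exact: measurable_first_coords.
- by apply: (measurableT_comp (@measurable_nth R d j)).
- by apply: (measurableT_comp (@measurable_nth R d.+1 j)).
Qed.

Lemma rosenblatt_coord01 i (r : R) (z : i.-tuple R) t : 0 <= r <= 1 -> 0 <= t <= 1 ->
  0 <= rosenblatt_coord r z t <= 1.
Proof.
move=> /andP[r0 r1] t01; rewrite /rosenblatt_coord; case: ifPn => // _.
rewrite /cond_df; set K := markov_kernel _.
rewrite -[fine (K z `[0, t[%classic)]/(pr (kprob K z) _) -[fine (K z [set t])]/(pr (kprob K z) _).
rewrite addr_ge0 ?mulr_ge0 ?pr_ge0//=.
rewrite (@le_trans _ _ (pr (kprob K z) (`[0, t[%classic `|` [set t])))//; last exact: pr_le1 (measurableU _ _ _ _).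
rewrite prU//; last by apply/seteqP; split => // x [/=]; rewrite in_itv /= => + xt; rewrite xt ltxx andbF.
by rewrite lerD2l ler_piMl// pr_ge0.
Qed.

Lemma rosenblatt_var_cube p : cube p.1 -> cube p.2 -> cube (rosenblatt_var p).
Proof.
move=> c1 c2 j; rewrite rosenblatt_varE; apply: rosenblatt_coord01.
  by rewrite -tnth_nth; exact: c2.
have jd : (j < d.+1)%N by rewrite ltnW// ltnS.
by rewrite -(tnth_nth 0 p.1 (Ordinal jd)); exact: c1.
Qed.

Definition rosenblatt_good : set (d.+1.-tuple R * d.-tuple R) := @cube R d.+1 `*` @cube R d.

Lemma measurable_rosenblatt_good : measurable rosenblatt_good.
Proof. by apply: measurableX; exact: mcube. Qed.

Lemma pr_rosenblatt_good : pr rosenblatt_space rosenblatt_good = 1.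
Proof.
rewrite /rosenblatt_space prX; [|exact: mcube..].
by rewrite copula_measure_cube pr_lebesgue_cube_cube mulr1.
Qed.

Let msel i (E : set (i.-tuple R * i.-tuple R)) : (i < d)%N -> measurable E ->
  measurable [set p : d.+1.-tuple R * d.-tuple R | E (first_coords i p.1, first_coords i p.2)].
Proof.
move=> id mE.
have mf : measurable_fun setT (fun p : d.+1.-tuple R * d.-tuple R =>
    (first_coords i p.1, first_coords i p.2)).
  apply: measurable_fun_pair.
    apply: (measurableT_comp (f := @first_coords R d.+1 i)) => //.
    by apply: measurable_first_coords; rewrite ltnW// ltnW// ltnS.
  apply: (measurableT_comp (f := @first_coords R d i)) => //.
  by apply: measurable_first_coords; exact: ltnW.
by rewrite -[X in measurable X]setTI; exact: mf.
Qed.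

Let mcoordle i (c : i.-tuple R -> R) : (i < d)%N -> measurable_fun setT c ->
  measurable [set p : d.+1.-tuple R * d.-tuple R |
    rosenblatt_coord (nth 0 p.2 i) (first_coords i p.1) (nth 0 p.1 i) <= c (first_coords i p.1)].
Proof.
move=> id mc.
have mfi : measurable_fun setT (fun p : d.+1.-tuple R * d.-tuple R => first_coords i p.1).
  apply: (measurableT_comp (f := @first_coords R d.+1 i)) => //.
  by apply: measurable_first_coords; rewrite ltnW// ltnW// ltnS.
apply: measurable_set_le; last exact: (measurableT_comp mc mfi).
apply: measurable_rosenblatt_coord => //.
- by apply: (measurableT_comp (@measurable_nth R d i)).
- by apply: (measurableT_comp (@measurable_nth R d.+1 i)).
Qed.

(** E may involve the earlier randomizers as well as the earlier coordinates. Freezing the former at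
    r by Fubini leaves [rosenblatt_coord_law] for the section of E; randomizers of index above i are
    integrated out by [lebesgue_cube_split]. *)
Lemma rosenblatt_step i (im : (i <= d.+1)%N) (id : (i < d)%N) (c : i.-tuple R -> R)
    (E : set (i.-tuple R * i.-tuple R)) :
  measurable_fun setT c -> (forall z, 0 <= c z <= 1) -> measurable E ->
  rosenblatt_space ([set p : d.+1.-tuple R * d.-tuple R | E (first_coords i p.1, first_coords i p.2)] `&`
    [set p : d.+1.-tuple R * d.-tuple R | rosenblatt_coord (nth 0 p.2 i) (first_coords i p.1) (nth 0 p.1 i)
      <= c (first_coords i p.1)]) =
  (\int[lebesgue_cube i]_r \int[first_law im]_(z in ysection E r) (c z)%:E)%E.
Proof.
move=> mc c01 mE.
pose W : set (d.+1.-tuple R * (i.-tuple R * R)) := [set w | E (first_coords i w.1, w.2.1)] `&`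
  [set w | rosenblatt_coord w.2.2 (first_coords i w.1) (nth 0 w.1 i) <= c (first_coords i w.1)].
have mfi : measurable_fun setT (fun w : d.+1.-tuple R * (i.-tuple R * R) => first_coords i w.1).
  by apply: (measurableT_comp (f := @first_coords R d.+1 i)) => //; exact: measurable_first_coords.
have mW : measurable W.
  apply: measurableI.
    have mf : measurable_fun setT (fun w : d.+1.-tuple R * (i.-tuple R * R) => (first_coords i w.1, w.2.1)).
      by apply: measurable_fun_pair => //; exact: measurableT_comp.
    by rewrite -[X in measurable X]setTI; exact: mf.
  apply: measurable_set_le; last exact: (measurableT_comp mc mfi).
  apply: measurable_rosenblatt_coord => //; first exact: measurableT_comp.
  by apply: (measurableT_comp (@measurable_nth R d.+1 i)).
transitivity ((mu \x (lebesgue_cube i \x unif))%E W).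
  rewrite [LHS]pr_productE; last by apply: measurableI; [exact: msel|exact: mcoordle].
  rewrite [RHS]pr_productE//; apply: eq_integral => x _.
  transitivity (lebesgue_cube d (coords_pair i @^-1` xsection W x)); last first.
    by apply: lebesgue_cube_split => //; exact: measurable_xsection.
  by congr (lebesgue_cube d _).
rewrite pr_productE2//.
rewrite (fubini_tonelli1 (m1 := lebesgue_cube i) (m2 := unif)); last 2 first.
- exact: measurable_fun_ysection.
- by move=> w; exact: measure_ge0.
apply: eq_integral => r _.
have mEr : measurable (ysection E r) by exact: measurable_ysection.
rewrite -(rosenblatt_coord_law im (ltnW id) mc c01 mEr).
rewrite pr_productE2; last first.
  have mf : measurable_fun setT (fun p : d.+1.-tuple R * R => (p.1, (r, p.2))).
    by apply: measurable_fun_pair => //; apply: measurable_fun_pair.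
  have := mf measurableT _ mW; rewrite setTI; congr measurable.
  by apply/seteqP; split => p; rewrite /W /ysection /= ?inE.
apply: eq_integral => q _; congr (mu _); apply/seteqP.
split => x; rewrite /ysection /=; first by move=> /set_mem[h1 h2]; apply/mem_set; split => //; apply/mem_set.
by move=> /set_mem[/set_mem h1 h2]; apply/mem_set.
Qed.

Lemma rosenblatt_step_cst i (id : (i < d)%N) (t : R) (E : set (i.-tuple R * i.-tuple R)) :
  0 <= t <= 1 -> measurable E ->
  pr rosenblatt_space ([set p : d.+1.-tuple R * d.-tuple R | E (first_coords i p.1, first_coords i p.2)] `&`
    [set p : d.+1.-tuple R * d.-tuple R | rosenblatt_coord (nth 0 p.2 i) (first_coords i p.1) (nth 0 p.1 i) <= t]) =
  t * pr rosenblatt_space [set p : d.+1.-tuple R * d.-tuple R | E (first_coords i p.1, first_coords i p.2)].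
Proof.
move=> t01 mE; have im : (i <= d.+1)%N by rewrite ltnW// ltnW// ltnS.
pose e := pr (lebesgue_cube i \x first_law im)%E [set w | E (w.2, w.1)].
have key s : 0 <= s <= 1 ->
  pr rosenblatt_space ([set p : d.+1.-tuple R * d.-tuple R | E (first_coords i p.1, first_coords i p.2)] `&`
    [set p : d.+1.-tuple R * d.-tuple R | rosenblatt_coord (nth 0 p.2 i) (first_coords i p.1) (nth 0 p.1 i) <= s]) = s * e.
  move=> s01; have s0 : 0 <= s by case/andP: s01.
  have mE' : measurable [set w : i.-tuple R * i.-tuple R | E (w.2, w.1)].
    have mf : measurable_fun setT (fun w : i.-tuple R * i.-tuple R => (w.2, w.1)).
      exact: measurable_fun_pair.
    by rewrite -[X in measurable X]setTI; exact: mf.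
  apply: EFin_inj; rewrite EFinM -prE; last first.
    by apply: measurableI; [exact: msel|exact: (mcoordle (c := cst s))].
  rewrite (rosenblatt_step im id (c := cst s))//.
  rewrite -prE// [X in (_ * X)%E]pr_productE//.
  rewrite -ge0_integralZl//; last exact: measurable_fun_xsection.
  apply: eq_integral => r _.
  rewrite (eq_integral (fun=> s%:E))// integral_cst//; last exact: measurable_ysection.
rewrite key//; congr (_ * _).
(* At threshold 1 the second event holds almost surely, which identifies e with the probability of
   E. *)
have h1 : 0 <= (1 : R) <= 1 by rewrite ler01 lexx.
rewrite -[LHS]mul1r -(key _ h1).
apply: pr_eq_on pr_rosenblatt_good _.
- exact: measurable_rosenblatt_good.
- by apply: measurableI; [exact: msel|exact: (mcoordle (c := cst 1))].
- exact: msel.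
apply/seteqP; split => [p [[Ep _] gp]|p [Ep gp]]; split => //; split => //=.
have [c1 c2] := gp; have := rosenblatt_var_cube c1 c2 (Ordinal id).
by rewrite rosenblatt_varE => /andP[].
Qed.

(** Induction on the number of bounded coordinates: the first k bounds depend only on the first k
    entries of X and of R, hence form an admissible event for [rosenblatt_step_cst], and the next
    bound multiplies the probability by its level. *)
Lemma rosenblatt_var_df (u : d.-tuple R) : cube u -> forall k, (k <= d)%N ->
  pr rosenblatt_space [set p | forall j : 'I_d, (j < k)%N -> tnth (rosenblatt_var p) j <= tnth u j] =
  \prod_(j < d | (j < k)%N) tnth u j.
Proof.
move=> cu; elim=> [_|k IH kd].
  rewrite big_pred0//.
  by rewrite -[RHS](prT rosenblatt_space); congr pr; apply/seteqP; split.
pose jk := Ordinal kd.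
pose E : set (k.-tuple R * k.-tuple R) := [set w : k.-tuple R * k.-tuple R | forall j : 'I_d, (j < k)%N ->
  rosenblatt_coord (nth 0 w.2 j) (first_coords j w.1) (nth 0 w.1 j) <= tnth u j].
have mE : measurable E.
  apply: measurable_forall_le => j jk'; apply: measurable_set_le => //.
  apply: measurable_rosenblatt_coord.
  - apply: (measurableT_comp (f := @first_coords R k j)) => //.
    by apply: measurable_first_coords; exact: ltnW.
  - by apply: (measurableT_comp (@measurable_nth R k j)).
  - by apply: (measurableT_comp (@measurable_nth R k j)).
have EE : [set p | forall j : 'I_d, (j < k)%N -> tnth (rosenblatt_var p) j <= tnth u j] =
    [set p : d.+1.-tuple R * d.-tuple R | E (first_coords k p.1, first_coords k p.2)].
  apply/seteqP; split => p h j jk'; have := h j jk'; rewrite rosenblatt_varE /=;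
  by rewrite (first_coords_first_coords p.1 (ltnW jk')) (nth_first_coords p.1 jk') (nth_first_coords p.2 jk').
rewrite (_ : [set p | _] = [set p : d.+1.-tuple R * d.-tuple R | E (first_coords k p.1, first_coords k p.2)] `&`
   [set p : d.+1.-tuple R * d.-tuple R | rosenblatt_coord (nth 0 p.2 k) (first_coords k p.1) (nth 0 p.1 k) <= tnth u jk]); last first.
  rewrite -EE; apply/seteqP; split => [p h|p [h hk] j].
    split; first by move=> j jk'; apply: h; exact: ltnW.
    by have := h jk (ltnSn k); rewrite rosenblatt_varE.
  rewrite ltnS leq_eqVlt => /predU1P[jE|]; last exact: h.
  have -> : j = jk by exact: val_inj.
  by rewrite rosenblatt_varE.
rewrite rosenblatt_step_cst// -EE IH; last exact: ltnW.
rewrite [RHS](bigD1 jk) /=; last exact: ltnSn.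
congr (_ * _); apply: eq_bigl => j.
by rewrite ltnS ltn_neqAle andbC.
Qed.

Lemma rosenblatt_var_uniform E : measurable E ->
  rosenblatt_space (rosenblatt_var @^-1` E) = lebesgue_cube d E.
Proof.
move=> mE.
have h1 : has_df_on_cube (fun u : d.-tuple R => \prod_j tnth u j)
    (law rosenblatt_space measurable_rosenblatt_var).
  have mpre (F : set (d.-tuple R)) : measurable F -> measurable (rosenblatt_var @^-1` F).
    by move=> mF; rewrite -[X in measurable X]setTI; exact: measurable_rosenblatt_var.
  split.
    have h : pr rosenblatt_space rosenblatt_good <= pr rosenblatt_space (rosenblatt_var @^-1` @cube R d).
      apply: le_pr; [exact: measurable_rosenblatt_good|by apply: mpre; exact: mcube|].
      by move=> p [c1 c2]; exact: rosenblatt_var_cube.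
    have e1 : pr (law rosenblatt_space measurable_rosenblatt_var) (@cube R d) = 1.
      apply/eqP; rewrite eq_le; apply/andP; split; first by apply: pr_le1; exact: mcube.
      by rewrite pr_rosenblatt_good in h.
    by rewrite (prE (law rosenblatt_space measurable_rosenblatt_var) (@mcube d)) e1.
  move=> u cu; rewrite prE; last exact: measurable_lower_orthant.
  congr EFin; rewrite pr_law.
  have -> : \prod_j tnth u j = \prod_(j < d | (j < d)%N) tnth u j.
    by apply: eq_bigl => j; rewrite ltn_ord.
  rewrite -(rosenblatt_var_df cu (leqnn d)).
  by congr pr; apply/seteqP; split => p h j; [move=> _|]; exact: h.
have h2 : has_df_on_cube (fun u : d.-tuple R => \prod_j tnth u j) (lebesgue_cube d).
  split; first by rewrite (prE (lebesgue_cube d) (@mcube d)) pr_lebesgue_cube_cube.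
  move=> u cu; rewrite prE; last exact: measurable_lower_orthant.
  by rewrite pr_lebesgue_cube_orthant; congr EFin; apply: eq_bigr => i _; rewrite clamp_id.
exact: (has_df_on_cube_orthant h1 h2 mE).
Qed.

End rosenblatt_transform.

(** * Recovering X from its transform *)

Section rosenblatt_recovery.
Context {R : realType} (d : nat) (A : d.+1.-tuple R -> R).
Hypothesis cA : is_copula A.

Let mu := copula_measure A.
Let muA : has_df_on_cube A mu.
Proof. by have [] := is_copula_measure cA. Qed.
Let P := rosenblatt_space A.
Let U := rosenblatt_var A.
Let mU : measurable_fun setT U. Proof. exact: measurable_rosenblatt_var. Qed.

(* U determines X almost surely. Only events matter below, so no inverse map of the
   transform is constructed. *)
Definition recoverable (G : set (d.+1.-tuple R * d.-tuple R)) : Prop :=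
  exists2 E', measurable E' & {ae P, forall p, G p <-> E' (U p)}.

Lemma recoverable_ae G H : {ae P, forall p, G p <-> H p} -> recoverable H -> recoverable G.
Proof.
move=> GH [E' mE' HE]; exists E' => //.
by apply: filterS2 GH HE => p [gh hg] [he eh]; split => [/gh/he|/eh/hg].
Qed.

Lemma recoverable_preimage E' : measurable E' -> recoverable (U @^-1` E').
Proof. by move=> mE'; exists E' => //; apply: filterE. Qed.

Lemma recoverableC G : recoverable G -> recoverable (~` G).
Proof.
move=> [E' mE' HE]; exists (~` E'); first exact: measurableC.
by apply: filterS HE => p [ge eg]; split => h h'; apply: h; [exact: eg|exact: ge].
Qed.

Lemma recoverableU G H : recoverable G -> recoverable H -> recoverable (G `|` H).
Proof.
move=> [E' mE' GE] [F' mF' HF]; exists (E' `|` F'); first exact: measurableU.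
apply: filterS2 GE HF => p [a b] [c e].
by split => -[h|h]; [left; exact: a|right; exact: c|left; exact: b|right; exact: e].
Qed.

Lemma recoverable_bigcup (G : nat -> set (d.+1.-tuple R * d.-tuple R)) :
  (forall n, recoverable (G n)) -> recoverable (\bigcup_n G n).
Proof.
move=> h; pose E' n := sval (cid2 (h n)).
have mE' n : measurable (E' n) by rewrite /E'; case: cid2.
have GE n : {ae P, forall p, G n p <-> E' n (U p)} by rewrite /E'; case: cid2.
exists (\bigcup_n E' n); first exact: bigcupT_measurable.
apply: filterS (ae_foralln GE) => p GEp.
by split => -[n _ Gn]; exists n => //; apply/GEp.
Qed.

Lemma recoverable_forall_rat (G : rat -> set (d.+1.-tuple R * d.-tuple R)) :
  (forall q, recoverable (G q)) -> recoverable [set p | forall q, G q p].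
Proof.
move=> h; pose E' q := sval (cid2 (h q)).
have mE' q : measurable (E' q) by rewrite /E'; case: cid2.
have GE q : {ae P, forall p, G q p <-> E' q (U p)} by rewrite /E'; case: cid2.
exists (\bigcap_q E' q).
  rewrite -[X in measurable X]setCK setC_bigcap; apply: measurableC.
  by apply: bigcupT_measurable_rat => q; exact: measurableC.
apply: filterS (ae_forall_rat GE) => p GEp.
by split => [Gp q _|Ep q]; apply/GEp; [exact: Gp|exact: Ep].
Qed.

Lemma rosenblatt_good_ae : {ae P, forall p, cube p.1 /\ cube p.2}.
Proof. exact: (ae_pr1 (measurable_rosenblatt_good (d := d)) (pr_rosenblatt_good cA)). Qed.

(* X_i <= t is a.s. equivalent to U_i <= K(X_1, ..., X_{i-1}; [0, t]): one
   inclusion is clear, and both events have the same probability. *)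
Lemma recoverable_coord i (t : R) : (i < d)%N ->
  (forall B, measurable B -> recoverable [set p | B (@first_coords R d.+1 i p.1)]) ->
  recoverable [set p : d.+1.-tuple R * d.-tuple R | nth 0 p.1 i <= t].
Proof.
case: i => [|j] id IH.
  apply: (recoverable_ae (H := U @^-1` [set u | tnth u (Ordinal id) <= t])).
    by apply: filterE => p; rewrite /U /preimage /= rosenblatt_varE.
  apply: recoverable_preimage; exact: (measurable_tnth_preimage _ (measurable_setle t)).
set i := j.+1 in id IH *.
have idd : (i < d.+1)%N by exact: ltnW.
have im : (i <= d.+1)%N by exact: ltnW.
pose K := markov_kernel (@copula_margin R d.+1 i.+1 A).
pose c (z : i.-tuple R) := pr (kprob K z) `[0, t]%classic.
have mc : measurable_fun setT c.
  by apply: measurableT_comp => //; apply: measurable_kernel; exact: measurable_itv.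
have c01 z : 0 <= c z <= 1 by rewrite pr_ge0 pr_le1//; exact: measurable_itv.
pose G : set (d.+1.-tuple R * d.-tuple R) := [set p : d.+1.-tuple R * d.-tuple R | 0 <= nth 0 p.1 i <= t].
pose H : set (d.+1.-tuple R * d.-tuple R) := [set p : d.+1.-tuple R * d.-tuple R |
  rosenblatt_coord A (nth 0 p.2 i) (first_coords i p.1) (nth 0 p.1 i) <= c (first_coords i p.1)].
have mS : measurable [set x : d.+1.-tuple R | 0 <= nth 0 x i <= t].
  by have := @measurable_nth R d.+1 i measurableT _ (measurable_setcc 0 t); rewrite setTI.
have mG : measurable G by rewrite -[X in measurable X]setTI; exact: (measurable_fst measurableT _ mS).
have mfi : measurable_fun setT (fun p : d.+1.-tuple R * d.-tuple R => first_coords i p.1).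
  by apply: (measurableT_comp (f := @first_coords R d.+1 i)) => //; exact: measurable_first_coords.
have mH : measurable H.
  apply: measurable_set_le; last exact: (measurableT_comp mc mfi).
  apply: measurable_rosenblatt_coord => //.
  - by apply: (measurableT_comp (@measurable_nth R d i)).
  - by apply: (measurableT_comp (@measurable_nth R d.+1 i)).
have GH : {ae P, forall p, G p -> H p}.
  apply: filterS rosenblatt_good_ae => p [c1 c2] /andP[x0 xt]; rewrite /H /= /rosenblatt_coord /=.
  have r1 : nth 0 p.2 i <= 1 by have /andP[_] := c2 (Ordinal id); rewrite (tnth_nth 0).
  set s := nth 0 p.1 i; set z := first_coords i p.1.
  rewrite -[cond_df _ _ _ _]/(randomized_df (kprob K z) s (nth 0 p.2 i)) /randomized_df.
  apply: (@le_trans _ _ (pr (kprob K z) (`[0, s[%classic `|` [set s]))).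
    rewrite prU//; last by apply/seteqP; split => // x [/=]; rewrite in_itv /= => + xs; rewrite xs ltxx andbF.
    by rewrite lerD2l ler_piMl// pr_ge0.
  apply: le_pr; [exact: measurableU|exact: measurable_itv|].
  move=> x [|->]; rewrite /= !in_itv /=; last by rewrite x0 xt.
  by move=> /andP[-> xs] /=; rewrite (le_trans (ltW xs)).
(* With the threshold [c z = K z [0, t]] and no condition on the earlier variables,
   [rosenblatt_step] gives the integral of [K z [0, t]], which is the probability of 0 <= X_i <=
   t. *)
have HG : pr P H = pr P G.
  transitivity (pr mu [set x | 0 <= nth 0 x i <= t]); last first.
    have -> : G = [set x : d.+1.-tuple R | 0 <= nth 0 x i <= t] `*` setT.
      by apply/seteqP; split => // p [].
    by rewrite [RHS]prX// prT mulr1.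
  congr fine.
  transitivity (P ([set p : d.+1.-tuple R * d.-tuple R |
      [set: i.-tuple R * i.-tuple R] (first_coords i p.1, first_coords i p.2)] `&` H)).
    by congr (P _); apply/seteqP; split => p; [move=> Hp; split|case].
  rewrite [LHS](rosenblatt_step cA im id mc c01 measurableT).
  transitivity (\int[lebesgue_cube i]_r (mu [set x | (0 <= nth 0 x i <= t)%R]))%E; last first.
    rewrite integral_cst// -[RHS]mule1; congr (_ * _)%E; exact: probability_setT.
  apply: eq_integral => r _; have -> : ysection [set: i.-tuple R * i.-tuple R] r = setT by apply/seteqP; split => // z _; apply/mem_set.
  transitivity (law mu (measurable_coords_pair (m := d.+1) (ltnW idd)) (setT `*` `[0, t]%classic)); last first.
    by rewrite lawE; congr (mu _); apply/seteqP; split => x; rewrite /preimage /= in_itv /=; [case|].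
  rewrite (margin_kernelP muA idd measurableT (measurable_itv _)).
  have -> : im = ltnW idd by exact: bool_irrelevance.
  by apply: eq_integral => z _; rewrite -prE//; exact: measurable_itv.
apply: (recoverable_ae (H := H)).
  apply: filterS2 rosenblatt_good_ae (ae_sub_eq mG mH GH _) => [p [c1 _] [gh hg]|].
    have x0 : 0 <= nth 0 p.1 i by have /andP[+ _] := c1 (Ordinal idd); rewrite (tnth_nth 0).
    split => [xt|/hg/andP[]//]; by apply: gh; apply/andP.
  by rewrite HG.
(* U_i <= c means that every rational q satisfies U_i <= q or q < c. The first event concerns U and
   the second only earlier coordinates, so H is a countable combination of recoverable events. *)
pose B q : set (i.-tuple R) := [set z | ratr q < c z].
have mB q : measurable (B q) by exact: measurable_set_lt.
have -> : H = [set p | forall q : rat,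
    ((U @^-1` [set u | tnth u (Ordinal id) <= ratr q]) `|` [set p | B q (first_coords i p.1)]) p].
  apply/seteqP; split => p; rewrite /H /= /B /=.
    move=> pc q; rewrite /U /preimage /= rosenblatt_varE /=.
    by have [|qU] := leP (rosenblatt_coord _ _ _ _) (ratr q); [left|right; exact: lt_le_trans pc].
  move=> h; rewrite leNgt; apply/negP => /rat_in_itvoo[q /itvP qI].
  have [|] := h q.
    by rewrite /U /preimage /= rosenblatt_varE /= leNgt qI.
  by rewrite ltNge ltW// qI.
apply: recoverable_forall_rat => q; apply: recoverableU; last exact: IH.
apply: recoverable_preimage; exact: (measurable_tnth_preimage _ (measurable_setle _)).
Qed.

(** The sets with recoverable preimage form a sigma-algebra, and an orthant in dimension i + 1 is an
    orthant in dimension i together with a bound on one more coordinate. *)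
Lemma recoverable_first_coords i : (i <= d)%N -> forall B, measurable B ->
  recoverable [set p | B (@first_coords R d.+1 i p.1)].
Proof.
elim: i => [_|i IH id] B mB.
  have z0 (z : 0.-tuple R) : z = [tuple] by exact: tuple0.
  have [B0|B0] := pselect (B [tuple]).
    apply: (recoverable_ae (H := U @^-1` setT)); last exact: recoverable_preimage.
    by apply: filterE => p; rewrite /= (z0 (first_coords _ _)).
  apply: (recoverable_ae (H := U @^-1` set0)); last exact: recoverable_preimage.
  by apply: filterE => p; rewrite /= (z0 (first_coords _ _)).
pose C := [set B | recoverable [set p | B (@first_coords R d.+1 i.+1 p.1)]].
suff : @measurable _ (i.+1.-tuple R) `<=` C by exact.
rewrite lower_orthant_gen; apply: smallest_sub.
  split => [|F CF|F CF].
  - apply: (recoverable_ae (H := U @^-1` set0)); last exact: recoverable_preimage.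
    exact: filterE.
  - by rewrite setTD; exact: recoverableC CF.
  - exact: (recoverable_bigcup CF).
move=> _ [u _ <-].
pose u1 := [tuple tnth u (widen_ord (leqnSn i) j) | j < i].
apply: (recoverable_ae (H := ~` (~` [set p | lower_orthant u1 (@first_coords R d.+1 i p.1)] `|`
   ~` [set p : d.+1.-tuple R * d.-tuple R | nth 0 p.1 i <= tnth u ord_max]))); last first.
  apply: recoverableC; apply: recoverableU; apply: recoverableC.
    by apply: IH; [exact: ltnW|exact: measurable_lower_orthant].
  by apply: recoverable_coord => // B' mB'; apply: IH => //; exact: ltnW.
apply: filterE => p; rewrite setCU !setCK /=.
have id1 : (i < d.+1)%N by exact: ltnW.
split => [/forall_ordS[h1 h2]|[h1 h2]].
  split => [j|]; last by move: h2; rewrite tnth_mktuple.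
  by have := h1 j; rewrite !tnth_mktuple.
apply/forall_ordS; split => [j|]; last by rewrite tnth_mktuple.
by have := h1 j; rewrite !tnth_mktuple.
Qed.

Definition linkage_var (p : d.+1.-tuple R * d.-tuple R) : d.+1.-tuple R :=
  [tuple of rcons (U p) (last_coord p.1)].

Lemma measurable_linkage_var : measurable_fun setT linkage_var.
Proof.
apply: measurable_rcons => //.
by apply: (measurableT_comp (@measurable_last_coord R d)).
Qed.

Definition linkage_law := law P measurable_linkage_var.

(** The condition [cube p.2] built into [linkage] holds almost surely. *)
Lemma linkage_law_df : has_df_on_cube (linkage A) linkage_law.
Proof.
have mc := @measurable_cube R.
have mpre E : measurable E -> measurable (linkage_var @^-1` E).
  by move=> mE; rewrite -[X in measurable X]setTI; exact: measurable_linkage_var.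
split.
  have h : {ae P, forall p, setT p <-> (linkage_var @^-1` @cube R d.+1) p}.
    apply: filterS rosenblatt_good_ae => p [c1 c2]; split => // _.
    apply/forall_ordS; split => [j|]; last by rewrite tnth_rcons_max; exact: c1.
    by rewrite tnth_rcons_widen; apply: rosenblatt_var_cube.
  have := pr_ae_eq measurableT (mpre _ (mc _)) h; rewrite prT => h1.
  by rewrite (prE linkage_law (mc _)) pr_law -h1.
move=> u cu; rewrite (prE _ (measurable_lower_orthant u)); congr EFin.
rewrite /linkage -[RHS]/(pr P _) pr_law.
have mo := mpre _ (measurable_lower_orthant u).
have m2 : measurable [set p : d.+1.-tuple R * d.-tuple R | cube p.2].
  by rewrite -[X in measurable X]setTI; exact: (measurable_snd measurableT _ (mc d)).
apply: pr_ae_eq => //; first exact: (measurableI _ _ m2 mo).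
apply: filterS rosenblatt_good_ae => p [c1 c2].
by split => [h|[]].
Qed.

Lemma linkage_law_first E : measurable E ->
  law linkage_law (measurable_first_coords (leqnSn d)) E = lebesgue_cube d E.
Proof.
move=> mE; rewrite -(rosenblatt_var_uniform cA mE).
rewrite lawE /linkage_law lawE; congr (P _); apply/funext => p.
exact: (congr1 E (first_coords_rcons (U p) _)).
Qed.

End rosenblatt_recovery.

Section integrals_on_probability_spaces.
Context {R : realType} d (T : measurableType d) (P : probability T R).

Lemma integral_bounded_fin_num (f : T -> R) (M : R) E : measurable_fun setT f ->
  (forall x, 0 <= f x <= M) -> measurable E ->
  (\int[P]_(x in E) (f x)%:E)%E \is a fin_num.
Proof.
move=> mf fM mE; have [M0 _] : 0 <= M /\ True.
  by split => //; have /andP[] := fM point; exact: le_trans.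
rewrite ge0_fin_numE; last by apply: integral_ge0 => x _; rewrite lee_fin; case/andP: (fM x).
apply: (@le_lt_trans _ _ (\int[P]_(x in E) M%:E)%E).
  apply: ge0_le_integral => //.
  - by move=> x _; rewrite lee_fin; case/andP: (fM x).
  - by apply/measurable_EFinP; exact: measurable_funTS.
  - by move=> x _; rewrite lee_fin; case/andP: (fM x).
by rewrite integral_cst// ltey_eq fin_numM// fin_num_measure.
Qed.

Lemma integral_full (f : T -> \bar R) E : measurable E -> pr P E = 1 ->
  measurable_fun setT f -> (forall x, 0 <= f x)%E ->
  (\int[P]_(x in E) f x = \int[P]_x f x)%E.
Proof.
move=> mE E1 mf f0; rewrite integral_mkcond; apply: ge0_ae_eq_integral => //.
- by apply/(measurable_restrictT _ mE).1; exact: measurable_funTS.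
- by move=> x _; rewrite patchE; case: ifPn.
apply: filterS (ae_pr1 mE E1) => x Ex _; rewrite patchE; case: ifPn => // /negP[].
exact/mem_set.
Qed.

Lemma integral_setC_split (f : T -> \bar R) E : measurable E ->
  measurable_fun setT f -> (forall x, 0 <= f x)%E ->
  (\int[P]_x f x = \int[P]_(x in E) f x + \int[P]_(x in ~` E) f x)%E.
Proof.
move=> mE mf f0; rewrite -ge0_integral_setU ?setUv//; first exact: measurableC.
by apply/disj_set2P; rewrite setICr.
Qed.

End integrals_on_probability_spaces.

(** * The dependence measure as a supremum of deviations *)

Section dependence_sections.
Context {R : realType} (d : nat).

(** The bound 0 <= Y is there to match the interval [[0, y]] to which the kernel of [zeta1] is
    applied. *)
Definition deviation (mu : probability (d.+1.-tuple R) R) (y : R) (E : set (d.-tuple R)) : R :=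
  pr mu [set x | E (first_coords d x) /\ 0 <= last_coord x <= y] -
  y * pr mu [set x | E (first_coords d x)].

Definition zeta_section (A : d.+1.-tuple R -> R) (y : R) : R :=
  fine (\int[lebesgue_cube d]_(x in @cube R d)
    `|markov_kernel (linkage A) x `[0%R, y]%classic - y%:E|)%E.

Variable A : d.+1.-tuple R -> R.
Hypothesis cA : is_copula A.

Let mu := copula_measure A.
Let nu := linkage_law A.
Let K := markov_kernel (linkage A).
Let lam := lebesgue_cube (R := R) d.

Let mfc := measurable_first_coords (R := R) (leqnSn d).

Let mpre (E : set (d.-tuple R)) : measurable E -> measurable (@first_coords R d.+1 d @^-1` E).
Proof. by move=> mE; rewrite -[X in measurable X]setTI; exact: mfc. Qed.

(** The kernel is integrated against Lebesgue measure because the first d coordinates of the linkage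
    are uniform; this ties the integral in [zeta1] to probabilities of (U, Y). *)
Lemma linkage_kernelP E F : measurable E -> measurable F ->
  nu [set x | E (first_coords d x) /\ F (last_coord x)] = (\int[lam]_(z in E) K z F)%E.
Proof.
move=> mE mF; have h := linkage_law_df cA.
have mEF : measurable [set x : d.+1.-tuple R | E (first_coords d x) /\ F (last_coord x)].
  exact: (measurableI _ _ (mpre mE) (measurable_tnth_preimage ord_max mF)).
have mKF : measurable_fun setT (K ^~ F) by exact: measurable_kernel.
have := markov_kernelP h mE mF.
rewrite (copula_measureE h mEF) (eq_measure_integral nu); last first.
  by move=> B mB _; exact: (copula_measureE h mB).
move=> ->.
transitivity (\int[law nu mfc]_(z in E) K z F)%E.
  by rewrite ge0_integral_law//; exact: measurable_funTS.
apply: eq_measure_integral => B mB _; exact: linkage_law_first.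
Qed.

Section fixed_level.
Variable y : R.
Hypothesis y01 : 0 <= y <= 1.

Let k z := pr (kprob K z) `[0, y]%classic.

Let mk : measurable_fun setT k.
Proof. by apply: measurableT_comp => //; exact: measurable_kernel. Qed.

Let k01 z : 0 <= k z <= 1.
Proof. by rewrite pr_ge0 pr_le1. Qed.

Let mcube : measurable (@cube R d). Proof. exact: measurable_cube. Qed.

Lemma integral_zeta_section :
  (\int[lam]_(x in @cube R d) `|K x `[0%R, y]%classic - y%:E| =
   \int[lam]_x (`|k x - y|%R)%:E)%E.
Proof.
transitivity (\int[lam]_(x in @cube R d) (`|k x - y|%R)%:E)%E.
  apply: eq_integral => x _.
  have -> : K x `[0, y]%classic = (k x)%:E by rewrite /k -prE.
  by rewrite -EFinB.
apply: integral_full => //; first exact: pr_lebesgue_cube_cube.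
by apply/measurable_EFinP; apply: measurableT_comp => //; exact: measurable_funB.
Qed.

Let mabs : measurable_fun setT (fun x => `|k x - y|).
Proof. by apply: measurableT_comp => //; exact: measurable_funB. Qed.

Let abs01 x : 0 <= `|k x - y| <= 1.
Proof.
rewrite normr_ge0 /=; have /andP[k0 k1] := k01 x; have /andP[y0 y1] := y01.
by rewrite ler_norml; apply/andP; split; lra.
Qed.

Lemma zeta_sectionE : (zeta_section A y)%:E = (\int[lam]_x (`|k x - y|%R)%:E)%E.
Proof.
rewrite /zeta_section integral_zeta_section fineK//.
exact: (@integral_bounded_fin_num _ _ _ _ _ 1).
Qed.

Lemma zeta_section01 : 0 <= zeta_section A y <= 1.
Proof.
rewrite -!lee_fin zeta_sectionE; apply/andP; split.
  by apply: integral_ge0 => x _; rewrite lee_fin.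
apply: (@le_trans _ _ (\int[lam]_x 1%:E)%E).
  apply: ge0_le_integral => //; first exact/measurable_EFinP.
  by move=> x _; rewrite lee_fin; case/andP: (abs01 x).
by rewrite integral_cst// [X in (_ * X)%E](probability_setT lam) mule1.
Qed.

Let mmax : measurable_fun setT (fun x => Num.max (k x) y).
Proof. by apply: measurable_maxr. Qed.

Let max01 x : 0 <= Num.max (k x) y <= 1.
Proof.
have /andP[k0 k1] := k01 x; have /andP[y0 y1] := y01.
by rewrite le_max k0 ge_max k1 y1.
Qed.

Let I := fine (\int[lam]_x (Num.max (k x) y)%:E)%E.

Let IE : (\int[lam]_x (Num.max (k x) y)%:E)%E = I%:E.
Proof. by rewrite /I fineK//; exact: (@integral_bounded_fin_num _ _ _ _ _ 1). Qed.

Let m E := pr nu [set x | E (first_coords d x) /\ 0 <= last_coord x <= y].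

Let mE (E : set (d.-tuple R)) : measurable E -> (\int[lam]_(z in E) (k z)%:E)%E = (m E)%:E.
Proof.
move=> mE; rewrite /m -prE; last first.
  exact: (measurableI _ _ (mpre mE) (measurable_tnth_preimage ord_max (measurable_setcc 0 y))).
transitivity (nu [set x | E (first_coords d x) /\ `[0, y]%classic (last_coord x)]).
  rewrite linkage_kernelP//; apply: eq_integral => z _; by rewrite /k -prE.
by congr (nu _); apply/seteqP; split => x; rewrite /= in_itv.
Qed.

Let y0E : (0 <= y%:E)%E. Proof. by rewrite lee_fin; case/andP: y01. Qed.

(* |k - y| = 2 max(k, y) - k - y, so maximizing the deviation amounts to integrating
   max(k, y), with the optimal event {y <= k}. *)
Let split_max E : measurable E -> m E + y * (1 - pr lam E) <= I.
Proof.
move=> mE'; rewrite -lee_fin EFinD EFinM -mE// -IE.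
have mC := measurableC mE'.
have mf E' : measurable_fun E' (EFin \o k) by apply/measurable_EFinP; exact: measurable_funTS.
have mx E' : measurable_fun E' (fun x => (Num.max (k x) y)%:E) by apply/measurable_EFinP; exact: measurable_funTS.
rewrite -prC// -prE// -integral_cst//.
rewrite [leRHS](integral_setC_split lam mE' (mx setT)); last first.
  by move=> x; rewrite lee_fin; case/andP: (max01 x).
apply: leeD; apply: ge0_le_integral => //.
- by move=> x _; rewrite lee_fin; case/andP: (k01 x).
- by move=> x _; rewrite lee_fin le_max lexx.
- by move=> x _; rewrite lee_fin le_max lexx orbT.
Qed.

Let E0 := [set x | y <= k x].

Let mE0 : measurable E0. Proof. exact: measurable_set_le. Qed.

Let split_max_eq : m E0 + y * (1 - pr lam E0) = I.
Proof.
apply: EFin_inj; rewrite EFinD EFinM -mE// -IE.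
have mC := measurableC mE0.
have mx E' : measurable_fun E' (fun x => (Num.max (k x) y)%:E) by apply/measurable_EFinP; exact: measurable_funTS.
rewrite -prC// -prE// -integral_cst//.
rewrite [RHS](integral_setC_split lam mE0 (mx setT)); last first.
  by move=> x; rewrite lee_fin; case/andP: (max01 x).
congr (_ + _)%E; apply: eq_integral => x /set_mem; rewrite /E0 /= => h.
  by rewrite max_l.
by rewrite max_r//; move/negP : h; rewrite -ltNge => /ltW.
Qed.

Lemma linkage_last : m setT = y.
Proof.
have ml : measurable [set x : d.+1.-tuple R | 0 <= last_coord x <= y].
  exact: (measurable_tnth_preimage ord_max (measurable_setcc 0 y)).
transitivity (pr mu [set x | 0 <= last_coord x <= y]).
  rewrite /m /nu /linkage_law pr_law.
  transitivity (pr (rosenblatt_space A) ([set x : d.+1.-tuple R | 0 <= last_coord x <= y] `*` setT)); last first.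
    by rewrite [LHS]prX// prT mulr1.
  congr pr; apply/seteqP; split => p.
    by move=> [_]; rewrite /= /last_coord tnth_rcons_max.
  by move=> [h _]; split => //; rewrite /last_coord tnth_rcons_max.
have [h1 h2] := is_copula_measure cA.
rewrite -[RHS](h2 ord_max y y01).
apply: pr_eq_on (copula_measure_cube cA) _ => //.
- exact: measurable_cube.
- exact: (measurable_tnth_preimage ord_max (measurable_setle y)).
apply/seteqP; split => x [/= xy cx]; split => //; first by case/andP: xy.
by rewrite /last_coord xy andbT; case/andP: (cx ord_max).
Qed.

Let section_max : zeta_section A y + y + y = 2 * I.
Proof.
have mT : m setT = y := linkage_last.
have e : (\int[lam]_x ((`|k x - y|%R)%:E + (k x)%:E + y%:E) = (zeta_section A y + y + y)%:E)%E.
  have mEk : measurable_fun setT (EFin \o k) by exact/measurable_EFinP.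
  have mEa : measurable_fun setT (fun x => (`|k x - y|%R)%:E) by exact/measurable_EFinP.
  have mEs : measurable_fun setT (fun x => (`|k x - y|%R)%:E + (k x)%:E)%E by exact: emeasurable_funD.
  have k0 x : (0 <= (k x)%:E)%E by rewrite lee_fin; case/andP: (k01 x).
  have s0 x : (0 <= (`|k x - y|%R)%:E + (k x)%:E)%E by rewrite adde_ge0.
  rewrite ge0_integralD// ge0_integralD//.
  rewrite mE// mT -zeta_sectionE integral_cst// [X in (_ + _ * X)%E](probability_setT lam) mule1.
  by rewrite !EFinD.
apply: EFin_inj; rewrite -e EFinM -IE -ge0_integralZl//; last 2 first.
- exact/measurable_EFinP.
- by move=> x _; rewrite lee_fin; case/andP: (max01 x).
apply: eq_integral => x _; rewrite -!EFinD -EFinM; congr EFin.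
have [ky|ky] := leP (k x) y.
  by rewrite ler0_norm ?subr_le0//; ring.
by rewrite gtr0_norm ?subr_gt0//; ring.
Qed.

Let devnu E : measurable E -> deviation nu y E = m E - y * pr lam E.
Proof.
move=> mE'; rewrite /deviation -/(m E); congr (_ - _ * _).
rewrite -[LHS](pr_law nu mfc); congr fine; exact: linkage_law_first.
Qed.

Let deviation_nu_le E : measurable E -> 2 * deviation nu y E <= zeta_section A y.
Proof.
move=> mE'; rewrite devnu//; have := split_max mE'; have := section_max.
by move=> h1 h2; lra.
Qed.

Let deviation_nu_eq : 2 * deviation nu y E0 = zeta_section A y.
Proof.
rewrite devnu//; have := split_max_eq; have := section_max.
by move=> h1 h2; lra.
Qed.

Let ml : measurable [set x : d.+1.-tuple R | 0 <= last_coord x <= y].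
Proof. exact: (measurable_tnth_preimage ord_max (measurable_setcc 0 y)). Qed.

Let P := rosenblatt_space A.
Let U := rosenblatt_var A.

Let mpreU E : measurable E -> measurable (U @^-1` E).
Proof. by move=> mE'; rewrite -[X in measurable X]setTI; exact: measurable_rosenblatt_var. Qed.

Let mlP : measurable [set p : d.+1.-tuple R * d.-tuple R | 0 <= last_coord p.1 <= y].
Proof. by rewrite -[X in measurable X]setTI; exact: (measurable_fst measurableT _ ml). Qed.

Let deviation_nuE E : measurable E -> deviation nu y E =
  pr P [set p | E (U p) /\ 0 <= last_coord p.1 <= y] - y * pr P [set p | E (U p)].
Proof.
move=> mE'; rewrite /deviation /nu /linkage_law !pr_law.
have fU p : first_coords d (linkage_var A p) = U p by exact: first_coords_rcons.
have lU p : last_coord (linkage_var A p) = last_coord p.1.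
  by rewrite [LHS]tnth_rcons_max.
have -> : linkage_var A @^-1` [set x | E (first_coords d x) /\ 0 <= last_coord x <= y] =
    [set p | E (U p) /\ 0 <= last_coord p.1 <= y].
  by apply/funext => p; rewrite /preimage /= fU lU.
have -> : linkage_var A @^-1` [set x | E (first_coords d x)] = [set p | E (U p)].
  by apply/funext => p; rewrite /preimage /= fU.
by [].
Qed.

Lemma deviation_le E : measurable E -> 2 * deviation mu y E <= zeta_section A y.
Proof.
move=> mE'.
have [E' mE1 EE'] := recoverable_first_coords cA (leqnn d) mE'.
have mEP : measurable [set p : d.+1.-tuple R * d.-tuple R | E (first_coords d p.1)].
  by rewrite -[X in measurable X]setTI; exact: (measurable_fst measurableT _ (mpre mE')).
suff -> : deviation mu y E = deviation nu y E' by exact: deviation_nu_le.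
rewrite deviation_nuE// /deviation.
have e1 : pr mu [set x | E (first_coords d x) /\ 0 <= last_coord x <= y] =
    pr P [set p | E' (U p) /\ 0 <= last_coord p.1 <= y].
  transitivity (pr P ([set x : d.+1.-tuple R | E (first_coords d x) /\ 0 <= last_coord x <= y] `*` setT)).
    by rewrite [RHS]prX ?prT ?mulr1//; exact: (measurableI _ _ (mpre mE') ml).
  apply: pr_ae_eq.
  - by apply: measurableX => //; exact: (measurableI _ _ (mpre mE') ml).
  - exact: (measurableI _ _ (mpreU mE1) mlP).
  apply: filterS EE' => p [h1 h2]; split; first by move=> [[h3 h4] _]; split => //; exact: h1.
  by move=> [h3 h4]; split => //; split => //; exact: h2.
have e2 : pr mu [set x | E (first_coords d x)] = pr P [set p | E' (U p)].
  transitivity (pr P ([set x : d.+1.-tuple R | E (first_coords d x)] `*` setT)).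
    by rewrite [RHS]prX ?prT ?mulr1//; exact: mpre.
  apply: pr_ae_eq; [by apply: measurableX => //; exact: mpre|exact: mpreU|].
  by apply: filterS EE' => p [h1 h2]; split => [[/h1]|/h2].
by rewrite e1 e2.
Qed.

(* The deviation of a U-event is the average over r of the deviations of the
   X-events obtained by freezing R = r. *)
Lemma zeta_section_le b : (forall E, measurable E -> 2 * deviation mu y E <= b) ->
  zeta_section A y <= b.
Proof.
(* The empty event gives b >= 0, which the additivity of nonnegative extended integrals asks for
   when b / 2 is put under the integral. *)
move=> hb; have b0 : 0 <= b.
  have := hb set0 measurable0; rewrite /deviation.
  rewrite (_ : [set x | _ /\ _] = set0); last by apply/seteqP; split => // x [].
  by rewrite (_ : [set x : d.+1.-tuple R | set0 (first_coords d x)] = set0)// !pr0 mulr0 subr0 mulr0.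
have /andP[y0 y1] := y01.
rewrite -deviation_nu_eq deviation_nuE//.
pose G1 := [set p | E0 (U p) /\ 0 <= last_coord p.1 <= y].
pose G2 := [set p | E0 (U p)].
have mG2 : measurable G2 by exact: mpreU.
have mG1 : measurable G1 by exact: (measurableI _ _ mG2 mlP).
suff : (P G1 <= (b / 2 + y * pr P G2)%:E)%E.
  by rewrite (prE P mG1) lee_fin -/G1 -/G2; lra.
have mE1 r : measurable [set z : d.-tuple R | E0 (rosenblatt A r z)].
  have mr : measurable_fun setT (fun z : d.-tuple R => rosenblatt A r z).
    apply/measurable_fun_tnthP => j.
    rewrite (_ : _ \o _ = fun z : d.-tuple R => rosenblatt_coord A (nth 0 r j) (first_coords j z) (nth 0 z j)).
      apply: measurable_rosenblatt_coord => //.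
      - by apply: measurable_first_coords; exact: ltnW.
      - exact: (@measurable_nth R d j).
    by apply/funext => z; rewrite /= tnth_mktuple /rosenblatt_coord !(tnth_nth 0).
  by rewrite -[X in measurable X]setTI; exact: mr.
rewrite (EFinD (b / 2)) (EFinM y) -(prE P mG2) /P /rosenblatt_space.
rewrite [leLHS](pr_productE2 _ _ mG1) [X in (_ + _ * X)%E](pr_productE2 _ _ mG2).
rewrite -ge0_integralZl//; last exact: measurable_fun_ysection.
have -> : (b / 2)%:E = (\int[lam]_r (b / 2)%:E)%E.
  by rewrite integral_cst// [X in (_ * X)%E](probability_setT lam) mule1.
have b2 : (0 <= (b / 2)%:E)%E by rewrite lee_fin divr_ge0.
rewrite -ge0_integralD//; last 2 first.
- by move=> r _; rewrite mule_ge0.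
- by apply: measurable_funeM; exact: measurable_fun_ysection.
apply: ge0_le_integral => //.
- exact: measurable_fun_ysection.
- by apply: emeasurable_funD => //; apply: measurable_funeM; exact: measurable_fun_ysection.
move=> r _; have m1 := measurable_ysection r mG1; have m2 := measurable_ysection r mG2.
rewrite (prE mu m1) (prE mu m2) -EFinM -EFinD lee_fin.
have := hb _ (mE1 r); rewrite /deviation.
have -> : ysection G1 r = [set x | [set z | E0 (rosenblatt A r z)] (first_coords d x) /\ 0 <= last_coord x <= y].
  by apply/seteqP; split => x; rewrite /ysection /=; [move/set_mem|move=> h; apply/mem_set].
have -> : ysection G2 r = [set x | [set z | E0 (rosenblatt A r z)] (first_coords d x)].
  by apply/seteqP; split => x; rewrite /ysection /=; [move/set_mem|move=> h; apply/mem_set].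
by lra.
Qed.

End fixed_level.

Lemma measurable_zeta_section : measurable_fun (`[0, 1]%classic : set R) (zeta_section A).
Proof.
pose f (p : d.-tuple R * R) := pr (kprob K p.1) `[0, p.2]%classic.
have mf : measurable_fun setT f.
  have mB : measurable [set q : (d.-tuple R * R) * R | 0 <= q.2 /\ q.2 <= q.1.2].
    apply: measurableI; first exact: (measurable_set_le (f := cst 0) (g := snd)).
    by apply: (measurable_set_le (f := snd) (g := snd \o fst)) => //; exact: measurableT_comp.
  have := measurable_kprob_section K (f := fst) measurable_fst mB; congr (measurable_fun _ _); apply/funext => s.
  congr pr; apply/seteqP; split => t; rewrite /xsection /=.
    by move=> /set_mem[/= h1 h2]; rewrite in_itv /= h1 h2.
  by rewrite in_itv /= => /andP[h1 h2]; apply/mem_set.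
pose g (p : d.-tuple R * R) := (`|f p - p.2|)%:E.
have mg : measurable_fun setT g.
  by apply/measurable_EFinP; apply: measurableT_comp => //; apply: measurable_funB.
have mG : measurable_fun setT (fun y => \int[lam]_x g (x, y))%E.
  by apply: (measurable_fun_fubini_tonelli_G (m1 := lam) g) => // p; rewrite lee_fin.
apply: (eq_measurable_fun (fun y => fine (\int[lam]_x g (x, y))%E)); last first.
  by apply: measurable_funTS; apply: measurableT_comp.
move=> y /set_mem; rewrite /= in_itv /= => y01.
by rewrite -(zeta_sectionE y01).
Qed.

Lemma zeta1E : zeta1 A = 3 * fine (\int[lebesgue_measure]_(y in `[0%R, 1%R]) (zeta_section A y)%:E)%E.
Proof.
rewrite /zeta1; congr (_ * fine _); apply: eq_integral => y /set_mem.
rewrite /= in_itv /= => y01.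
by rewrite zeta_sectionE// -integral_zeta_section.
Qed.

End dependence_sections.

(** * Checkerboards *)

Section mixtures.
Context {R : realType} d (T : measurableType d) (I : finType).
Variables (w : I -> R) (U : I -> probability T R).
Hypotheses (w0 : forall i, 0 <= w i) (w1 : \sum_i w i = 1).

(** Recursion over a list keeps each partial sum a measure by construction. *)
Fixpoint seq_mixture (s : seq I) : {measure set T -> \bar R} :=
  if s is i :: s' then measure_add (mscale (NngNum (w0 i)) (U i)) (seq_mixture s')
  else mzero.

Lemma seq_mixtureE s E : seq_mixture s E = (\sum_(i <- s) (w i)%:E * U i E)%E.
Proof.
elim: s => [|i s IH]; first by rewrite big_nil.
by rewrite big_cons -IH [LHS]measure_addE.
Qed.

(** The proof that the weights sum to 1 is an argument, so that the probability structure can be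
    attached to the term. *)
Definition mixture_fun (_ : \sum_i w i = 1) : set T -> \bar R := seq_mixture (index_enum I).

HB.instance Definition _ := Measure.on (mixture_fun w1).

Lemma mixture_setT : mixture_fun w1 setT = 1%E.
Proof.
rewrite /mixture_fun seq_mixtureE -[1%E]/(1%:E) -w1 -sumEFin; apply: eq_bigr => i _.
by rewrite probability_setT mule1.
Qed.

HB.instance Definition _ := Measure_isProbability.Build _ _ R (mixture_fun w1) mixture_setT.

Definition mixture : probability T R := mixture_fun w1.

Lemma pr_mixture E : measurable E -> pr mixture E = \sum_i w i * pr (U i) E.
Proof.
move=> mE; apply: EFin_inj; rewrite -prE// -sumEFin.
rewrite -[LHS]/(seq_mixture _ E) seq_mixtureE; apply: eq_bigr => i _.
by rewrite EFinM -prE.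
Qed.

End mixtures.

Section cell_laws.
Context {R : realType} (N : nat).
Hypothesis N0 : (0 < N)%N.

Let NR0 : 0 < N%:R :> R. Proof. by rewrite ltr0n. Qed.

Definition cell_map m (i : m.-tuple 'I_N) (x : m.-tuple R) : m.-tuple R :=
  [tuple ((tnth i j)%:R + tnth x j) / N%:R | j < m].

Lemma measurable_cell_map m (i : m.-tuple 'I_N) : measurable_fun setT (cell_map i).
Proof.
apply/measurable_fun_tnthP => j.
rewrite (_ : _ \o _ = fun x : m.-tuple R => ((tnth i j)%:R + tnth x j) / N%:R); last first.
  by apply/funext => x; rewrite /= tnth_mktuple.
apply: measurable_funM => //; apply: measurable_funD => //; exact: measurable_tnth.
Qed.

Definition cell_law m (i : m.-tuple 'I_N) : probability (m.-tuple R) R :=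
  law (lebesgue_cube m) (measurable_cell_map i).

Lemma pr_lebesgue_cube_coord m (j : 'I_m) (B : set R) : measurable B ->
  pr (lebesgue_cube m) [set x | B (tnth x j)] = pr unif B.
Proof.
move=> mB; pose C (l : 'I_m) := if l == j then B else setT.
have mC l : measurable (C l) by rewrite /C; case: ifP.
rewrite (_ : [set x | _] = [set x | forall l, C l (tnth x l)]); last first.
  apply/seteqP; split => x /= h; first by move=> l; rewrite /C; case: eqP => [->|].
  by have := h j; rewrite /C eqxx.
rewrite pr_lebesgue_cube_box// (bigD1 j)//= /C eqxx big1 ?mulr1// => l /negbTE ->.
exact: prT.
Qed.

Lemma cell_coord_le m (i : m.-tuple 'I_N) x (j : 'I_m) (t : R) :
  (tnth (cell_map i x) j <= t) = (tnth x j <= N%:R * t - (tnth i j)%:R).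
Proof. by rewrite tnth_mktuple ler_pdivrMr// lerBrDl mulrC. Qed.

Lemma pr_cell_law_orthant m (i : m.-tuple 'I_N) u :
  pr (cell_law i) (lower_orthant u) = \prod_j clamp (N%:R * tnth u j - (tnth i j)%:R).
Proof.
rewrite pr_law (_ : _ @^-1` _ =
  lower_orthant [tuple N%:R * tnth u j - (tnth i j)%:R | j < m]).
  by rewrite pr_lebesgue_cube_orthant; apply: eq_bigr => j _; rewrite tnth_mktuple.
by apply/seteqP; split => x /= h j; have := h j; rewrite cell_coord_le tnth_mktuple.
Qed.

Lemma pr_cell_law_coord m (i : m.-tuple 'I_N) (j : 'I_m) t :
  pr (cell_law i) [set x | tnth x j <= t] = clamp (N%:R * t - (tnth i j)%:R).
Proof.
rewrite pr_law (_ : _ @^-1` _ = [set x | tnth x j <= N%:R * t - (tnth i j)%:R]).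
  by rewrite (pr_lebesgue_cube_coord _ (measurable_setle _)) pr_unif_le.
by apply/seteqP; split => x /=; rewrite cell_coord_le.
Qed.

Lemma cell_map_cube m (i : m.-tuple 'I_N) x : cube x -> cube (cell_map i x).
Proof.
move=> cx j; rewrite tnth_mktuple; have /andP[x0 x1] := cx j.
rewrite divr_ge0 ?addr_ge0//= ler_pdivrMr// mul1r.
by rewrite (@le_trans _ _ ((tnth i j).+1%:R))// ?ler_nat// -natr1 lerD2l.
Qed.

Lemma pr_cell_law_cube m (i : m.-tuple 'I_N) : pr (cell_law i) (@cube R m) = 1.
Proof.
have mc := @measurable_cube R m.
have mpre : measurable (cell_map i @^-1` @cube R m).
  by rewrite -[X in measurable X]setTI; exact: measurable_cell_map.
apply/eqP; rewrite eq_le pr_le1//= pr_law -[leLHS](pr_lebesgue_cube_cube m).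
by apply: le_pr => // x; exact: cell_map_cube.
Qed.

(** The unit intervals to the left of x contribute 1 each, those to the right 0, and the one
    containing x its covered part. *)
Lemma sum_clamp (n : nat) (x : R) : 0 <= x <= n%:R -> \sum_(a < n) clamp (x - a%:R) = x.
Proof.
elim: n => [|n IH] /andP[x0 xn].
  by rewrite big_ord0; apply/eqP; rewrite eq_le x0 xn.
rewrite big_ord_recr/=; have [xn'|xn'] := leP x n%:R.
  by rewrite IH ?x0// clamp_lt0 ?addr0// subr_le0.
rewrite clamp_id; last by rewrite subr_ge0 ltW//= lerBlDl natr1.
rewrite (eq_bigr (fun=> 1)) => [|a _].
  by rewrite sumr_const card_ord addrC subrK.
by rewrite clamp_gt1// lerBrDl (le_trans _ (ltW xn'))// natr1 ler_nat.
Qed.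

(** The distribution function of the mixture of uniform laws on cells with weights w; checkerboards
    and the empirical multilinear copula both have this form. *)
Definition cell_mixture_df m (w : m.-tuple 'I_N -> R) (u : m.-tuple R) : R :=
  \sum_i w i * \prod_j clamp (N%:R * tnth u j - (tnth i j)%:R).

Section mixture_of_cells.
Context m (w : m.-tuple 'I_N -> R).
Hypotheses (w0 : forall i, 0 <= w i) (w1 : \sum_i w i = 1).

Definition cell_mixture : probability (m.-tuple R) R := mixture (@cell_law m) w0 w1.

Lemma cell_mixture_has_df C : (forall u, cube u -> C u = cell_mixture_df w u) ->
  has_df_on_cube C cell_mixture.
Proof.
move=> hC; split.
  rewrite (prE _ (@measurable_cube R m)) pr_mixture; last exact: measurable_cube.
  by rewrite (eq_bigr w) ?w1// => i _; rewrite pr_cell_law_cube mulr1.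
move=> u cu; rewrite (prE _ (measurable_lower_orthant u)) hC//.
rewrite pr_mixture; last exact: measurable_lower_orthant.
by congr EFin; apply: eq_bigr => i _; rewrite pr_cell_law_orthant.
Qed.

Hypothesis wm : forall (j : 'I_m) (a : 'I_N), \sum_(i | tnth i j == a) w i = N%:R^-1.

(** Grouped by their index in direction j, the cells have weight 1 / N per group, and the clamps add
    up to N t. *)
Lemma cell_mixture_coord j t : 0 <= t <= 1 -> pr cell_mixture [set x | tnth x j <= t] = t.
Proof.
move=> /andP[t0 t1]; rewrite pr_mixture; last exact: (measurable_tnth_preimage j (measurable_setle t)).
under eq_bigr do rewrite pr_cell_law_coord.
rewrite (partition_big (fun i => tnth i j) xpredT)//=.
under eq_bigr => a _.
  rewrite (eq_bigr (fun i => w i * clamp (N%:R * t - a%:R))); last by move=> i /eqP ->.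
  rewrite -mulr_suml wm.
  over.
rewrite -mulr_sumr (@sum_clamp N) ?mulrA ?mulVf ?mul1r ?gt_eqF//.
by rewrite mulr_ge0 ?ler0n//= ler_piMr// ler0n.
Qed.

Lemma cell_mixture_is_copula C : (forall u, cube u -> C u = cell_mixture_df w u) ->
  is_copula C.
Proof.
move=> hC; exists cell_mixture; first exact: cell_mixture_has_df.
move=> j t t01; rewrite prE ?cell_mixture_coord//.
exact: (measurable_tnth_preimage j (measurable_setle t)).
Qed.

End mixture_of_cells.

End cell_laws.

Section finite_partitions.
Context {R : realType} d (T : measurableType d) (mu : probability T R) (I : finType).

Lemma pr_bigcup_fin (c : I -> set T) E (P : pred I) : (forall i, measurable (c i)) ->
  (forall i j x, c i x -> c j x -> i = j) -> measurable E ->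
  pr mu (E `&` \bigcup_(i in [set i | P i]) c i) = \sum_(i | P i) pr mu (E `&` c i).
Proof.
move=> mc dc mE.
have mU (s : seq I) : measurable (\bigcup_(i in [set` s]) c i).
  by apply: fin_bigcup_measurable => //; exact: finite_seq.
have key s : uniq s -> pr mu (E `&` \bigcup_(i in [set` s]) c i) =
    \sum_(i <- s) pr mu (E `&` c i).
  elim: s => [_|i s IH /= /andP[nis us]].
    by rewrite big_nil set_nil bigcup_set0 setI0 pr0.
  rewrite big_cons -IH// -prU; last 3 first.
  - exact: measurableI.
  - exact: measurableI.
  - apply/seteqP; split => // x [[_ ci] [_ [j /= js cj]]].
    by move: nis; rewrite (dc _ _ _ ci cj) js.
  congr pr; apply/seteqP; split => [x [Ex [j /=]]|x [[Ex ci]|[Ex [j /= js cj]]]].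
  - by rewrite inE => /predU1P[->|js] cj; [left|right; split => //; exists j].
  - by split => //; exists i => //=; rewrite inE eqxx.
  - by split => //; exists j => //=; rewrite inE js orbT.
rewrite -big_filter -(key _ (filter_uniq P (index_enum_uniq I))).
congr (pr mu (_ `&` _)); apply/seteqP; split => x [i /= Pi ci]; exists i => //=.
  by rewrite mem_filter Pi mem_index_enum.
by move: Pi; rewrite mem_filter => /andP[].
Qed.

Lemma pr_partition (c : I -> set T) E : (forall i, measurable (c i)) ->
  (forall i j x, c i x -> c j x -> i = j) -> pr mu (\bigcup_i c i) = 1 -> measurable E ->
  pr mu E = \sum_i pr mu (E `&` c i).
Proof.
move=> mc dc c1 mE; rewrite -pr_bigcup_fin//.
rewrite (_ : \bigcup_(i in _) c i = \bigcup_i c i) ?pr_setI1//.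
  by apply: fin_bigcup_measurable.
by apply/seteqP; split => x [i _ ci]; exists i.
Qed.

Lemma pr_forall1 (Q : I -> set T) : (forall i, measurable (Q i)) ->
  (forall i, pr mu (Q i) = 1) -> pr mu [set x | forall i, Q i x] = 1.
Proof.
move=> mQ Q1.
have key (s : seq I) : measurable [set x | forall i, i \in s -> Q i x] /\
    pr mu [set x | forall i, i \in s -> Q i x] = 1.
  elim: s => [|i s [mS IH]].
    by rewrite (_ : [set x | _] = setT) ?prT//; apply/seteqP; split.
  have -> : [set x | forall j, j \in i :: s -> Q j x] = [set x | forall j, j \in s -> Q j x] `&` Q i.
    apply/seteqP; split => [x h|x [h1 h2] j].
      by split => [j js|]; apply: h; rewrite inE ?js ?eqxx ?orbT.
    by rewrite inE => /predU1P[->//|]; exact: h1.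
  by split; [exact: measurableI|rewrite pr_setI1].
have [_ <-] := key (index_enum I); congr pr.
by apply/seteqP; split => x h i; [move=> _|]; apply: h => //; exact: mem_index_enum.
Qed.

End finite_partitions.

Section half_open_cells.
Context {R : realType} (N : nat).
Hypothesis N0 : (0 < N)%N.

Let NR0 : 0 < N%:R :> R. Proof. by rewrite ltr0n. Qed.

(* Unlike the closed cells of Defs, these are pairwise disjoint. *)
Definition half_open_cell m (i : m.-tuple 'I_N) : set (m.-tuple R) :=
  [set x | forall j, (tnth i j)%:R / N%:R < tnth x j <= (tnth i j).+1%:R / N%:R].

Lemma measurable_setoc (a b : R) : measurable [set x : R | a < x <= b].
Proof. by rewrite -set_itvoc; exact: measurable_itv. Qed.

Lemma measurable_half_open_cell m (i : m.-tuple 'I_N) : measurable (half_open_cell i).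
Proof.
apply: (@measurable_box _ _ (fun j => [set x | (tnth i j)%:R / N%:R < x <= (tnth i j).+1%:R / N%:R])) => j.
exact: measurable_setoc.
Qed.

Lemma half_open_cell_disjoint m (i k : m.-tuple 'I_N) x :
  half_open_cell i x -> half_open_cell k x -> i = k.
Proof.
move=> xi xk; apply: eq_from_tnth => j; apply/val_inj/eqP => /=.
have h (a b : nat) (t : R) : a%:R / N%:R < t <= a.+1%:R / N%:R -> b%:R / N%:R < t <= b.+1%:R / N%:R -> (a <= b)%N.
  move=> /andP[h1 _] /andP[_ h2]; have := lt_le_trans h1 h2.
  by rewrite ltr_pM2r ?invr_gt0// ltr_nat ltnS.
by rewrite eqn_leq (h _ _ _ (xi j) (xk j)) (h _ _ _ (xk j) (xi j)).
Qed.

Lemma half_open_cell_cover m (x : m.-tuple R) : (forall j, 0 < tnth x j <= 1) ->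
  exists i, half_open_cell i x.
Proof.
move=> x01.
have h (t : R) : 0 < t <= 1 -> exists a : 'I_N, a%:R / N%:R < t <= a.+1%:R / N%:R.
  move=> /andP[t0 t1]; pose P := fun n : nat => N%:R * t <= n%:R.
  have exP : exists n, P n by exists N; rewrite /P ler_piMr.
  case: (ex_minnP exP) => -[|n] Pn minn.
    by move: Pn; rewrite /P leNgt mulr_gt0.
  have nN : (n < N)%N by apply: minn; rewrite /P ler_piMr.
  exists (Ordinal nN) => /=; rewrite ltr_pdivrMr// ler_pdivlMr// mulrC.
  apply/andP; split; last exact: Pn.
  rewrite ltNge; apply/negP => Pn'.
  by have := minn _ Pn'; rewrite ltnn.
exists [tuple sval (cid (h _ (x01 j))) | j < m] => j.
by rewrite tnth_mktuple; case: cid.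
Qed.

(** Points outside all half-open cells, such as those with a coordinate 0, are left free; under
    uniform margins they form a null set. *)
Definition grid_set m (G : set (m.-tuple R)) : Prop :=
  forall i : m.-tuple 'I_N, half_open_cell i `<=` G \/ half_open_cell i `&` G = set0.

Lemma grid_setC m (G : set (m.-tuple R)) : grid_set G -> grid_set (~` G).
Proof.
move=> gG i; have [h|h] := gG i; [right|left].
  by apply/seteqP; split => // x [/h].
by move=> x ix Gx; have : (half_open_cell i `&` G) x by []; rewrite h.
Qed.

Lemma grid_setU m (G H : set (m.-tuple R)) : grid_set G -> grid_set H -> grid_set (G `|` H).
Proof.
move=> gG gH i; have [h|h] := gG i; first by left => x /h; left.
have [h'|h'] := gH i; first by left => x /h'; right.
by right; rewrite setIUr h h' setU0.
Qed.

End half_open_cells.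

Section uniform_margins.
Context {R : realType} m (mu : probability (m.-tuple R) R).
Hypothesis mu1 : pr mu (@cube R m) = 1.
Hypothesis mum : forall j t, 0 <= t <= 1 -> pr mu [set x | tnth x j <= t] = t.

Lemma margin_le j t : pr mu [set x | tnth x j <= t] = clamp t.
Proof.
have mt s : measurable [set x : m.-tuple R | tnth x j <= s].
  exact: (measurable_tnth_preimage j (measurable_setle s)).
have [t0|t0] := ltP t 0.
  rewrite clamp_lt0 ?ltW// -(pr0 mu); apply: pr_eq_on mu1 _ => //; first exact: measurable_cube.
  rewrite set0I; apply/seteqP; split => // x [/= xt /(_ j)/andP[x0 _]].
  by move: (le_lt_trans x0 (le_lt_trans xt t0)); rewrite ltxx.
have [t1|t1] := leP t 1; first by rewrite clamp_id ?t0// mum// t0.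
rewrite clamp_gt1 ?ltW// -[RHS]mu1; apply: pr_eq_on mu1 _ => //; [exact: measurable_cube..|].
rewrite setIid; apply/seteqP; split => [x []//|x cx]; split => //=.
by have /andP[_ /le_trans] := cx j; apply; exact: ltW.
Qed.

Lemma measurable_margin_oc (j : 'I_m) (a b : R) : measurable [set x : m.-tuple R | a < tnth x j <= b].
Proof. exact: (measurable_tnth_preimage j (measurable_setoc a b)). Qed.

Lemma margin_oc j a b : a <= b ->
  pr mu [set x | a < tnth x j <= b] = clamp b - clamp a.
Proof.
move=> ab; rewrite -!(margin_le j) -prD; last 3 first.
- exact: (measurable_tnth_preimage j (measurable_setle b)).
- exact: (measurable_tnth_preimage j (measurable_setle a)).
- by move=> x /= /le_trans; exact.
congr pr; apply/seteqP; split => x /=; first by move=> /andP[xa ->]; split => //; rewrite leNgt xa.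
by move=> [-> /negP]; rewrite -ltNge => ->.
Qed.

Lemma clamp_lipschitz (a b : R) : a <= b -> clamp b - clamp a <= b - a.
Proof.
move=> ab; have [a0|a0] := leP a 0.
  rewrite (clamp_lt0 a0) subr0; have [b0|b0] := leP b 0; first by rewrite clamp_lt0//; lra.
  have [b1|b1] := leP b 1; last by rewrite (clamp_gt1 (ltW b1)); lra.
  by rewrite clamp_id; [lra|rewrite (ltW b0) b1].
have [b1|b1] := leP b 1.
  rewrite !clamp_id//; first by rewrite (ltW a0) (le_trans ab).
  by rewrite b1 andbT (le_trans (ltW a0)).
rewrite (clamp_gt1 (ltW b1)); have [a1|a1] := leP a 1; last by rewrite (clamp_gt1 (ltW a1)); lra.
by rewrite clamp_id; [lra|rewrite (ltW a0) a1].
Qed.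

Lemma margin_oc_le j a b : a <= b -> pr mu [set x | a < tnth x j <= b] <= b - a.
Proof. by move=> ab; rewrite margin_oc// clamp_lipschitz. Qed.

(** A hyperplane of mass e > 0 would lie in a slab of width e / 2, whose mass is at most e / 2. *)
Lemma margin_neq j t : pr mu [set x | tnth x j <> t] = 1.
Proof.
have mt : measurable [set x : m.-tuple R | tnth x j = t].
  exact: (measurable_tnth_preimage j (measurable_set1 t)).
rewrite (_ : [set x | _] = ~` [set x | tnth x j = t])// prC//.
suff -> : pr mu [set x | tnth x j = t] = 0 by rewrite subr0.
apply/eqP; rewrite eq_le pr_ge0 andbT leNgt; apply/negP => e0.
set e := pr mu _ in e0; have e2 : 0 < e / 2 by rewrite divr_gt0.
have : e <= e / 2.
  have := @margin_oc_le j (t - e / 2) t; rewrite opprB addrCA subrr addr0 => h.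
  apply: le_trans (h _); last by rewrite gerBl ltW.
  apply: le_pr => //; first exact: measurable_margin_oc.
  by move=> x /= ->; rewrite lexx andbT gtrBl.
lra.
Qed.

Lemma pr_half_open_cube : pr mu [set x | forall j, 0 < tnth x j <= 1] = 1.
Proof.
apply: (@pr_forall1 _ _ _ _ _ (fun j (x : m.-tuple R) => 0 < tnth x j <= 1)) => j.
  exact: measurable_margin_oc.
by rewrite margin_oc// clamp_gt1// clamp_lt0// subr0.
Qed.

Context (N : nat).
Hypothesis N0 : (0 < N)%N.

Lemma half_open_cells_full : pr mu (\bigcup_(i in [set: m.-tuple 'I_N]) half_open_cell i) = 1.
Proof.
apply/eqP; rewrite eq_le pr_le1/=; last first.
  by apply: fin_bigcup_measurable => // i _; exact: measurable_half_open_cell.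
rewrite -[leLHS]pr_half_open_cube; apply: le_pr.
- apply: (@measurable_forall _ _ _ (fun j (x : m.-tuple R) => 0 < tnth x j <= 1)) => j.
  exact: measurable_margin_oc.
- by apply: fin_bigcup_measurable => // i _; exact: measurable_half_open_cell.
- by move=> x /(half_open_cell_cover N0)[i xi]; exists i.
Qed.

Lemma half_open_partition E : measurable E ->
  pr mu E = \sum_(i : m.-tuple 'I_N) pr mu (E `&` half_open_cell i).
Proof.
move=> mE; apply: pr_partition => //.
- exact: measurable_half_open_cell.
- by move=> i k x; exact: half_open_cell_disjoint.
- exact: half_open_cells_full.
Qed.

Lemma grid_set_pr (G : set (m.-tuple R)) : measurable G -> grid_set N G ->
  pr mu G = \sum_(i : m.-tuple 'I_N | `[< half_open_cell i `<=` G >]) pr mu (half_open_cell i).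
Proof.
move=> mG gG; rewrite half_open_partition// [RHS]big_mkcond; apply: eq_bigr => i _.
case: asboolP => [h|h]; first by rewrite setIidr.
by have [//|h'] := gG i; rewrite setIC h' pr0.
Qed.

(** The closed cell adds only points on the lower faces, which are null by [margin_neq]. This links
    the definition of the checkerboard to the disjoint cells. *)
Lemma grid_cell_half_open (i : m.-tuple 'I_N) :
  pr mu (grid_cell i) = pr mu (half_open_cell i).
Proof.
have mgc : measurable (@grid_cell R m N i).
  apply: (@measurable_box _ _ (fun j => [set x | (tnth i j)%:R / N%:R <= x <= (tnth i j).+1%:R / N%:R])) => j.
  exact: measurable_setcc.
have mneq j : measurable [set x : m.-tuple R | tnth x j <> (tnth i j)%:R / N%:R].
  rewrite (_ : [set x | _] = ~` [set x | tnth x j = (tnth i j)%:R / N%:R])//.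
  by apply: measurableC; exact: (measurable_tnth_preimage j (measurable_set1 _)).
pose Q j : set (m.-tuple R) := [set x | tnth x j <> (tnth i j)%:R / N%:R].
have mQ : measurable [set x | forall j, Q j x] by exact: measurable_forall.
have Q1 : pr mu [set x | forall j, Q j x] = 1.
  by apply: pr_forall1 => // j; exact: (margin_neq j).
apply: (pr_eq_on mQ mgc (measurable_half_open_cell i) Q1).
apply/seteqP; split => x [xi xn]; split => // j; have /andP[h1 h2] := xi j.
  by rewrite h2 andbT lt_neqAle h1 andbT eq_sym; apply/eqP; exact: xn.
by rewrite h2 ltW.
Qed.

End uniform_margins.

Section checkerboards.
Context {R : realType} (N : nat) (N0 : (0 < N)%N).

Let NR0 : 0 < N%:R :> R. Proof. by rewrite ltr0n. Qed.

Section mixture_on_cells.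
Context m (w : m.-tuple 'I_N -> R).
Hypotheses (w0 : forall i, 0 <= w i) (w1 : \sum_i w i = 1).

(** The half-open unit cube has full Lebesgue measure and is mapped into the half-open cell; the
    other cells are disjoint from it. *)
Lemma cell_law_half_open (i k : m.-tuple 'I_N) :
  pr (cell_law k) (half_open_cell i) = (k == i)%:R :> R.
Proof.
have self : pr (cell_law k) (half_open_cell k) = 1 :> R.
  apply/eqP; rewrite eq_le pr_le1/=; last exact: measurable_half_open_cell.
  have full : pr (lebesgue_cube m) [set x : m.-tuple R | forall j, 0 < tnth x j <= 1] = 1.
    apply: pr_half_open_cube; first exact: pr_lebesgue_cube_cube.
    move=> j t t01; rewrite (pr_lebesgue_cube_coord _ (measurable_setle t)) pr_unif_le.
    by rewrite clamp_id.
  have mp : measurable (cell_map k @^-1` (@half_open_cell R N m k)).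
    rewrite -[X in measurable X]setTI; apply: measurable_cell_map => //.
    exact: measurable_half_open_cell.
  rewrite -[leLHS]full pr_law; apply: le_pr => //.
    apply: (@measurable_forall _ _ _ (fun j (x : m.-tuple R) => 0 < tnth x j <= 1)) => j.
    exact: measurable_margin_oc.
  move=> x x01 j; rewrite tnth_mktuple; have /andP[h1 h2] := x01 j.
  rewrite ltr_pM2r ?invr_gt0// ltrDl h1 /= ler_pM2r ?invr_gt0//.
  by rewrite -natr1 lerD2l.
case: eqP => [<-//|ki].
have : pr (cell_law k) (half_open_cell i) <= 1 - pr (cell_law k) (half_open_cell k) :> R.
  rewrite -prC; last exact: measurable_half_open_cell.
  apply: le_pr; [exact: measurable_half_open_cell|apply: measurableC; exact: measurable_half_open_cell|].
  by move=> x xi xk; apply: ki; exact: half_open_cell_disjoint xk xi.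
by rewrite self subrr => h; apply/eqP; rewrite eq_le pr_ge0 h.
Qed.

Lemma cell_mixture_half_open i : pr (cell_mixture w0 w1) (half_open_cell i) = w i.
Proof.
rewrite pr_mixture; last exact: measurable_half_open_cell.
rewrite (bigD1 i)//= cell_law_half_open eqxx mulr1 big1 ?addr0// => k ki.
by rewrite cell_law_half_open (negbTE ki) mulr0.
Qed.

End mixture_on_cells.

Section checkerboard_of_copula.
Context m (C : m.-tuple R -> R).
Hypothesis cC : is_copula C.

Let gam := copula_measure C.
Let gam1 : pr gam (@cube R m) = 1.
Proof. by have [[h _] _] := is_copula_measure cC; rewrite /pr h. Qed.
Let gamm j t : 0 <= t <= 1 -> pr gam [set x | tnth x j <= t] = t.
Proof. by have [_ h] := is_copula_measure cC; exact: h. Qed.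

Definition checkerboard_weight (i : m.-tuple 'I_N) : R := pr gam (grid_cell i).

Lemma checkerboard_weightE i : checkerboard_weight i = pr gam (half_open_cell i).
Proof. exact: grid_cell_half_open. Qed.

Lemma checkerboard_weight_ge0 i : 0 <= checkerboard_weight i.
Proof. exact: pr_ge0. Qed.

Lemma checkerboard_weight_sum : \sum_i checkerboard_weight i = 1.
Proof.
rewrite -(prT gam) (half_open_partition gam1 gamm N0 measurableT).
by apply: eq_bigr => i _; rewrite setTI checkerboard_weightE.
Qed.

Lemma checkerboard_weight_margin j (a : 'I_N) :
  \sum_(i | tnth i j == a) checkerboard_weight i = N%:R^-1.
Proof.
have mS := measurable_margin_oc j (a%:R / N%:R : R) (a.+1%:R / N%:R).
have aN : a%:R / N%:R <= a.+1%:R / N%:R :> R by rewrite ler_pM2r ?invr_gt0// ler_nat.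
transitivity (pr gam [set x | a%:R / N%:R < tnth x j <= a.+1%:R / N%:R]); last first.
  rewrite margin_oc// !clamp_id; last 2 first.
  - by rewrite divr_ge0//= ler_pdivrMr// mul1r ler_nat ltnW.
  - by rewrite divr_ge0//= ler_pdivrMr// mul1r ler_nat.
  by rewrite -mulrBl -natr1 addrC addKr mul1r.
rewrite (half_open_partition gam1 gamm N0 mS) big_mkcond; apply: eq_bigr => i _.
rewrite checkerboard_weightE; case: eqP => [<-|ia].
  by congr pr; apply/seteqP; split => [x xi|x []//]; split => //; exact: xi.
rewrite (_ : _ `&` _ = set0) ?pr0//; apply/seteqP; split => // x [/= xa xi].
apply: ia; have := xi j => xi'.
have h (p q : nat) (t : R) : p%:R / N%:R < t <= p.+1%:R / N%:R -> q%:R / N%:R < t <= q.+1%:R / N%:R -> (p <= q)%N.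
  move=> /andP[h1 _] /andP[_ h2]; have := lt_le_trans h1 h2.
  by rewrite ltr_pM2r ?invr_gt0// ltr_nat ltnS.
by apply/val_inj/eqP => /=; rewrite eqn_leq (h _ _ _ xi' xa) (h _ _ _ xa xi').
Qed.

Let measurable_grid_cell (i : m.-tuple 'I_N) : measurable (@grid_cell R m N i).
Proof.
apply: (@measurable_box _ _ (fun j => [set x | (tnth i j)%:R / N%:R <= x <= (tnth i j).+1%:R / N%:R])) => j.
exact: measurable_setcc.
Qed.

(** The one-dimensional factor of the integral that defines the checkerboard. The cases are t to the
    left of the slab, inside it and to its right. *)
Let slab (a : 'I_N) (t : R) : 0 <= t <= 1 ->
  N%:R * pr unif ([set x | 0 <= x <= 1] `&` [set x | x <= t] `&`
     [set x | a%:R / N%:R <= x <= a.+1%:R / N%:R]) = clamp (N%:R * t - a%:R).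
Proof.
move=> /andP[t0 t1].
have a0 : 0 <= a%:R / N%:R :> R by rewrite divr_ge0.
have a1 : a.+1%:R / N%:R <= 1 :> R by rewrite ler_pdivrMr// mul1r ler_nat.
have NK (s : R) : N%:R * (s / N%:R) = s by rewrite mulrCA mulfV ?mulr1// gt_eqF.
have [ta|ta] := ltP t (a%:R / N%:R).
  rewrite clamp_lt0; last by rewrite subr_le0 mulrC -ler_pdivlMr// ltW.
  rewrite (_ : _ `&` _ = set0) ?pr0 ?mulr0//; apply/seteqP; split => // x [[_ /= xt] /andP[ax _]].
  by move: (le_lt_trans ax (le_lt_trans xt ta)); rewrite ltxx.
have [tb|tb] := leP t (a.+1%:R / N%:R).
  rewrite (_ : _ `&` _ = [set x | a%:R / N%:R <= x <= t]); last first.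
    apply/seteqP; split => [x [[_ /= ->] /andP[-> _]]//|x /= /andP[ax xt]].
    by rewrite ax xt (le_trans a0 ax) (le_trans xt t1) (le_trans xt tb).
  rewrite pr_unif_cc// mulrBr NK clamp_id// subr_ge0 mulrC -ler_pdivrMr// ta /=.
  by rewrite lerBlDr nat1r -ler_pdivlMr.
rewrite (_ : _ `&` _ = [set x | a%:R / N%:R <= x <= a.+1%:R / N%:R]); last first.
  apply/seteqP; split => [x []//|x /= /andP[ax xb]].
  by rewrite ax xb (le_trans a0 ax) (le_trans xb a1) (le_trans xb (ltW tb)).
rewrite pr_unif_cc//; last by rewrite ler_pM2r ?invr_gt0// ler_nat.
rewrite mulrBr !NK -natr1 addrC addKr clamp_gt1//.
by rewrite lerBrDr nat1r mulrC -ler_pdivrMr// ltW.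
Qed.

(** On one cell the density is constant and the domain is a box, so the integral factorizes; the
    factor N ^ m is distributed as one N per coordinate. *)
Lemma checkerboardE u : cube u -> checkerboard N C u = cell_mixture_df checkerboard_weight u.
Proof.
move=> cu; have mD : measurable (@cube R m `&` lower_orthant u).
  by apply: measurableI; [exact: measurable_cube|exact: measurable_lower_orthant].
have mf i : measurable_fun (@cube R m `&` lower_orthant u)
    (fun x => (N%:R ^+ m * checkerboard_weight i)%:E * (\1_(@grid_cell R m N i) x)%:E)%E.
  apply/measurable_funTS/measurable_funeM/measurable_EFinP.
  exact: measurable_indic (measurable_grid_cell i).
have c0 i : 0 <= N%:R ^+ m * checkerboard_weight i.
  by rewrite mulr_ge0// ?exprn_ge0// checkerboard_weight_ge0.
rewrite /checkerboard.
transitivity (fine (\int[lebesgue_cube m]_(x in @cube R m `&` lower_orthant u)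
   (\sum_(i : m.-tuple 'I_N) (N%:R ^+ m * checkerboard_weight i)%:E * (\1_(@grid_cell R m N i) x)%:E))%E).
  congr fine; apply: eq_integral => x _; rewrite /checkerboard_density mulr_sumr -sumEFin.
  by apply: eq_bigr => i _; rewrite -EFinM mulrA.
rewrite ge0_integral_sum//; last first.
  by move=> i x _; rewrite mule_ge0 ?lee_fin ?c0.
apply: EFin_inj; rewrite /cell_mixture_df -sumEFin.
have e i : (\int[lebesgue_cube m]_(x in @cube R m `&` lower_orthant u)
    ((N%:R ^+ m * checkerboard_weight i)%:E * (\1_(@grid_cell R m N i) x)%:E) =
    (checkerboard_weight i * \prod_j clamp (N%:R * tnth u j - (tnth i j)%:R))%:E)%E.
  rewrite ge0_integralZl//; last 2 first.
  - by apply/measurable_funTS/measurable_EFinP; exact: measurable_indic (measurable_grid_cell i).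
  - by rewrite lee_fin c0.
  rewrite integral_indic//.
  pose B j : set R := [set x | 0 <= x <= 1] `&` [set x | x <= tnth u j] `&`
     [set x | (tnth i j)%:R / N%:R <= x <= (tnth i j).+1%:R / N%:R].
  have mB j : measurable (B j).
    apply: measurableI; last exact: measurable_setcc.
    by apply: measurableI; [exact: measurable_setcc|exact: measurable_setle].
  have -> : grid_cell i `&` (@cube R m `&` lower_orthant u) = [set x | forall j, B j (tnth x j)].
    apply/seteqP; split => [x [h1 [h2 h3]] j|x h]; first by split; [split; [exact: h2|exact: h3]|exact: h1].
    by split => [j|]; [|split => j]; have [[h1 h2] h3] := h j.
  transitivity ((N%:R ^+ m * checkerboard_weight i)%:E * (pr (lebesgue_cube m) [set x | forall j, B j (tnth x j)])%:E)%E.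
    by congr (_ * _)%E; apply: prE; exact: measurable_box.
  rewrite -EFinM pr_lebesgue_cube_box//; congr EFin.
  rewrite mulrAC mulrC; congr (_ * _).
  have -> : N%:R ^+ m = \prod_(j < m) N%:R :> R by rewrite prodr_const card_ord.
  rewrite -big_split /=; apply: eq_bigr => j _.
  exact: slab.
under eq_bigr do rewrite e.
by rewrite sumEFin.
Qed.

Definition checkerboard_mixture := cell_mixture checkerboard_weight_ge0 checkerboard_weight_sum.

Lemma checkerboard_is_copula : is_copula (checkerboard N C).
Proof.
apply: (cell_mixture_is_copula N0 checkerboard_weight_ge0 checkerboard_weight_sum).
  exact: checkerboard_weight_margin.
exact: checkerboardE.
Qed.

Lemma checkerboard_measureE E : measurable E ->
  copula_measure (checkerboard N C) E = checkerboard_mixture E.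
Proof.
by move=> mE; apply: copula_measureE => //; apply: cell_mixture_has_df => //; exact: checkerboardE.
Qed.

Lemma checkerboard_mixture_coord j t : 0 <= t <= 1 ->
  pr checkerboard_mixture [set x | tnth x j <= t] = t.
Proof. by move=> t01; rewrite cell_mixture_coord//; exact: checkerboard_weight_margin. Qed.

Lemma checkerboard_mixture_cube : pr checkerboard_mixture (@cube R m) = 1.
Proof.
rewrite pr_mixture; last exact: measurable_cube.
by rewrite -checkerboard_weight_sum; apply: eq_bigr => i _; rewrite pr_cell_law_cube// mulr1.
Qed.

Lemma checkerboard_mixture_grid G : measurable G -> grid_set N G ->
  pr checkerboard_mixture G = pr gam G.
Proof.
move=> mG gG.
rewrite (grid_set_pr checkerboard_mixture_cube checkerboard_mixture_coord N0 mG gG).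
rewrite (grid_set_pr gam1 gamm N0 mG gG); apply: eq_bigr => i _.
by rewrite /checkerboard_mixture cell_mixture_half_open checkerboard_weightE.
Qed.

End checkerboard_of_copula.

End checkerboards.

(** * Comparing laws on boxes and columns *)

Section box_differences.
Context {R : realType} m (mu nu : probability (m.-tuple R) R) (e : R).
Hypothesis mu_nu : forall u, `|pr mu (lower_orthant u) - pr nu (lower_orthant u)| <= e.

(* Only the first k coordinates are bounded below; each of these bounds doubles the
   error. *)
Definition partial_box k (a b : m.-tuple R) : set (m.-tuple R) :=
  [set x | forall j : 'I_m, (j < k)%N -> tnth a j < tnth x j] `&` lower_orthant b.

Lemma measurable_partial_box k a b : measurable (partial_box k a b).
Proof.
apply: measurableI; last exact: measurable_lower_orthant.
apply: measurable_forall_le => j _.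
have := measurable_tnth_preimage j (measurableC (measurable_setle (tnth a j))).
by congr measurable; apply/seteqP; split => x /=; rewrite ltNge => /negP.
Qed.

(** A lower bound on coordinate k removes the box whose upper corner is lowered to the entry of a
    there. Both boxes have k lower bounds, so the errors add up to twice that of k bounds. *)
Lemma box_difference k (a b : m.-tuple R) : (k <= m)%N -> (forall j, tnth a j <= tnth b j) ->
  `|pr mu (partial_box k a b) - pr nu (partial_box k a b)| <= 2 ^+ k * e.
Proof.
elim: k b => [|k IH] b km ab.
  rewrite expr0 mul1r (_ : partial_box 0 a b = lower_orthant b)//.
  by apply/seteqP; split => [x []|x].
pose jk := Ordinal km.
pose b' : m.-tuple R := [tuple if j == jk then tnth a j else tnth b j | j < m].
have ab' j : tnth a j <= tnth b' j by rewrite tnth_mktuple; case: ifP.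
have bb' : partial_box k a b' `<=` partial_box k a b.
  move=> x [h1 h2]; split => // j; have := h2 j; rewrite tnth_mktuple; case: ifP => // _.
  by move=> /le_trans; apply; exact: ab.
have boxE : partial_box k.+1 a b = partial_box k a b `\` partial_box k a b'.
  apply/seteqP; split => [x [h1 h2]|x [[h1 h2] h3]].
    split; first by split => // j jk'; apply: h1; exact: ltnW.
    move=> [_ /(_ jk)]; rewrite tnth_mktuple eqxx => h.
    by have := h1 jk (ltnSn k); rewrite ltNge h.
  split => // j; rewrite ltnS leq_eqVlt => /predU1P[jE|]; last exact: h1.
  rewrite ltNge; apply/negP => xa; apply: h3; split => // l; rewrite tnth_mktuple.
  case: eqP => [->|_]; last exact: h2.
  by rewrite (_ : jk = j)//; exact: val_inj.
have m1 := measurable_partial_box k a b; have m2 := measurable_partial_box k a b'.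
rewrite boxE (prD mu m1 m2 bb') (prD nu m1 m2 bb').
have h1 := IH b (ltnW km) ab; have h2 := IH b' (ltnW km) ab'.
rewrite opprB addrACA exprS -mulrA mulr_natl mulr2n.
rewrite (_ : _ + _ = (pr mu (partial_box k a b) - pr nu (partial_box k a b)) -
  (pr mu (partial_box k a b') - pr nu (partial_box k a b'))); last by ring.
by rewrite (le_trans (ler_normB _ _))// lerD.
Qed.

End box_differences.

Section deviations_on_cells.
Context {R : realType} (d N : nat) (N0 : (0 < N)%N).

Let NR0 : 0 < N%:R :> R. Proof. by rewrite ltr0n. Qed.

Let cell (k : d.-tuple 'I_N) : set (d.-tuple R) := half_open_cell k.

Definition positive_deviation (mu : probability (d.+1.-tuple R) R) (y : R) : R :=
  \sum_(k : d.-tuple 'I_N) Num.max (deviation mu y (half_open_cell k)) 0.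

Let mfirst (E : set (d.-tuple R)) : measurable E -> measurable [set x : d.+1.-tuple R | E (first_coords d x)].
Proof. by move=> mE; rewrite -[X in measurable X]setTI; exact: measurable_first_coords. Qed.

Let mlast (y : R) : measurable [set x : d.+1.-tuple R | 0 <= last_coord x <= y].
Proof. exact: (measurable_tnth_preimage ord_max (measurable_setcc 0 y)). Qed.

Lemma deviation_bigcup (mu : probability (d.+1.-tuple R) R) y (P : pred (d.-tuple 'I_N)) :
  deviation mu y (\bigcup_(k in [set k | P k]) half_open_cell k) =
  \sum_(k | P k) deviation mu y (half_open_cell k).
Proof.
pose c k := [set x : d.+1.-tuple R | cell k (first_coords d x)].
have mc k : measurable (c k) by exact: mfirst (measurable_half_open_cell k).
have dc i j x : c i x -> c j x -> i = j by exact: half_open_cell_disjoint.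
rewrite /deviation sumrB -mulr_sumr; congr (_ - _ * _).
  transitivity (pr mu ([set x | 0 <= last_coord x <= y] `&` \bigcup_(k in [set k | P k]) c k)).
    congr pr; apply/seteqP; split => [x [[k Pk xk] xy]|x [xy [k Pk xk]]].
      by split => //; exists k.
    by split => //; exists k.
  rewrite pr_bigcup_fin//; apply: eq_bigr => k _; congr pr.
  by apply/seteqP; split => x [].
transitivity (pr mu (setT `&` \bigcup_(k in [set k | P k]) c k)).
  congr pr; apply/seteqP; split => [x [k Pk xk]|x [_ [k Pk xk]]].
    by split => //; exists k.
  by exists k.
by rewrite pr_bigcup_fin//; apply: eq_bigr => k _; rewrite setTI.
Qed.

Lemma positive_deviation_le (A : d.+1.-tuple R -> R) y : is_copula A -> 0 <= y <= 1 ->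
  2 * positive_deviation (copula_measure A) y <= zeta_section A y.
Proof.
move=> cA y01; pose P (k : d.-tuple 'I_N) := 0 < deviation (copula_measure A) y (half_open_cell k).
rewrite (_ : positive_deviation _ y =
  deviation (copula_measure A) y (\bigcup_(k in [set k | P k]) half_open_cell k)).
  apply: deviation_le => //.
  by apply: fin_bigcup_measurable => // k _; exact: measurable_half_open_cell.
rewrite deviation_bigcup [RHS]big_mkcond; apply: eq_bigr => k _; rewrite /P.
by case: ltP.
Qed.

Definition first_index (i : d.+1.-tuple 'I_N) : d.-tuple 'I_N :=
  [tuple tnth i (widen_ord (leqnSn d) j) | j < d].

Section mixture_deviation.
Variable w : d.+1.-tuple 'I_N -> R.
Hypotheses (w0 : forall i, 0 <= w i) (w1 : \sum_i w i = 1).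
Variable y : R.
Hypothesis y01 : 0 <= y <= 1.

Let first_cell_map i x : first_coords d (cell_map i x) =
  cell_map (first_index i) (first_coords d x) :> d.-tuple R.
Proof.
apply: eq_from_tnth => j; rewrite /first_coords !tnth_mktuple.
rewrite -(tnth_nth 0 (cell_map i x) (widen_ord (leqnSn d) j)) tnth_mktuple.
by rewrite -(tnth_nth 0 x (widen_ord (leqnSn d) j)).
Qed.

Let cell_law_rect i (E : set (d.-tuple R)) (B : set R) : measurable E -> measurable B ->
  pr (cell_law i) [set x | E (first_coords d x) /\ B (last_coord x)] =
  pr (cell_law (first_index i)) E *
  pr unif [set s | B (((tnth i ord_max)%:R + s) / N%:R)].
Proof.
move=> mE mB; rewrite !pr_law.
have mA : measurable (cell_map (first_index i) @^-1` E).
  by rewrite -[X in measurable X]setTI; exact: measurable_cell_map.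
have mB' : measurable [set s : R | B (((tnth i ord_max)%:R + s) / N%:R)].
  have mf : measurable_fun setT (fun s : R => ((tnth i ord_max)%:R + s) / N%:R).
    by apply: measurable_funM => //; apply: measurable_funD.
  by rewrite -[X in measurable X]setTI; exact: mf.
set A' := _ @^-1` E in mA *; set B' := [set s | _] in mB' *.
transitivity (pr (lebesgue_cube d \x unif)%E (A' `*` B')); last exact: prX.
congr fine; rewrite -[RHS](lebesgue_cube_split (ltnSn d) (measurableX mA mB')).
congr (lebesgue_cube d.+1 _); apply/funext => x; rewrite /preimage /A' /B' /=.
have -> : last_coord (cell_map i x) = ((tnth i ord_max)%:R + nth 0 x d) / N%:R.
  by rewrite /last_coord tnth_mktuple (tnth_nth 0).
by rewrite first_cell_map.
Qed.

Let weight i : R := w i * (clamp (N%:R * y - (tnth i ord_max)%:R) - y).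

(** A cell law is a product, so E enters only through its share of the column below the cell.
    [weight i] is the contribution of cell i to the deviation of its whole column. *)
Lemma deviation_cell_mixture E : measurable E ->
  deviation (cell_mixture w0 w1) y E =
  \sum_(k : d.-tuple 'I_N) pr (cell_law k) E * \sum_(i | first_index i == k) weight i.
Proof.
move=> mE; rewrite /deviation.
rewrite pr_mixture; last exact: (measurableI _ _ (mfirst mE) (mlast y)).
rewrite pr_mixture; last exact: mfirst.
rewrite mulr_sumr -sumrB.
transitivity (\sum_i pr (cell_law (first_index i)) E * weight i).
  apply: eq_bigr => i _.
  rewrite (cell_law_rect i mE (measurable_setcc 0 y)).
  have -> : pr (cell_law i) [set x | E (first_coords d x)] =
      pr (cell_law i) [set x | E (first_coords d x) /\ setT (last_coord x)].
    by congr pr; apply/seteqP; split => [x|x []].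
  rewrite (cell_law_rect i mE measurableT) [pr unif [set s | setT _]]prT mulr1.
  have -> : [set s | 0 <= ((tnth i ord_max)%:R + s) / N%:R <= y] =
      [set s : R | - (tnth i ord_max)%:R <= s <= N%:R * y - (tnth i ord_max)%:R].
    apply/seteqP; split => s /=.
      by rewrite pmulr_lge0 ?invr_gt0// ler_pdivrMr// lerBrDl mulrC -lerBlDl sub0r.
    by rewrite pmulr_lge0 ?invr_gt0// ler_pdivrMr// lerBrDl mulrC -lerBlDl sub0r.
  rewrite pr_unif_seg; last by rewrite lerDr mulr_ge0//; case/andP: y01.
  rewrite [clamp (- _)]clamp_lt0 ?oppr_le0// subr0 /weight.
  by rewrite [RHS]mulrCA; ring.
rewrite (partition_big first_index xpredT)//=; apply: eq_bigr => k _.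
by rewrite mulr_sumr; apply: eq_bigr => i /eqP ->.
Qed.

(* Inside one cell the mixture makes X and Y independent, so taking a cell as a whole,
   or not at all, is optimal. *)
Lemma deviation_cell_mixture_le E : measurable E ->
  deviation (cell_mixture w0 w1) y E <= positive_deviation (cell_mixture w0 w1) y.
Proof.
move=> mE; rewrite deviation_cell_mixture//; apply: ler_sum => k _.
rewrite (_ : deviation _ _ _ = \sum_(i | first_index i == k) weight i); last first.
  rewrite deviation_cell_mixture; last exact: measurable_half_open_cell.
  rewrite (bigD1 k)//= cell_law_half_open// eqxx mul1r [X in _ + X]big1 ?addr0// => l /negbTE lk.
  by rewrite cell_law_half_open// lk mul0r.
set D := \sum_(i | _) _; have [D0|D0] := leP 0 D.
  by rewrite ler_piMl// pr_le1.
by rewrite mulr_ge0_le0// ?pr_ge0// ltW.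
Qed.

End mixture_deviation.

Lemma zeta_section_checkerboard (C : d.+1.-tuple R -> R) y : is_copula C -> 0 <= y <= 1 ->
  zeta_section (checkerboard N C) y =
  2 * positive_deviation (copula_measure (checkerboard N C)) y.
Proof.
move=> cC y01; have cCB := checkerboard_is_copula N0 cC.
apply/eqP; rewrite eq_le positive_deviation_le// andbT.
apply: zeta_section_le => // E mE; rewrite ler_pM2l//.
have devE F : measurable F -> deviation (copula_measure (checkerboard N C)) y F =
    deviation (checkerboard_mixture N0 cC) y F.
  move=> mF; rewrite /deviation; congr (_ - _ * _); congr fine; apply: checkerboard_measureE.
    exact: (measurableI _ _ (mfirst mF) (mlast y)).
  exact: mfirst.
rewrite devE// /positive_deviation.
under eq_bigr => k _ do rewrite (devE _ (measurable_half_open_cell k)).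
exact: deviation_cell_mixture_le.
Qed.

End deviations_on_cells.

(** * Convergence of checkerboards *)

Section deviation_comparison.
Context {R : realType} (d N : nat) (N0 : (0 < N)%N).
Variables A C : d.+1.-tuple R -> R.
Hypotheses (cA : is_copula A) (cC : is_copula C).
Variable e : R.
Hypothesis CA : forall u, cube u -> `|C u - A u| <= e.

Let NR0 : 0 < N%:R :> R. Proof. by rewrite ltr0n. Qed.

Let muA := copula_measure A.
Let gam := copula_measure C.
Let mix := copula_measure (checkerboard N C).
Let cCB : is_copula (checkerboard N C). Proof. exact: checkerboard_is_copula. Qed.

Lemma orthant_difference u :
  `|pr gam (lower_orthant u) - pr muA (lower_orthant u)| <= e.
Proof.
have [hA _] := is_copula_measure cA; have [hC _] := is_copula_measure cC.
rewrite (has_df_on_cubeE hA) (has_df_on_cubeE hC); case: ifPn => [/forallP u0|_].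
  apply: CA => i; rewrite tnth_mktuple le_min u0 ler01 /=.
  by rewrite ge_min lexx orbT.
(* An orthant with a negative corner is null for both measures. What is left is 0 <= e, read off the
   hypothesis at the corner (1, ..., 1). *)
have c1 : cube ([tuple 1 | i < d.+1] : d.+1.-tuple R).
  by move=> i; rewrite tnth_mktuple ler01 lexx.
by rewrite subrr normr0 (le_trans _ (CA c1)).
Qed.

Let margins (B : d.+1.-tuple R -> R) (cB : is_copula B) :
  forall j t, 0 <= t <= 1 -> pr (copula_measure B) [set x | tnth x j <= t] = t.
Proof. by have [_ h] := is_copula_measure cB => j t; exact: h. Qed.

Let S (k : d.-tuple 'I_N) (v : R) : set (d.+1.-tuple R) :=
  [set x | half_open_cell k (first_coords d x) /\ last_coord x <= v].

Let mcell (k : d.-tuple 'I_N) : measurable [set x : d.+1.-tuple R | half_open_cell k (first_coords d x)].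
Proof.
rewrite -[X in measurable X]setTI.
by apply: (measurable_first_coords (leqnSn d)) => //; exact: measurable_half_open_cell.
Qed.

Let mS k v : measurable (S k v).
Proof. exact: (measurableI _ _ (mcell k) (measurable_tnth_preimage ord_max (measurable_setle v))). Qed.

Let first_half_open (i : d.+1.-tuple (ordinal N)) (x : d.+1.-tuple R) : half_open_cell i x ->
  half_open_cell (first_index i) (first_coords d x).
Proof.
move=> xi j; rewrite !tnth_mktuple -(tnth_nth 0 x (widen_ord (leqnSn d) j)).
exact: xi.
Qed.

Let S_grid k J : grid_set N (S k (J%:R / N%:R)).
Proof.
move=> i; have [ik|ik] := eqVneq (first_index i) k; last first.
  right; apply/seteqP; split => // x [/first_half_open xi [xk _]].
  by move/eqP : ik; apply; exact: half_open_cell_disjoint xi xk.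
have [iJ|iJ] := ltnP (tnth i ord_max) J.
  left => x xi; split; first by rewrite -ik; exact: first_half_open.
  have /andP[_ /le_trans] := xi ord_max; apply.
  by rewrite ler_pM2r ?invr_gt0// ler_nat.
right; apply/seteqP; split => // x [xi [_ xJ]].
have /andP[h _] := xi ord_max; move: (lt_le_trans h xJ).
by rewrite ltr_pM2r ?invr_gt0// ltr_nat ltnNge iJ.
Qed.

Let S_mix k J : pr mix (S k (J%:R / N%:R)) = pr gam (S k (J%:R / N%:R)).
Proof.
rewrite -(checkerboard_mixture_grid N0 cC (mS _ _) (S_grid _ _)).
congr fine; exact: checkerboard_measureE.
Qed.

Let delta := 2 ^+ d * e.

(** A column cut at a grid height is a union of cells, so the checkerboard gives it the mass that C
    does. It is bounded below in d coordinates only, so passing from C to A costs 2 ^ d * e. *)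
Let S_delta k J : `|pr mix (S k (J%:R / N%:R)) - pr muA (S k (J%:R / N%:R))| <= delta.
Proof.
rewrite S_mix.
pose a : d.+1.-tuple R := [tuple of rcons [tuple (tnth k j)%:R / N%:R | j < d] 0].
pose b : d.+1.-tuple R := [tuple of rcons [tuple (tnth k j).+1%:R / N%:R | j < d] (J%:R / N%:R)].
have -> : S k (J%:R / N%:R) = partial_box d a b.
  have fE (x : d.+1.-tuple R) j : tnth (first_coords d x) j = tnth x (widen_ord (leqnSn d) j).
    by rewrite tnth_mktuple (tnth_nth 0).
  apply/seteqP; split => x.
    move=> [xk xJ]; split.
      move=> j jd; rewrite (_ : j = widen_ord (leqnSn d) (Ordinal jd)); last exact: val_inj.
      rewrite tnth_rcons_widen tnth_mktuple.
      by have := xk (Ordinal jd); rewrite fE => /andP[].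
    apply/forall_ordS; rewrite tnth_rcons_max; split => // j.
    rewrite tnth_rcons_widen tnth_mktuple.
    by have := xk j; rewrite fE => /andP[].
  move=> [h1 /forall_ordS[h2]]; rewrite tnth_rcons_max => h3; split => // j.
  rewrite fE; apply/andP; split.
    by have := h1 (widen_ord (leqnSn d) j) (ltn_ord j); rewrite tnth_rcons_widen tnth_mktuple.
  by have := h2 j; rewrite tnth_rcons_widen tnth_mktuple.
apply: (box_difference orthant_difference) => //.
apply/forall_ordS; rewrite !tnth_rcons_max; split; last by rewrite divr_ge0.
by move=> j; rewrite !tnth_rcons_widen !tnth_mktuple ler_pM2r ?invr_gt0// ler_nat.
Qed.

Let S_mono (mu : probability (d.+1.-tuple R) R) k u v : u <= v -> pr mu (S k u) <= pr mu (S k v).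
Proof. by move=> uv; apply: le_pr => // x [xk xu]; split => //; exact: le_trans uv. Qed.

Let deviationE B (cB : is_copula B) k y : deviation (copula_measure B) y (half_open_cell k) =
  pr (copula_measure B) (S k y) - y * pr (copula_measure B) (S k 1).
Proof.
have c1 := copula_measure_cube cB; have mc := @measurable_cube R d.+1.
rewrite /deviation; congr (_ - _ * _).
  apply: (pr_eq_on mc _ _ c1) => //.
    exact: (measurableI _ _ (mcell k) (measurable_tnth_preimage ord_max (measurable_setcc 0 y))).
  apply/seteqP; split => x [[xk xy] cx]; split => //; split => //; first by case/andP: xy.
  by rewrite xy andbT; have /andP[] := cx ord_max.
apply: (pr_eq_on mc _ _ c1) => //.
apply/seteqP; split => x.
  by move=> [xk cx]; split => //; split => //; have /andP[] := cx ord_max.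
by move=> [[xk xy] cx]; split.
Qed.

Variable y : R.
Hypothesis y01 : 0 <= y <= 1.

Let level : exists J : 'I_N, J%:R / N%:R <= y <= J.+1%:R / N%:R.
Proof.
have /andP[y0 y1] := y01; move: y0; rewrite le_eqVlt => /predU1P[<-|y0].
  by exists (Ordinal N0); rewrite mul0r lexx divr_ge0.
have [|i] := @half_open_cell_cover R N N0 1 [tuple y].
  by move=> j; rewrite (tnth_nth 0) (ord1 j) /= y0 y1.
move=> /(_ ord0); rewrite (tnth_nth 0) /= => /andP[h1 h2].
by exists (tnth i ord0); rewrite ltW.
Qed.

(** Between two consecutive grid heights monotonicity traps the mass of a column for both measures;
    the gap is the A-mass of a strip. The strips of all columns lie in one slab of height 1 / N,
    hence total at most 1 / N. Each column further costs one delta for the grid height and one for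
    its full mass, which is multiplied by y <= 1. *)
Lemma positive_deviation_difference :
  `|positive_deviation N mix y - positive_deviation N muA y| <=
  N%:R^-1 + 2 * N%:R ^+ d * (2 ^+ d * e).
Proof.
have [J /andP[Jy yJ]] := level.
have JJ : J%:R / N%:R <= J.+1%:R / N%:R :> R by rewrite ler_pM2r ?invr_gt0// ler_nat.
pose strip k := pr muA (S k (J.+1%:R / N%:R)) - pr muA (S k (J%:R / N%:R)).
have one k : `|pr mix (S k 1) - pr muA (S k 1)| <= delta.
  by have := S_delta k N; rewrite mulfV// gt_eqF.
have dk k : `|deviation mix y (half_open_cell k) - deviation muA y (half_open_cell k)| <=
    strip k + 2 * delta.
  rewrite (deviationE cCB) (deviationE cA) -/mix -/muA.
  have := S_delta k J; have := S_delta k J.+1; have := one k.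
  have := S_mono mix k Jy; have := S_mono mix k yJ.
  have := S_mono muA k Jy; have := S_mono muA k yJ.
  rewrite /strip; set M0 := pr mix (S k (J%:R / N%:R)); set M := pr mix (S k y).
  set M1 := pr mix (S k (J.+1%:R / N%:R)); set a0 := pr muA (S k (J%:R / N%:R)).
  set a := pr muA (S k y); set a1 := pr muA (S k (J.+1%:R / N%:R)).
  set m1 := pr mix (S k 1); set m2 := pr muA (S k 1).
  move=> h1 h2 h3 h4 /ler_normlP[g1 g2] /ler_normlP[g3 g4] /ler_normlP[g5 g6].
  have /andP[y0 y1] := y01.
  have d0 : 0 <= delta by lra.
  have ym : `|y * (m1 - m2)| <= delta.
    rewrite normrM (ger0_norm y0) (le_trans _ (_ : `|m1 - m2| <= _))//.
      by rewrite ler_piMl.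
    by apply/ler_normlP; split; lra.
  have /ler_normlP[k1 k2] := ym.
  by apply/ler_normlP; split; lra.
have sum_strip : \sum_k strip k <= N%:R^-1.
  pose T := [set x : d.+1.-tuple R | J%:R / N%:R < tnth x ord_max <= J.+1%:R / N%:R].
  have mT : measurable T by exact: measurable_margin_oc.
  have stripE k : strip k = pr muA (T `&` [set x | half_open_cell k (first_coords d x)]).
    rewrite /strip -prD//; last by move=> x [xk xJ]; split => //; exact: le_trans JJ.
    congr pr; apply/seteqP; split => x.
      move=> [[xk xJ] nx]; split => //; rewrite /T /=; apply/andP; split => //.
      by rewrite ltNge; apply/negP => h; apply: nx.
    by move=> [/andP[h1 h2] xk]; split => // -[_]; rewrite leNgt h1.
  under eq_bigr do rewrite stripE.
  rewrite -(@pr_bigcup_fin _ _ _ _ _ (fun k : d.-tuple 'I_N =>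
    [set x : d.+1.-tuple R | half_open_cell k (first_coords d x)]) T predT)//; last first.
    by move=> i j x; exact: half_open_cell_disjoint.
  apply: (@le_trans _ _ (pr muA T)).
    apply: le_pr => //.
    by apply: measurableI => //; apply: fin_bigcup_measurable.
  have c1 := copula_measure_cube cA.
  rewrite (le_trans (margin_oc_le c1 (margins cA) _ JJ))//.
  by rewrite -mulrBl -natr1 addrC addKr mul1r.
rewrite /positive_deviation -sumrB (le_trans (ler_norm_sum _ _ _))//.
apply: (@le_trans _ _ (\sum_(k : d.-tuple 'I_N) (strip k + 2 * delta))).
  apply: ler_sum => k _; apply: le_trans (dk k).
  (* Taking positive parts is 1-Lipschitz, by the four sign cases. *)
  set u := deviation mix _ _; set v := deviation muA _ _.
  have [u0|u0] := leP u 0; have [v0|v0] := leP v 0.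
  - by rewrite subrr normr0.
  - by rewrite sub0r normrN gtr0_norm// ler0_norm ?subr_le0; lra.
  - by rewrite subr0 gtr0_norm// ger0_norm ?subr_ge0; lra.
  - by [].
rewrite big_split /= lerD//.
by rewrite sumr_const card_tuple card_ord -[leLHS]mulr_natl natrX mulrCA mulrA.
Qed.

End deviation_comparison.

Section union_bound.
Context {R : realType} d (T : measurableType d) (mu : probability T R).

Lemma measurable_exists (I : finType) (Q : I -> set T) : (forall i, measurable (Q i)) ->
  measurable [set x | exists i, Q i x].
Proof.
move=> mQ; have -> : [set x | exists i, Q i x] = \bigcup_(i in [set: I]) Q i.
  by apply/seteqP; split => [x [i]|x [i _]]; exists i.
exact: fin_bigcup_measurable.
Qed.

Lemma pr_exists_le (I : finType) (Q : I -> set T) : (forall i, measurable (Q i)) ->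
  pr mu [set x | exists i, Q i x] <= \sum_i pr mu (Q i).
Proof.
move=> mQ.
have h (s : seq I) : measurable [set x | exists2 i, i \in s & Q i x] /\
    pr mu [set x | exists2 i, i \in s & Q i x] <= \sum_(i <- s) pr mu (Q i).
  elim: s => [|i s [mS IH]].
    have -> : [set x | exists2 i, i \in [::] & Q i x] = set0.
      by apply/seteqP; split => // x [].
    by rewrite big_nil pr0.
  have -> : [set x | exists2 j, j \in i :: s & Q j x] = Q i `|` [set x | exists2 j, j \in s & Q j x].
    apply/seteqP; split => [x [j]|x [Qi|[j js Qj]]].
    - by rewrite inE => /predU1P[->|js Qj]; [left|right; exists j].
    - by exists i => //; rewrite mem_head.
    - by exists j => //; rewrite inE js orbT.
  split; first exact: measurableU.
  by rewrite big_cons (le_trans (prU_le _ _ _))// lerD2l.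
have [_] := h (index_enum I); apply: le_trans.
rewrite (_ : [set x | exists i, Q i x] = [set x | exists2 i, i \in index_enum I & Q i x])//.
by apply/seteqP; split => [x [i Qi]|x [i _ Qi]]; exists i => //; exact: mem_index_enum.
Qed.

End union_bound.

(** * Approximation of events by unions of cells *)

Section grid_approximation.
Context {R : realType} m (mu : probability (m.-tuple R) R).
Hypothesis mu1 : pr mu (@cube R m) = 1.
Hypothesis mum : forall j t, 0 <= t <= 1 -> pr mu [set x | tnth x j <= t] = t.

(** Required for all large N and not just for some: grids of different mesh need not refine each
    other, and a union of two sets has to be approximated on a common grid. *)
Definition grid_approximable (E : set (m.-tuple R)) := forall e, 0 < e ->
  exists N1, forall N, (N1 <= N)%N -> (0 < N)%N ->
  exists F, [/\ measurable F, grid_set N F & pr mu (E `+` F) <= e].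

Let cells N (E : set (m.-tuple R)) : set (m.-tuple R) :=
  \bigcup_(k in [set k : m.-tuple 'I_N | `[< half_open_cell k `<=` E >]]) half_open_cell k.

Let mcells N E : measurable (cells N E).
Proof. by apply: fin_bigcup_measurable => // i _; exact: measurable_half_open_cell. Qed.

Let grid_cells N (N0 : (0 < N)%N) E : grid_set N (cells N E).
Proof.
move=> k; have [kE|kE] := asboolP (half_open_cell k `<=` E).
  by left => x xk; exists k => //=; apply/asboolP.
right; apply/seteqP; split => // x [xk [l /= /asboolP lE xl]].
by apply: kE; rewrite (half_open_cell_disjoint N0 xk xl).
Qed.

Let cells_sub N E : cells N E `<=` E.
Proof. by move=> x [k /= /asboolP kE xk]; exact: kE. Qed.

(** The cells inside the orthant miss only points within 1 / N below the corner in some coordinate.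
    These m slabs have total mass at most m / N. *)
Lemma grid_approximable_orthant u : grid_approximable (lower_orthant u).
Proof.
move=> e e0; have me0 : 0 <= m%:R / e by rewrite divr_ge0// ltW.
exists (Num.truncn (m%:R / e)).+1 => N NN N0; exists (cells N (lower_orthant u)); split => //.
  exact: grid_cells.
have NR0 : 0 < N%:R :> R by rewrite ltr0n.
have mo := @measurable_lower_orthant R m u.
pose Q j := [set x : m.-tuple R | tnth u j - N%:R^-1 < tnth x j <= tnth u j].
have mQ j : measurable (Q j) by exact: measurable_margin_oc.
have mh : measurable [set x : m.-tuple R | forall j, 0 < tnth x j <= 1].
  apply: (@measurable_forall _ _ _ (fun j (x : m.-tuple R) => 0 < tnth x j <= 1)) => j.
  exact: measurable_margin_oc.
have mY : measurable (lower_orthant u `+` cells N (lower_orthant u)).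
  by apply: measurableU; exact: measurableD.
have mE := measurable_exists mQ.
apply: (@le_trans _ _ (\sum_(j < m) pr mu (Q j))).
  rewrite -(pr_setI1 mY mh (pr_half_open_cube mu1 mum)).
  apply: le_trans (pr_exists_le mu mQ); apply: le_pr => //; first exact: measurableI.
  move=> x [[[xu nx]|[/cells_sub//]] xh].
  have [k xk] := half_open_cell_cover N0 xh.
  apply: contrapT => nQ; apply: nx; exists k => //=; apply/asboolP => z zk j.
  have /andP[_ /le_trans] := zk j; apply; rewrite leNgt; apply/negP => ju.
  apply: nQ; exists j; rewrite /Q /= xu andbT.
  have /andP[h _] := xk j; apply: lt_trans h.
  by rewrite ltrBlDr -[X in _ + X]mul1r -mulrDl natr1.
apply: (@le_trans _ _ (\sum_(j < m) N%:R^-1)).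
  apply: ler_sum => j _; apply: le_trans (margin_oc_le mu1 mum _ _) _.
    by rewrite gerBl invr_ge0 ltW.
  by rewrite opprB addrCA subrr addr0.
rewrite sumr_const card_ord -[leLHS]mulr_natl ler_pdivrMr// mulrC -ler_pdivrMr//.
by rewrite ltW// (lt_le_trans (truncnS_gt _))// ler_nat.
Qed.

Let mY (E F : set (m.-tuple R)) : measurable E -> measurable F -> measurable (E `+` F).
Proof. by move=> mE mF; apply: measurableU; exact: measurableD. Qed.

Lemma grid_approximableC E : measurable E -> grid_approximable E -> grid_approximable (~` E).
Proof.
move=> mE aE e /aE[N1 hN]; exists N1 => N NN N0; have [F [mF gF EF]] := hN N NN N0.
exists (~` F); split; [exact: measurableC|exact: grid_setC|].
apply: le_trans EF; apply: le_pr; [by apply: mY; exact: measurableC|exact: mY|].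
by move=> x [[h1 h2]|[h1 h2]]; [right|left]; split => //; apply: contrapT.
Qed.

Lemma grid_approximableU E E' : measurable E -> measurable E' ->
  grid_approximable E -> grid_approximable E' -> grid_approximable (E `|` E').
Proof.
move=> mE mE' aE aE' e e0; have e2 : 0 < e / 2 by rewrite divr_gt0.
have [N1 h1] := aE _ e2; have [N2 h2] := aE' _ e2; exists (maxn N1 N2) => N.
rewrite geq_max => /andP[N1N N2N] N0.
have [F [mF gF EF]] := h1 N N1N N0; have [F' [mF' gF' EF']] := h2 N N2N N0.
exists (F `|` F'); split; [exact: measurableU|exact: grid_setU|].
rewrite [leRHS](splitr e); apply: le_trans (lerD EF EF').
apply: le_trans (prU_le _ (mY mE mF) (mY mE' mF')).
apply: le_pr; [by apply: mY; exact: measurableU|by apply: measurableU; exact: mY|].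
move=> x [[[h|h] /not_orP[n1 n2]]|[[h|h] /not_orP[n1 n2]]].
- by left; left.
- by right; left.
- by left; right.
- by right; right.
Qed.

(** Half of e pays for the passage to a finite partial union, half for its approximation; the
    threshold on N is the one of that partial union. *)
Lemma grid_approximable_bigcup (F : (set (m.-tuple R))^nat) : (forall n, measurable (F n)) ->
  (forall n, grid_approximable (F n)) -> grid_approximable (\bigcup_n F n).
Proof.
move=> mF aF; pose U n := \big[setU/set0]_(i < n.+1) F i.
have mU n : measurable (U n) by exact: bigsetU_measurable.
have aU n : grid_approximable (U n).
  elim: n => [|n IH]; rewrite /U big_ord_recr/= -?/(U n); last exact: grid_approximableU.
  by rewrite big_ord0 set0U.
move=> e e0; have e2 : 0 < e / 2 by rewrite divr_gt0.
have ndU : nondecreasing_seq U by move=> i j ij; apply/subsetPset; apply: subset_bigsetU.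
have := @pr_bigcup_cvg _ _ _ mu _ mU ndU; rewrite bigcup_bigsetU_bigcup => /cvgrPdist_le /(_ _ e2)[n _ hn].
have {}hn : pr mu (\bigcup_n F n `\` U n) <= e / 2.
  have mUF : measurable (\bigcup_n F n) by exact: bigcupT_measurable.
  rewrite prD//; last by rewrite -(bigcup_bigsetU_bigcup F); exact: bigcup_sup.
  exact: le_trans (ler_norm _) (hn n (leqnn n)).
have mUF : measurable (\bigcup_n F n) by exact: bigcupT_measurable.
have [N1 h1] := aU n _ e2; exists N1 => N NN N0.
have [G [mG gG UG]] := h1 N NN N0; exists G; split => //.
rewrite (splitr e); apply: le_trans (lerD hn UG).
apply: le_trans (prU_le _ (measurableD mUF (mU n)) (mY (mU n) mG)).
apply: le_pr; [exact: mY|apply: measurableU; [exact: measurableD|exact: mY]|].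
move=> x [[xF nG]|[xG nF]].
  by have [xU|xU] := pselect (U n x); [right; left|left].
right; right; split => // xU; apply: nF; rewrite -(bigcup_bigsetU_bigcup F); exists n => //.
Qed.

Lemma measurable_grid_approximable E : measurable E -> grid_approximable E.
Proof.
suff h : @measurable _ (m.-tuple R) `<=` [set E | measurable E /\ grid_approximable E].
  by move=> /h[].
rewrite [X in X `<=` _](lower_orthant_gen m); apply: smallest_sub; last first.
  move=> _ [u _ <-]; split; [exact: measurable_lower_orthant|exact: grid_approximable_orthant].
split.
- split => // e e0; exists 0%N => N _ _; exists set0; split => //; first by move=> i; right; rewrite setI0.
  by rewrite (_ : _ `+` _ = set0) ?pr0 ?ltW//; apply/seteqP; split => // x [[]|[]].
- by move=> G [mG aG]; rewrite setTD; split; [exact: measurableC|exact: grid_approximableC].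
- move=> F hF; split; first by apply: bigcupT_measurable => n; case: (hF n).
  by apply: grid_approximable_bigcup => n; case: (hF n).
Qed.

(** A grid set may contain points outside the cells. Intersecting with the cells, which carry all
    mass, leaves a genuine union of cells. *)
Lemma cells_approximation E e : measurable E -> 0 < e -> exists N1, forall N, (N1 <= N)%N -> (0 < N)%N ->
  exists P : pred (m.-tuple 'I_N), pr mu (E `+` \bigcup_(k in [set k | P k]) half_open_cell k) <= e.
Proof.
move=> mE e0; have [N1 h1] := measurable_grid_approximable mE e0; exists N1 => N NN N0.
have [F [mF gF EF]] := h1 N NN N0.
exists (fun k => `[< half_open_cell k `<=` F >]); rewrite -/(cells N F).
have mH : measurable (\bigcup_(i in [set: m.-tuple 'I_N]) half_open_cell i : set (m.-tuple R)).
  by apply: fin_bigcup_measurable => // i _; exact: measurable_half_open_cell.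
rewrite -(pr_setI1 (mY mE (mcells N F)) mH (half_open_cells_full mu1 mum N0)).
apply: le_trans EF; apply: le_pr; [by apply: measurableI => //; exact: mY|exact: mY|].
move=> x [[[xE nF]|[/cells_sub xF nE]] [k _ xk]]; last by right.
left; split => // xF; apply: nF; exists k => //=; apply/asboolP.
by have [//|h] := gF k; have : (half_open_cell k `&` F) x by []; rewrite h.
Qed.

End grid_approximation.

Section section_convergence.
Context {R : realType} (d : nat) (A : d.+1.-tuple R -> R) (cA : is_copula A).

Let mu := copula_measure A.
Let mfc := measurable_first_coords (R := R) (leqnSn d).
Let m0 := law mu mfc.

Let m01 : pr m0 (@cube R d) = 1.
Proof.
rewrite pr_law; apply/eqP; rewrite eq_le pr_le1 /=; last first.
  by rewrite -[X in measurable X]setTI; apply: mfc => //; exact: measurable_cube.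
rewrite -[leLHS](copula_measure_cube cA); apply: le_pr.
- exact: measurable_cube.
- by rewrite -[X in measurable X]setTI; apply: mfc => //; exact: measurable_cube.
- by move=> x cx j; rewrite tnth_mktuple -(tnth_nth 0 x (widen_ord (leqnSn d) j)).
Qed.

Let m0m j t : 0 <= t <= 1 -> pr m0 [set x | tnth x j <= t] = t.
Proof.
move=> t01; have [_ h] := is_copula_measure cA; rewrite pr_law -[RHS](h (widen_ord (leqnSn d) j) t t01).
by congr pr; apply/seteqP; split => x /=; rewrite tnth_mktuple (tnth_nth 0 x (widen_ord (leqnSn d) j)).
Qed.

Lemma deviation_le_symmetric_difference y E F : 0 <= y <= 1 -> measurable E -> measurable F ->
  deviation mu y E <= deviation mu y F + 2 * pr m0 (E `+` F).
Proof.
move=> /andP[y0 y1] mE mF.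
have mp G : measurable G -> measurable [set x : d.+1.-tuple R | G (first_coords d x)].
  by move=> mG; rewrite -[X in measurable X]setTI; exact: mfc.
have ml : measurable [set x : d.+1.-tuple R | 0 <= last_coord x <= y].
  exact: (measurable_tnth_preimage ord_max (measurable_setcc 0 y)).
pose D := [set x : d.+1.-tuple R | (E `+` F) (first_coords d x)].
have mD : measurable D by apply: mp; apply: measurableU; exact: measurableD.
have -> : pr m0 (E `+` F) = pr mu D by rewrite pr_law.
have h1 : pr mu [set x | E (first_coords d x) /\ 0 <= last_coord x <= y] <=
    pr mu [set x | F (first_coords d x) /\ 0 <= last_coord x <= y] + pr mu D.
  have mFl : measurable [set x : d.+1.-tuple R | F (first_coords d x) /\ 0 <= last_coord x <= y].
    exact: (measurableI _ _ (mp _ mF) ml).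
  apply: le_trans (prU_le mu mFl mD); apply: le_pr; [|exact: measurableU|].
    exact: (measurableI _ _ (mp _ mE) ml).
  move=> x [xE xl]; have [xF|xF] := pselect (F (first_coords d x)); first by left.
  by right; left.
have h2 : pr mu [set x | F (first_coords d x)] <= pr mu [set x | E (first_coords d x)] + pr mu D.
  apply: le_trans (prU_le mu (mp _ mE) mD).
  apply: le_pr; [exact: mp|by apply: measurableU => //; exact: mp|].
  move=> x xF; have [xE|xE] := pselect (E (first_coords d x)); first by left.
  by right; right.
have p0 : 0 <= pr mu D by exact: pr_ge0.
rewrite /deviation.
have h3 := ler_wpM2l y0 h2; have h4 : y * pr mu D <= pr mu D by rewrite ler_piMl.
rewrite mulrDr in h3; lra.
Qed.

Lemma zeta_section_approx y e : 0 <= y <= 1 -> 0 < e -> exists N1, forall N, (N1 <= N)%N -> (0 < N)%N ->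
  zeta_section A y <= 2 * positive_deviation N mu y + e.
Proof.
move=> y01 e0; have [E mE hE] : exists2 E, measurable E & zeta_section A y - e / 2 < 2 * deviation mu y E.
  apply: contrapT => h; suff : zeta_section A y <= zeta_section A y - e / 2 by lra.
  apply: zeta_section_le => // E mE; rewrite leNgt; apply/negP => hE; apply: h; by exists E.
(* The choice of E uses e / 2. Replacing E by F changes the deviation by at most 2 (e / 8), which
   doubles to the other e / 2. *)
have e8 : 0 < e / 8 by rewrite divr_gt0.
have [N1 h1] := cells_approximation m01 m0m mE e8; exists N1 => N NN N0; have [P hP] := h1 N NN N0.
set F := \bigcup_(k in _) _ in hP.
have mF : measurable F by apply: fin_bigcup_measurable => // i _; exact: measurable_half_open_cell.
have := deviation_le_symmetric_difference y01 mE mF.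
have : deviation mu y F <= positive_deviation N mu y.
  rewrite /F deviation_bigcup//.
  rewrite big_mkcond/=; apply: ler_sum => k _; case: ifP => _; by rewrite le_max lexx ?orbT.
by move: hE hP; lra.
Qed.

Variables (N : nat -> nat) (C : nat -> d.+1.-tuple R -> R) (e : nat -> R).
Hypothesis N0 : forall n, (0 < N n)%N.
Hypothesis Noo : forall k, \forall n \near \oo, (k <= N n)%N.
Hypothesis cC : forall n, is_copula (C n).
Hypothesis CA : forall n u, cube u -> `|C n u - A u| <= e n.
Hypothesis Ne : (N n)%:R ^+ d * e n @[n --> \oo] --> 0.

Lemma zeta_section_checkerboard_cvg y : 0 <= y <= 1 ->
  zeta_section (checkerboard (N n) (C n)) y @[n --> \oo] --> zeta_section A y.
Proof.
move=> y01; apply/cvgrPdist_le => eps eps0.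
(* The approximation for A takes eps / 4. The comparison error, doubled, is at most 2 (eps / 8 + 2
   eps / 8), the remaining three quarters. *)
have e4 : 0 < eps / 4 by rewrite divr_gt0.
have [N1 h1] := zeta_section_approx y01 e4.
have Ninv : \forall n \near \oo, (N n)%:R^-1 <= eps / 8.
  have := Noo (Num.truncn (eps / 8)^-1).+1; apply: filterS => n hn.
  rewrite invf_ple ?posrE ?ltr0n// ?divr_gt0//.
  by rewrite ltW// (lt_le_trans (truncnS_gt _))// ler_nat.
have Nee : \forall n \near \oo, (N n)%:R ^+ d * e n <= eps / (8 * 2 ^+ d).
  have p : 0 < eps / (8 * 2 ^+ d) by rewrite divr_gt0// mulr_gt0// exprn_gt0.
  have /cvgrPdist_le/(_ _ p) := Ne; apply: filterS => n; rewrite sub0r normrN.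
  exact: le_trans (ler_norm _).
near=> n.
have hn1 : zeta_section A y <= 2 * positive_deviation (N n) mu y + eps / 4.
  by apply: h1 => //; near: n; exact: Noo.
have hn2 : 2 * positive_deviation (N n) mu y <= zeta_section A y by exact: positive_deviation_le.
have hn3 := positive_deviation_difference (N0 n) cA (cC n) (CA n) y01.
rewrite (zeta_section_checkerboard (N0 n) (cC n) y01).
have i1 : (N n)%:R^-1 <= eps / 8 by near: n.
have i2 : (N n)%:R ^+ d * (2 ^+ d * e n) <= eps / 8.
  rewrite mulrCA mulrC -ler_pdivlMr ?exprn_gt0// -mulrA -invfM.
  by near: n.
move: hn3; set a := positive_deviation _ _ _; set b := positive_deviation _ _ _.
move: hn1 hn2; rewrite -/b => hn1 hn2 /ler_normlP[g1 g2].
apply/ler_normlP; split; lra.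
Unshelve. all: by end_near.
Qed.

Theorem zeta1_checkerboard_cvg : zeta1 (checkerboard (N n) (C n)) @[n --> \oo] --> zeta1 A.
Proof.
rewrite (zeta1E A).
have cCB n : is_copula (checkerboard (N n) (C n)) by exact: checkerboard_is_copula.
have -> : (fun n => zeta1 (checkerboard (N n) (C n))) =
    (fun n => 3 * fine (\int[lebesgue_measure]_(y in `[0%R, 1%R])
      (zeta_section (checkerboard (N n) (C n)) y)%:E)%E).
  by apply/funext => n; rewrite zeta1E.
apply: cvgMr.
have mD : measurable (`[0, 1]%classic : set R) by exact: measurable_itv.
have in01 (y : R) : `[0, 1]%classic y -> 0 <= y <= 1 by rewrite /= in_itv.
have := @dominated_convergence _ _ _ (@lebesgue_measure R) _ mD
  (fun n y => (zeta_section (checkerboard (N n) (C n)) y)%:E)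
  (fun y => (zeta_section A y)%:E) (cst 1%:E).
case.
- by move=> n; apply/measurable_EFinP; exact: measurable_zeta_section.
- by apply/measurable_EFinP; exact: measurable_zeta_section.
- apply: aeW => y /in01 y01; apply: cvg_EFin.
    by apply: nearW.
  exact: zeta_section_checkerboard_cvg.
- apply/integrableP; split; first exact: measurable_cst.
  rewrite (_ : (fun x : R => _) = cst 1%:E); last by apply/funext => x /=; rewrite normr1.
  rewrite integral_cst// mul1e; have := @lebesgue_measure_itv R `[0, 1]; rewrite /= lte_fin ltr01 => ->.
  by rewrite -EFinB ltry.
- apply: aeW => y n /in01 y01; rewrite lee_fin ger0_norm; last by case/andP: (zeta_section01 (checkerboard (N n) (C n)) y01).
  by case/andP: (zeta_section01 (checkerboard (N n) (C n)) y01).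
by move=> intA _ h; apply: fine_cvg; rewrite fineK//; exact: integrable_fin_num.
Qed.

End section_convergence.

(** * The empirical multilinear copula *)

Section extrema.
Context {R : realType}.

Lemma sup_max (E : set R) x : E x -> ubound E x -> sup E = x.
Proof.
move=> Ex ux; apply/eqP; rewrite eq_le; apply/andP; split.
  by apply: ge_sup => //; exists x.
by apply: ub_le_sup => //; exists x.
Qed.

Lemma inf_min (E : set R) x : E x -> lbound E x -> inf E = x.
Proof.
move=> Ex lx; apply/eqP; rewrite eq_le; apply/andP; split.
  by apply: ge_inf => //; exists x.
by apply: lb_le_inf => //; exists x.
Qed.

End extrema.

Section ranks.
Context {R : realType} (m n : nat) (z : nat -> m.-tuple R).
Hypothesis n0 : (0 < n)%N.

Definition sample_count i (t : R) : nat := #|[pred k : 'I_n | tnth (z k) i <= t]|.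

Definition rank i (k : 'I_n) : nat := sample_count i (tnth (z k) i).

Lemma empirical_marginE i t : empirical_margin n z i t = (sample_count i t)%:R / n%:R.
Proof.
rewrite /empirical_margin -natr_sum /sample_count -sum1_card.
by congr (_%:R / _); rewrite [RHS]big_mkcond /=; apply: eq_bigr => k _; rewrite inE; case: (_ <= _).
Qed.

(** If z_k <= t, all observations counted by the rank of k are counted at t. Otherwise the
    observations counted at t form a proper subset, which misses k. *)
Lemma le_sample_count i k t : (rank i k <= sample_count i t)%N = (tnth (z k) i <= t).
Proof.
have [kt|tk] := leP (tnth (z k) i) t.
  by apply: subset_leq_card; apply/fintype.subsetP => l; rewrite !inE => /le_trans; apply.
apply/negbTE; rewrite -ltnNge; apply: proper_card; rewrite properE; apply/andP; split.
  by apply/fintype.subsetP => l; rewrite !inE => /le_trans; apply; exact: ltW.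
by apply/fintype.subsetPn; exists k; rewrite !inE ?lexx// -ltNge.
Qed.

Lemma rank_gt0 i k : (0 < rank i k)%N.
Proof. by apply/card_gt0P; exists k; rewrite inE. Qed.

Lemma sample_count_le i t : (sample_count i t <= n)%N.
Proof. by rewrite (leq_trans (max_card _))// card_ord. Qed.

Let index_lt i k : ((rank i k).-1 < n)%N.
Proof. by rewrite prednK ?rank_gt0// sample_count_le. Qed.

(** Ranks run from 1 to n, cell indices from 0 to n - 1. *)
Definition rank_index i k : 'I_n := Ordinal (index_lt i k).

Lemma rank_indexE i k : rank i k = (rank_index i k).+1.
Proof. by rewrite /= prednK// rank_gt0. Qed.

Hypothesis no_ties : forall i (k l : 'I_n), tnth (z k) i = tnth (z l) i -> k = l.

Lemma rank_index_inj i : injective (rank_index i).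
Proof.
move=> k l kl; apply: (@no_ties i); have rkl : rank i k = rank i l by rewrite !rank_indexE kl.
apply/eqP; rewrite eq_le -!le_sample_count.
by apply/andP; split; [rewrite rkl|rewrite -rkl].
Qed.

Lemma rank_index_surj i a : exists k, rank_index i k = a.
Proof. by have [g _ gK] := injF_bij (@rank_index_inj i); exists (g a). Qed.

Lemma sample_count_surj i q : (q <= n)%N -> exists t, sample_count i t = q.
Proof.
case: q => [_|q qn]; last first.
  have [k kq] := rank_index_surj i (Ordinal qn).
  by exists (tnth (z k) i); rewrite -/(rank i k) rank_indexE kq.
(* The count 0 is attained at any point below all observations. *)
exists (- \sum_(k < n) `|tnth (z k) i| - 1); apply/eqP/pred0P => k /=; apply/negbTE; rewrite -ltNge (bigD1 k)//=.
have h : 0 <= \sum_(l < n | l != k) `|tnth (z l) i| by apply: sumr_ge0.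
have := ler_norm (- tnth (z k) i); rewrite normrN; lra.
Qed.

Lemma range_empirical_margin i :
  range (empirical_margin n z i) = [set q%:R / n%:R | q in [set q | (q <= n)%N]].
Proof.
apply/seteqP; split => [_ [t _ <-]|_ [q /= qn <-]].
  by exists (sample_count i t); [exact: sample_count_le|rewrite empirical_marginE].
by have [t tq] := sample_count_surj i qn; exists t => //; rewrite empirical_marginE tq.
Qed.

(** Whichever preimage [xget] selects, an observation lies below it exactly when its ranks are at
    most the q i, so the value does not depend on the choice. *)
Lemma empirical_subcopulaE (q : 'I_m -> nat) v : (forall i, (q i <= n)%N) ->
  (forall i, tnth v i = (q i)%:R / n%:R) ->
  empirical_subcopula n z v = (\sum_(k < n) \prod_i (rank i k <= q i)%N%:R) / n%:R.
Proof.
move=> qn vq; rewrite /empirical_subcopula /empirical_df.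
set X := [set x | _]; have /(@xgetPex _ point) hx : exists x, X x.
  have /choice[t tq] i := sample_count_surj i (qn i).
  by exists [tuple t i | i < m] => i; rewrite tnth_mktuple vq empirical_marginE tq.
congr (_ / _); apply: eq_bigr => k _.
have h i : (rank i k <= q i)%N = (tnth (z k) i <= tnth (xget point X) i).
  have := hx i; rewrite vq empirical_marginE.
  move=> /(mulIf _)/eqP; rewrite invr_eq0 pnatr_eq0 -lt0n n0 => /(_ isT).
  by rewrite eqr_nat => /eqP <-; rewrite le_sample_count.
rewrite indicE; under [RHS]eq_bigr do rewrite h.
case: (boolP (z k \in _)) => [/set_mem hk|hk]; first by rewrite big1// => i _; rewrite hk.
have /existsP[i hi] : [exists i, ~~ (tnth (z k) i <= tnth (xget point X) i)].
  rewrite -negb_forall; apply: contraNN hk => /forallP hk; apply/mem_set => i; exact: hk.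
by rewrite (bigD1 i)//= (negbTE hi) mul0r.
Qed.

End ranks.

Section empirical_copula_formula.
Context {R : realType} (m n : nat) (z : nat -> m.-tuple R).
Hypothesis n0 : (0 < n)%N.
Hypothesis no_ties : forall i (k l : 'I_n), tnth (z k) i = tnth (z l) i -> k = l.

Let nR0 : 0 < n%:R :> R. Proof. by rewrite ltr0n. Qed.

Let prodM (F G : 'I_m -> R) : (\prod_i F i) * (\prod_i G i) = \prod_i (F i * G i).
Proof. by rewrite big_split. Qed.

(** Linear interpolation between integers of the step that jumps at r + 1 is the uniform
    distribution function on [r, r + 1]. At an integer x both nodes coincide and the first weight is
    0. *)
Let clamp_interpolation (x : R) (a c r : nat) :
  a%:R <= x < a.+1%:R -> c = (if x == a%:R then a else a.+1) ->
  (x - a%:R) * (r.+1 <= c)%N%:R + (1 - (x - a%:R)) * (r.+1 <= a)%N%:R = clamp (x - r%:R).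
Proof.
move=> /andP[ax xa] ->; have [ra|ar] := ltnP r a.
  have r1 : r.+1%:R <= a%:R :> R by rewrite ler_nat.
  rewrite (_ : (r < _)%N = true); last by case: ifP => _ //; exact: leq_trans ra _.
  by rewrite !mulr1 addrC subrK clamp_gt1//; rewrite -natr1 in r1; lra.
rewrite mulr0 addr0; have [xa'|xa'] := eqVneq x a%:R.
  rewrite ltnNge ar /= mulr0 clamp_lt0// xa' subr_le0 ler_nat//.
rewrite ltnS; have [ra|ra] := leqP r a.
  have -> : r = a by apply/eqP; rewrite eqn_leq ra ar.
  by rewrite mulr1 clamp_id// subr_ge0 ax /=; move: xa; rewrite -natr1; lra.
rewrite mulr0 clamp_lt0// subr_le0 (le_trans (ltW xa))// ler_nat//.
Qed.

(** At a node the subcopula is an average of products of steps, one per observation. The sum over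
    the vertices of the interpolation cell distributes over such a product and leaves one linear
    interpolation per coordinate. *)
Lemma empirical_copulaE u : cube u ->
  empirical_copula n z u =
  (\sum_(k < n) \prod_i clamp (n%:R * tnth u i - (rank_index z i k)%:R)) / n%:R.
Proof.
move=> cu; rewrite /empirical_copula /multilinear_interpolation.
(* The nodes around u are a / n and c / n, where a and c are n u rounded down and up. *)
pose a i := Num.truncn (n%:R * tnth u i).
pose c i := if n%:R * tnth u i == (a i)%:R then a i else (a i).+1.
have ha i : (a i)%:R <= n%:R * tnth u i < (a i).+1%:R.
  by apply: truncn_itv; have /andP[u0 _] := cu i; rewrite mulr_ge0.
have an i : (a i <= n)%N.
  have /andP[_ u1] := cu i; have /andP[h _] := ha i.
  by rewrite -(ler_nat R) (le_trans h)// ler_piMr.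
have cn i : (c i <= n)%N.
  rewrite /c; case: ifPn => // h; have /andP[h1 _] := ha i; have /andP[_ u1] := cu i.
  rewrite -(ltr_nat R) (lt_le_trans (_ : _ < n%:R * tnth u i))//; last by rewrite ler_piMr.
  by rewrite lt_neqAle eq_sym h h1.
have loE i : sup [set v | range (empirical_margin n z i) v /\ v <= tnth u i] = (a i)%:R / n%:R.
  rewrite (range_empirical_margin no_ties); apply: sup_max.
    split; first by exists (a i) => //=; exact: an.
    by rewrite ler_pdivrMr// mulrC; case/andP: (ha i).
  move=> _ [[q /= qn <-]]; rewrite ler_pdivrMr// mulrC => qu.
  rewrite ler_pM2r ?invr_gt0// ler_nat -ltnS -(ltr_nat R).
  by case/andP: (ha i) => _; exact: le_lt_trans.
have hiE i : inf [set v | range (empirical_margin n z i) v /\ tnth u i <= v] = (c i)%:R / n%:R.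
  rewrite (range_empirical_margin no_ties); apply: inf_min.
    split; first by exists (c i) => //=; exact: cn.
    rewrite ler_pdivlMr// mulrC /c; case: ifPn => [/eqP -> //|_].
    by apply: ltW; case/andP: (ha i).
  move=> _ [[q /= qn <-]]; rewrite ler_pdivlMr// mulrC => uq.
  rewrite ler_pM2r ?invr_gt0// ler_nat /c; have /andP[h1 h2] := ha i.
  have aq : (a i <= q)%N by rewrite -(ler_nat R) (le_trans h1).
  case: ifPn => // h; rewrite -(ltr_nat R) (lt_le_trans _ uq)//.
  by rewrite lt_neqAle eq_sym h h1.
(* When both nodes coincide the quotient is 0 by convention, in agreement with n u = a. *)
have wE i : (tnth u i - (a i)%:R / n%:R) / ((c i)%:R / n%:R - (a i)%:R / n%:R) =
    n%:R * tnth u i - (a i)%:R.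
  rewrite /c; case: ifPn => [/eqP ->|_]; first by rewrite !subrr invr0 mulr0.
  rewrite -mulrBl -natr1 (addrC _ 1) addrK mul1r invrK mulrBl.
  by rewrite mulfVK ?gt_eqF// mulrC.
under eq_bigr => b _.
  rewrite (@empirical_subcopulaE _ _ _ _ n0 no_ties (fun i => if b i then c i else a i)); last 2 first.
  - by move=> i; case: ifP.
  - by move=> i; rewrite tnth_mktuple hiE loE; case: ifP.
  rewrite mulrA mulr_sumr.
  under [X in X / _]eq_bigr => k _.
    rewrite prodM.
    rewrite (eq_bigr (fun i => if b i then (n%:R * tnth u i - (a i)%:R) * (rank z i k <= c i)%N%:R
      else (1 - (n%:R * tnth u i - (a i)%:R)) * (rank z i k <= a i)%N%:R)); last first.
      by move=> i _; rewrite hiE loE wE; case: (b i).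
    over.
  over.
rewrite -mulr_suml exchange_big /=; congr (_ / _); apply: eq_bigr => k _.
rewrite -(bigA_distr_bigA (fun i (b : bool) => if b then (n%:R * tnth u i - (a i)%:R) * (rank z i k <= c i)%N%:R
      else (1 - (n%:R * tnth u i - (a i)%:R)) * (rank z i k <= a i)%N%:R)) /=.
by apply: eq_bigr => i _; rewrite big_bool /= rank_indexE clamp_interpolation.
Qed.

Let cell_index k : m.-tuple 'I_n := [tuple rank_index z i k | i < m].

Let weight i : R := (\sum_(k < n) (cell_index k == i)%:R) / n%:R.

Let sum_weight (G : m.-tuple 'I_n -> R) :
  \sum_i weight i * G i = (\sum_(k < n) G (cell_index k)) / n%:R.
Proof.
rewrite [RHS]mulr_suml; under eq_bigr do rewrite /weight !mulr_suml.
rewrite exchange_big /=; apply: eq_bigr => k _.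
rewrite (bigD1 (cell_index k))//= eqxx mul1r big1 ?addr0 1?mulrC// => i.
by rewrite eq_sym => /negbTE ->; rewrite !mul0r.
Qed.

(** Each observation gives weight 1 / n to the cell selected by its ranks. Without ties the ranks in
    one coordinate are a bijection, so every slab of width 1 / n gets exactly one observation; this
    makes the margins uniform. *)
Lemma empirical_copula_is_copula : is_copula (empirical_copula n z).
Proof.
have w0 i : 0 <= weight i by rewrite divr_ge0// sumr_ge0.
have w1 : \sum_i weight i = 1.
  transitivity (\sum_i weight i * 1); first by apply: eq_bigr => i _; rewrite mulr1.
  by rewrite sum_weight sumr_const card_ord mulfV// gt_eqF.
apply: (cell_mixture_is_copula n0 w0 w1).
  move=> j a; rewrite big_mkcond /=.
  transitivity (\sum_i weight i * (tnth i j == a)%:R).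
    by apply: eq_bigr => i _; case: eqP => _; rewrite ?mulr1 ?mulr0.
  rewrite sum_weight; have [k ka] := rank_index_surj no_ties j a.
  rewrite (bigD1 k)//= tnth_mktuple ka eqxx big1 ?addr0 ?mul1r// => l lk.
  rewrite tnth_mktuple -ka; case: eqP => // /(rank_index_inj no_ties) /eqP.
  by rewrite (negbTE lk).
move=> u cu; rewrite empirical_copulaE// /cell_mixture_df sum_weight; congr (_ / _).
by apply: eq_bigr => k _; apply: eq_bigr => i _; rewrite tnth_mktuple.
Qed.

End empirical_copula_formula.

Section uniform_margins_lipschitz.
Context {R : realType} (m : nat) (mu : probability (m.-tuple R) R).
Hypothesis mu1 : pr mu (@cube R m) = 1.
Hypothesis mum : forall j t, 0 <= t <= 1 -> pr mu [set x | tnth x j <= t] = t.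

Lemma lower_orthant_shift u (delta : R) : 0 <= delta ->
  pr mu (lower_orthant [tuple tnth u i + delta | i < m]) <= pr mu (lower_orthant u) + m%:R * delta.
Proof.
move=> d0; pose Q (i : 'I_m) := [set x : m.-tuple R | tnth u i < tnth x i <= tnth u i + delta].
have mQ i : measurable (Q i) by exact: measurable_margin_oc.
have mE := measurable_exists mQ; have mo := @measurable_lower_orthant R m.
apply: (@le_trans _ _ (pr mu (lower_orthant u `|` [set x | exists i, Q i x]))).
  apply: le_pr => //; first exact: measurableU.
  move=> x xu; apply: contrapT => /not_orP[nx nQ]; apply: nx => i.
  rewrite leNgt; apply/negP => h; apply: nQ; exists i; rewrite /Q /= h /=.
  by have := xu i; rewrite tnth_mktuple.
apply: le_trans (prU_le _ (mo u) mE) _; rewrite lerD2l.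
apply: le_trans (pr_exists_le mu mQ) _.
rewrite -[X in X%:R * _]card_ord mulr_natl -sumr_const; apply: ler_sum => i _.
apply: le_trans (margin_oc_le mu1 mum _ _) _; first by rewrite lerDl.
by rewrite addrAC subrr add0r.
Qed.

Lemma lower_orthant_lipschitz u v (delta : R) : 0 <= delta ->
  (forall i, `|tnth u i - tnth v i| <= delta) ->
  `|pr mu (lower_orthant u) - pr mu (lower_orthant v)| <= m%:R * delta.
Proof.
move=> d0 uv.
have h x y : (forall i, tnth x i <= tnth y i + delta) ->
    pr mu (lower_orthant x) <= pr mu (lower_orthant y) + m%:R * delta.
  move=> xy; apply: le_trans (lower_orthant_shift y d0).
  apply: le_pr; [exact: measurable_lower_orthant..|move=> w wx i].
  by rewrite tnth_mktuple (le_trans (wx i)).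
apply/ler_normlP; split; rewrite ?opprB lerBlDl addrC.
  by rewrite addrC; apply: h => i; have /ler_normlP[] := uv i; lra.
by rewrite addrC; apply: h => i; have /ler_normlP[] := uv i; lra.
Qed.

End uniform_margins_lipschitz.

(** * Uniform error of the empirical copula *)

Section empirical_copula_error.
Context {R : realType} (m : nat) (A : m.-tuple R -> R) (cA : is_copula A).

Let mu := copula_measure A.
Let mu1 : pr mu (@cube R m) = 1. Proof. by have [[h _] _] := is_copula_measure cA; rewrite /pr h. Qed.
Let mum j t : 0 <= t <= 1 -> pr mu [set x | tnth x j <= t] = t.
Proof. by have [_ h] := is_copula_measure cA; exact: h. Qed.

Variables (n : nat) (z V : nat -> m.-tuple R) (e : R).
Hypothesis n0 : (0 < n)%N.
Hypothesis no_ties : forall i (k l : 'I_n), tnth (z k) i = tnth (z l) i -> k = l.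
Hypothesis order_zV : forall i (k l : 'I_n),
  (tnth (z k) i <= tnth (z l) i) = (tnth (V k) i <= tnth (V l) i).
Hypothesis V01 : forall k : 'I_n, cube (V k).
Hypothesis Ve : forall u, `|empirical_df n V u - pr mu (lower_orthant u)| <= e.

Let nR0 : 0 < n%:R :> R. Proof. by rewrite ltr0n. Qed.

(** z and V are ordered alike, so rank / n is the empirical distribution function of V at the point
    with entry V_k in coordinate i and 1 elsewhere. The orthant of that point has mass
    [tnth (V k) i] by uniformity. *)
Let rank_error i (k : 'I_n) : `|(rank z i k)%:R / n%:R - tnth (V k) i| <= e.
Proof.
pose u := [tuple if j == i then tnth (V k) i else 1 | j < m].
have cu : cube u.
  by move=> j; rewrite tnth_mktuple; case: ifP => _; [exact: V01|rewrite ler01 lexx].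
have := Ve u; congr (`|_ - _| <= e).
  rewrite /empirical_df; congr (_ / _).
  rewrite /rank /sample_count -sum1_card natr_sum [RHS]big_mkcond; apply: eq_bigr => l _.
  rewrite inE order_zV indicE; case: ifPn => h.
    rewrite mem_set// => j; rewrite tnth_mktuple; case: eqP => [-> //|_].
    by case/andP: (V01 l j).
  rewrite memNset// => /(_ i); rewrite tnth_mktuple eqxx => h'.
  by rewrite h' in h.
have mc := @measurable_cube R m.
rewrite -[RHS](mum i (V01 k i)); apply: (pr_eq_on mc _ _ mu1).
- exact: measurable_lower_orthant.
- exact: (measurable_tnth_preimage i (measurable_setle _)).
apply/seteqP; split => x [h cx]; split => //.
  by have := h i; rewrite tnth_mktuple eqxx.
move=> j; rewrite tnth_mktuple; case: eqP => [-> //|_].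
by case/andP: (cx j).
Qed.

Let clamp_le_bool (x : R) : clamp x <= (0 < x)%R%:R.
Proof. by case: ltP => h; [exact: clamp_le1|rewrite clamp_lt0]. Qed.

Let bool_le_clamp (x : R) : (1 <= x)%R%:R <= clamp x.
Proof. by have [h|h] := leP 1 x; [rewrite clamp_gt1|exact: clamp_ge0]. Qed.

Let prod_bool (x u : m.-tuple R) : \prod_i (tnth x i <= tnth u i)%R%:R = \1_(lower_orthant u) x :> R.
Proof.
rewrite indicE; case: (boolP (x \in _)) => [/set_mem hk|hk]; first by rewrite big1// => i _; rewrite hk.
have /existsP[i hi] : [exists i, ~~ (tnth x i <= tnth u i)].
  rewrite -negb_forall; apply: contraNN hk => /forallP hk; apply/mem_set => i; exact: hk.
by rewrite (bigD1 i)//= (negbTE hi) mul0r.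
Qed.

Let AE u : cube u -> A u = pr mu (lower_orthant u).
Proof. by move=> cu; have [[_ h] _] := is_copula_measure cA; rewrite /pr h. Qed.

(** By [rank_error] the product of clamps lies between the indicators of the orthants with corners u
    - e and u + 1/n + e, both evaluated at V_k. The empirical error adds e, and shifting the corner
    of an orthant by delta changes its mass by at most m delta. *)
Lemma empirical_copula_error u : cube u ->
  `|empirical_copula n z u - A u| <= m.+1%:R * e + m%:R / n%:R.
Proof.
move=> cu; rewrite (empirical_copulaE n0 no_ties)// (AE cu).
have e0 : 0 <= e by exact: le_trans (normr_ge0 _) (Ve u).
have den : 0 <= n%:R^-1 + e by rewrite addr_ge0// invr_ge0 ltW.
have rankE i k : (rank_index z i k)%:R = (rank z i k)%:R - 1 :> R.
  by rewrite rank_indexE -natr1 addrK.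
have up : (\sum_(k < n) \prod_i clamp (n%:R * tnth u i - (rank_index z i k)%:R)) / n%:R <=
    empirical_df n V [tuple tnth u i + (n%:R^-1 + e) | i < m].
  rewrite /empirical_df ler_pM2r ?invr_gt0//; apply: ler_sum => k _; rewrite -prod_bool.
  apply: ler_prod => i _; rewrite clamp_ge0 /=; apply: le_trans (clamp_le_bool _) _.
  rewrite ler_nat; case: ltP => //; rewrite rankE tnth_mktuple => h; rewrite lt0b.
  have /ler_normlP[h1 _] := rank_error i k.
  have : (rank z i k)%:R / n%:R <= tnth u i + n%:R^-1.
    by rewrite ler_pdivrMr// mulrDl mulVf ?gt_eqF// mulrC; lra.
  lra.
have down : empirical_df n V [tuple tnth u i - e | i < m] <=
    (\sum_(k < n) \prod_i clamp (n%:R * tnth u i - (rank_index z i k)%:R)) / n%:R.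
  rewrite /empirical_df ler_pM2r ?invr_gt0//; apply: ler_sum => k _; rewrite -prod_bool.
  apply: ler_prod => i _; rewrite ler0n /=; apply: le_trans (bool_le_clamp _).
  rewrite ler_nat tnth_mktuple; case: leP => // h; rewrite lt0b rankE.
  have /ler_normlP[_ h1] := rank_error i k.
  have : (rank z i k)%:R / n%:R <= tnth u i by lra.
  by rewrite ler_pdivrMr// mulrC; lra.
have /ler_normlP[_ u1] := Ve [tuple tnth u i + (n%:R^-1 + e) | i < m].
have /ler_normlP[d1 _] := Ve [tuple tnth u i - e | i < m].
have u2 := lower_orthant_shift mu1 mum u den.
have := lower_orthant_shift mu1 mum [tuple tnth u i - e | i < m] e0.
rewrite (_ : [tuple tnth [tuple tnth u i - e | i < m] i + e | i < m] = u); last first.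
  by apply: eq_from_tnth => i; rewrite !tnth_mktuple subrK.
move=> d2; rewrite mulrDr in u2; rewrite -natr1 mulrDl mul1r.
have mn : 0 <= m%:R / n%:R :> R by rewrite divr_ge0.
by apply/ler_normlP; split; lra.
Qed.

End empirical_copula_error.

(** * Transformed samples *)

Section atomless_probability_integral_transform.
Context {R : realType}.

Let df (mu : probability R R) (s : R) := pr mu [set x | x <= s].

(** A down-closed set is an increasing union of closed half-lines with end points in it. The cases
    are no upper bound, a supremum in the set and a supremum outside it. *)
Lemma pr_down_closed_le (mu : probability R R) (D : set R) t : measurable D -> 0 <= t ->
  (forall x y, D x -> y <= x -> D y) -> (forall x, D x -> df mu x <= t) -> pr mu D <= t.
Proof.
move=> mD t0 dD Dt.
have seqD (x : R^nat) : nondecreasing_seq x -> (forall n, D (x n)) ->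
    D `<=` \bigcup_n [set y | y <= x n] -> pr mu D <= t.
  move=> ndx Dx Dux; have DE : D = \bigcup_n [set y | y <= x n].
    by apply/seteqP; split => // y [n _ /= yx]; exact: dD (Dx n) yx.
  have : pr mu [set y | y <= x n] @[n --> \oo] --> pr mu D.
    rewrite DE; apply: pr_bigcup_cvg => [n|m n mn]; first exact: measurable_setle.
    by apply/subsetPset => y /= /le_trans; apply; exact: ndx.
  move=> cv; rewrite -(cvg_lim _ cv)//; apply: limr_le; first by apply/cvg_ex; eexists; exact: cv.
  by apply: nearW => n; exact: Dt.
have [->|/set0P D0] := eqVneq D set0; first by rewrite pr0.
have [[b ub]|nub] := pselect (has_ubound D); last first.
  apply: (seqD (fun n => n%:R)) => [m n|n|y Dy]; first by rewrite ler_nat.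
    apply: contrapT => nD; apply: nub; exists n%:R => y Dy.
    by rewrite leNgt; apply/negP => ny; apply: nD; exact: dD Dy (ltW ny).
  by exists (Num.truncn `|y|).+1 => //=; rewrite (le_trans (ler_norm _))// ltW// truncnS_gt.
have sD : has_sup D by split => //; exists b.
have [Ds|nDs] := pselect (D (sup D)).
  apply: (seqD (fun=> sup D)) => // y Dy; exists 0%N => //=; exact: ub_le_sup (proj2 sD) _ Dy.
have lts y : D y -> y < sup D.
  move=> Dy; rewrite lt_neqAle (ub_le_sup (proj2 sD) Dy) andbT.
  by apply: contra_notN nDs => /eqP <-.
apply: (seqD (fun n => sup D - n.+1%:R^-1)) => [m n mn|n|y Dy].
- by rewrite lerD2l lerN2 lef_pV2 ?posrE// ler_nat.
- have [|y Dy sy] := sup_adherent (_ : 0 < n.+1%:R^-1) sD; first by rewrite invr_gt0.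
  exact: dD Dy (ltW sy).
- exists (Num.truncn (sup D - y)^-1) => //=.
  have yD : 0 < sup D - y by rewrite subr_gt0 lts.
  rewrite lerBrDr -lerBrDl -[leRHS]invrK lef_pV2 ?posrE ?invr_gt0//.
  by apply: ltW; exact: truncnS_gt.
Qed.

Variable mu : probability R R.
Hypothesis atomless : forall s, pr mu [set s] = 0.

Let ndf : {homo df mu : x y / x <= y}.
Proof. by move=> x y xy; apply: le_pr; [exact: measurable_setle..|move=> z /= /le_trans; exact]. Qed.

Lemma measurable_df : measurable_fun setT (df mu).
Proof. exact: nondecreasing_measurable. Qed.

(** The set where the distribution function is at most t is down-closed, which bounds its mass by t.
    Its complement is down-closed after the reflection x to -x; there the distribution function of
    the reflected law is P(X >= -x), equal to P(X > -x) for lack of atoms, and this gives the bound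
    1 - t. *)
Lemma atomless_df_uniform t : 0 <= t <= 1 -> pr mu [set x | df mu x <= t] = t.
Proof.
move=> /andP[t0 t1].
have mD : measurable [set x | df mu x <= t].
  exact: (measurable_set_le (f := df mu) (g := cst t) measurable_df).
apply/eqP; rewrite eq_le; apply/andP; split.
  apply: pr_down_closed_le => // x y /= xt yx; exact: le_trans (ndf yx) xt.
rewrite -[leLHS](subKr 1) -[leRHS](subKr 1) lerD2l lerN2 -prC//.
have mN : measurable_fun setT (fun x : R => - x) by exact: oppr_measurable.
rewrite (_ : pr mu _ = pr (law mu mN) [set x | t < df mu (- x)]); last first.
  by rewrite pr_law; congr pr; apply/seteqP; split => x /=; rewrite opprK; [move/negP; rewrite -ltNge|rewrite ltNge => /negP].
have mDN : measurable_fun setT (fun x : R => df mu (- x)).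
  by apply: measurableT_comp mN; exact: measurable_df.
apply: pr_down_closed_le => [||x y /= tx yx|x /= tx].
- exact: (@measurable_set_lt _ _ _ (cst t) _ (measurable_cst t) mDN).
- by rewrite subr_ge0.
- by apply: (lt_le_trans tx); apply: ndf; rewrite lerN2.
rewrite /df pr_law.
have -> : (fun x0 : R => - x0) @^-1` [set x0 | x0 <= x] = ~` ([set y | y <= - x] `\` [set - x]).
  apply/seteqP; split => y /=.
    by rewrite lerNl => xy [yx]; apply; apply/eqP; rewrite eq_le yx.
  move=> h; rewrite lerNl leNgt; apply/negP => yx; apply: h; split; first exact: ltW.
  by move=> yE; move: yx; rewrite yE ltxx.
rewrite prC; last by apply: measurableD => //; exact: measurable_setle.
rewrite prD//; last by move=> y /= ->.
  by rewrite atomless subr0 lerD2l lerN2 ltW.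
exact: measurable_setle.
Qed.

End atomless_probability_integral_transform.

Section continuous_margins.
Context {R : realType} (disp : measure_display) (Omega : measurableType disp).
Variables (P : probability Omega R) (m : nat) (X : {RV P >-> m.-tuple R}).

Lemma measurable_coordinate (i : 'I_m) : measurable_fun setT (fun w => tnth (X w) i).
Proof. by apply: (measurableT_comp (f := fun x : m.-tuple R => tnth x i)) => //; exact: measurable_tnth. Qed.

Lemma measurable_coordinate_set (i : 'I_m) (B : set R) : measurable B ->
  measurable [set w | B (tnth (X w) i)].
Proof. by move=> mB; rewrite -[X in measurable X]setTI; exact: measurable_coordinate. Qed.

Hypothesis cX : continuous_df X.

(** Continuity is assumed for the joint distribution function only, so the other coordinates are
    first kept below N. The truncated event is dominated by increments of that function in
    coordinate i alone, which vanish in the limit; then N grows. *)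
Lemma continuous_df_atomless i t : pr P [set w | tnth (X w) i = t] = 0.
Proof.
pose E (N : nat) := [set w | forall j, if j == i then tnth (X w) j = t else tnth (X w) j <= N%:R].
pose x (N : nat) (s : R) : m.-tuple R := [tuple if j == i then s else N%:R | j < m].
have mX u : measurable (X @^-1` lower_orthant u).
  by rewrite -[Y in measurable Y]setTI; apply: measurable_funPT => //; exact: measurable_lower_orthant.
have mE N : measurable (E N).
  apply: (@measurable_forall _ _ _ (fun j w => if j == i then tnth (X w) j = t else tnth (X w) j <= N%:R)) => j.
  have [_|_] := boolP (j == i); first exact: (measurable_coordinate_set j (measurable_set1 t)).
  exact: (measurable_coordinate_set j (measurable_setle _)).
have E_le N s : s < t -> pr P (E N) <= joint_df X (x N t) - joint_df X (x N s).
  move=> st; rewrite /joint_df -/(pr P _) -/(pr P (_ @^-1` lower_orthant (x N s))) -prD//.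
    apply: le_pr; [exact: mE|exact: measurableD|] => w Ew; split.
      move=> j; rewrite tnth_mktuple; have := Ew j; case: eqP => [_ ->//|_]; exact.
    move=> /(_ i); rewrite tnth_mktuple eqxx; have := Ew i; rewrite eqxx => ->.
    by rewrite leNgt st.
  move=> w h j; have := h j; rewrite !tnth_mktuple; case: eqP => // _ /le_trans; apply.
  exact: ltW.
have E0 N : pr P (E N) = 0.
  apply/eqP; rewrite eq_le pr_ge0 andbT; apply/ler_addgt0Pr => e e0; rewrite add0r.
  pose row s : 'rV[R]_m := \row_j tnth (x N s) j.
  have rowE s : [tuple row s ord0 j | j < m] = x N s.
    by apply: eq_from_tnth => j; rewrite tnth_mktuple mxE.
  have /cvgrPdist_le/(_ _ e0)/nbhs_ballP[r /= r0 hr] := @cX (row t).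
  have tr : t - r / 2 < t by rewrite ltrBlDr ltrDl divr_gt0.
  apply: le_trans (E_le N _ tr) _; rewrite -!rowE; apply: le_trans (ler_norm _) _; apply: hr.
  split => // a j; rewrite !mxE !tnth_mktuple; case: ifP => _; last exact: ballxx.
  by rewrite /ball /= opprB addrCA subrr addr0 ger0_norm ?divr_ge0 ?ltW// ltr_pdivrMr//; lra.
have mt : measurable [set w | tnth (X w) i = t].
  exact: (measurable_coordinate_set i (measurable_set1 t)).
have : pr P (E N) @[N --> \oo] --> pr P (\bigcup_N E N).
  apply: pr_bigcup_cvg => // N N' NN; apply/subsetPset => w Ew j; have := Ew j.
  by case: ifP => // _ /le_trans; apply; rewrite ler_nat.
rewrite (_ : (fun N => pr P (E N)) = fun=> 0); last by apply/funext => N; exact: E0.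
move=> /cvg_lim => /(_ (@norm_hausdorff _ _)); rewrite lim_cst// => h.
apply/eqP; rewrite eq_le pr_ge0 andbT {}h; apply: le_pr => //; first exact: bigcupT_measurable.
move=> w wt; exists (\sum_j (Num.truncn `|tnth (X w) j|).+1)%N => // j.
case: eqP => [-> //|_]; rewrite (bigD1 j)//= natrD (le_trans (ler_norm _))//.
by rewrite (le_trans (ltW (truncnS_gt _)))// lerDl.
Qed.

End continuous_margins.

Section sample_transform.
Context {R : realType} (disp : measure_display) (Omega : measurableType disp).
Variables (P : probability Omega R) (m : nat).
Variables (XY : {RV P >-> m.-tuple R}) (Z : nat -> {RV P >-> m.-tuple R}) (A : m.-tuple R -> R).
Hypotheses (hZ : random_sample XY Z) (cXY : continuous_df XY) (uA : underlying_copula XY A).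

Let F i := margin_df XY i.

Let F_mono i s t : s <= t -> F i s <= F i t.
Proof.
by move=> st; apply: le_pr; [exact: (measurable_coordinate_set XY i (measurable_setle _))..|
  move=> w /= /le_trans; exact].
Qed.

Let F01 i t : 0 <= F i t <= 1.
Proof.
apply/andP; split; first exact: pr_ge0.
exact: (pr_le1 P (measurable_coordinate_set XY i (measurable_setle t))).
Qed.

Let mF i : measurable_fun setT (F i).
Proof. by apply: nondecreasing_measurable => // s t; exact: F_mono. Qed.

Definition margin_transform (x : m.-tuple R) : m.-tuple R := [tuple F i (tnth x i) | i < m].

Lemma measurable_margin_transform : measurable_fun setT margin_transform.
Proof.
apply/measurable_fun_tnthP => i.
rewrite (_ : _ \o _ = F i \o (fun x : m.-tuple R => tnth x i)).
  by apply: measurableT_comp => //; exact: measurable_tnth.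
by apply/funext => x; rewrite /= tnth_mktuple.
Qed.

Lemma margin_transform_cube x : cube (margin_transform x).
Proof. by move=> i; rewrite tnth_mktuple. Qed.

Lemma le_margin_transform x y i : tnth x i <= tnth y i ->
  tnth (margin_transform x) i <= tnth (margin_transform y) i.
Proof. by move=> xy; rewrite !tnth_mktuple F_mono. Qed.

Let mphiX : measurable_fun setT (fun w => margin_transform (XY w)).
Proof. by apply: measurableT_comp => //; exact: measurable_margin_transform. Qed.

Let nu := law P mphiX.

Let F_uniform i t : 0 <= t <= 1 -> pr P [set w | F i (tnth (XY w) i) <= t] = t.
Proof.
move=> t01; have := @atomless_df_uniform _ (law P (measurable_coordinate XY i)).
apply => //; move=> s; rewrite pr_law; exact: (continuous_df_atomless cXY i s).
Qed.

Let num j t : 0 <= t <= 1 -> pr nu [set x | tnth x j <= t] = t.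
Proof.
move=> t01; rewrite pr_law -[RHS](F_uniform j t01); congr pr.
by apply/seteqP; split => w /=; rewrite tnth_mktuple.
Qed.

Let nu1 : pr nu (@cube R m) = 1.
Proof.
rewrite pr_law -[RHS](prT P); congr pr; apply/seteqP; split => // w _.
exact: margin_transform_cube.
Qed.

(** F_i(X_i) <= F_i(x_i) is implied by X_i <= x_i, and both events have probability F_i(x_i), so
    they differ by a null set. This settles the orthants whose corners are values of the
    transform. *)
Let nu_transform x : pr nu (lower_orthant (margin_transform x)) = A (margin_transform x).
Proof.
have [_ hA] := uA; rewrite pr_law -[RHS](hA x) /joint_df -/(pr P _).
have mo u : measurable (XY @^-1` lower_orthant u).
  by rewrite -[X in measurable X]setTI; apply: measurable_funPT => //; exact: measurable_lower_orthant.
have mpo u : measurable ((fun w => margin_transform (XY w)) @^-1` lower_orthant u).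
  by rewrite -[X in measurable X]setTI; apply: mphiX => //; exact: measurable_lower_orthant.
pose Q i := [set w | F i (tnth (XY w) i) <= F i (tnth x i)] `\` [set w | tnth (XY w) i <= tnth x i].
have mQ1 i : measurable [set w | F i (tnth (XY w) i) <= F i (tnth x i)].
  apply: (measurable_set_le (f := fun w => F i (tnth (XY w) i)) (g := cst (F i (tnth x i)))) => //.
  by apply: measurableT_comp => //; exact: measurable_coordinate.
have mQ2 i : measurable [set w | tnth (XY w) i <= tnth x i].
  exact: (measurable_coordinate_set XY i (measurable_setle _)).
have mQ i : measurable (Q i) by exact: measurableD.
have Q0 i : pr P (Q i) = 0.
  by rewrite prD//; [rewrite F_uniform// subrr|move=> w /= /F_mono; exact].
apply/eqP; rewrite eq_le; apply/andP; split; last first.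
  by apply: le_pr => // w xw i; exact: le_margin_transform.
apply: (@le_trans _ _ (pr P (XY @^-1` lower_orthant x `|` [set w | exists i, Q i w]))).
  apply: le_pr => //; first by apply: measurableU => //; exact: measurable_exists.
  move=> w wx; apply: contrapT => /not_orP[nx nQ]; apply: nx => i.
  apply: contrapT => h; apply: nQ; exists i; split => //.
  by have := wx i; rewrite !tnth_mktuple.
apply: le_trans (prU_le _ (mo x) (measurable_exists mQ)) _.
rewrite gerDl (le_trans (pr_exists_le P mQ))// big1//.
Qed.

(* F_i (X_i) is uniform, so it charges every neighbourhood: its range is dense. *)
Let near_transform u (delta : R) : cube u -> 0 < delta ->
  exists x, forall i, `|tnth (margin_transform x) i - tnth u i| <= delta.
Proof.
move=> cu d0; have h i : exists t, `|F i t - tnth u i| <= delta.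
  apply: contrapT => nh.
  have : 0 < pr nu [set x | tnth u i - delta < tnth x i <= tnth u i + delta].
    rewrite (margin_oc nu1 num); last by lra.
    have /andP[u0 u1] := cu i; rewrite subr_gt0.
    have [h1|h1] := leP (tnth u i - delta) 0.
      rewrite (clamp_lt0 h1); have [h2|h2] := leP 1 (tnth u i + delta); first by rewrite clamp_gt1.
      by rewrite clamp_id//; [lra|apply/andP; split; lra].
    rewrite clamp_id; last by apply/andP; split; lra.
    have [h2|h2] := leP 1 (tnth u i + delta); first by rewrite clamp_gt1//; lra.
    by rewrite clamp_id//; [lra|apply/andP; split; lra].
  rewrite (_ : pr nu _ = 0) ?ltxx// -(pr0 P) pr_law; congr pr; apply/seteqP; split => // w.
  rewrite /= tnth_mktuple => /andP[h1 h2]; apply: nh; exists (tnth (XY w) i).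
  by apply/ler_normlP; split; lra.
have /choice[t ht] := h; exists [tuple t i | i < m] => i.
by rewrite !tnth_mktuple.
Qed.

(** The values of the transform are dense in the cube, and orthant masses are Lipschitz in the
    corner for both measures, so [nu_transform] extends to all corners. *)
Let nu_df : has_df_on_cube A nu.
Proof.
split; first by rewrite (prE nu (@measurable_cube R m)) nu1.
have [cA _] := uA; have [[hA1 hA] hAm] := is_copula_measure cA.
have A1 : pr (copula_measure A) (@cube R m) = 1 by rewrite /pr hA1.
move=> u cu; rewrite (prE nu (measurable_lower_orthant u)); congr EFin.
apply/eqP; rewrite -subr_eq0 -normr_le0; apply/ler_addgt0Pr => e e0; rewrite add0r.
(* Two Lipschitz errors of m times the distance must fit into e. *)
have m1 : 0 < (2 * m.+1%:R : R) by rewrite mulr_gt0.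
have [x hx] := near_transform cu (divr_gt0 e0 m1).
have hx' i : `|tnth u i - tnth (margin_transform x) i| <= e / (2 * m.+1%:R) by rewrite distrC.
have de : 0 <= e / (2 * m.+1%:R) by rewrite divr_ge0// ltW.
have h1 := lower_orthant_lipschitz nu1 num de hx'.
have h2 := lower_orthant_lipschitz A1 hAm de hx.
have AE v : cube v -> pr (copula_measure A) (lower_orthant v) = A v by move=> cv; rewrite /pr hA.
rewrite nu_transform in h1; rewrite (AE _ (margin_transform_cube x)) (AE _ cu) in h2.
have -> : pr nu (lower_orthant u) - A u = (pr nu (lower_orthant u) - A (margin_transform x)) +
  (A (margin_transform x) - A u) by rewrite addrA subrK.
rewrite (le_trans (ler_normD _ _))// (le_trans (lerD h1 h2))//.
have qE : 2 * m.+1%:R * (e / (2 * m.+1%:R)) = e by field; rewrite nat1r pnatr_eq0.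
have : m%:R * (e / (2 * m.+1%:R)) <= m.+1%:R * (e / (2 * m.+1%:R)) by rewrite ler_wpM2r// ler_nat.
by move: qE; set q := e / _; lra.
Qed.

Lemma pr_margin_transform k (E : set (m.-tuple R)) : measurable E ->
  pr P [set w | E (margin_transform (Z k w))] = pr (copula_measure A) E.
Proof.
move=> mE; rewrite [RHS]/pr (copula_measureE nu_df mE) -/(pr nu E) pr_law.
have [_ /(_ k (margin_transform @^-1` E)) h] := hZ.
have mpE : measurable (margin_transform @^-1` E).
  by rewrite -[X in measurable X]setTI; exact: measurable_margin_transform.
by have := h mpE => /(congr1 fine).
Qed.

Lemma pr_sample_transform (s : seq nat) (E : nat -> set (m.-tuple R)) : uniq s ->
  (forall k, measurable (E k)) ->
  pr P [set w | forall k, k \in s -> E k (margin_transform (Z k w))] =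
  \prod_(k <- s) pr (copula_measure A) (E k).
Proof.
move=> us mE; have [/(_ [fset k in s]%fset (fun k => margin_transform @^-1` E k)) h _] := hZ.
have mpE k : measurable (margin_transform @^-1` E k).
  by rewrite -[X in measurable X]setTI; exact: measurable_margin_transform.
apply: EFin_inj; transitivity (P (\bigcap_(k in [set` [fset k in s]%fset]) (Z k @^-1` (margin_transform @^-1` E k)))).
  rewrite -prE.
    congr (P _); apply/seteqP; split => w hw k; first by move=> /=; rewrite in_fset; exact: hw.
    by move=> ks; apply: hw; rewrite /= in_fset.
  rewrite (_ : [set w | _] = \bigcap_(k in [set` s]) (Z k @^-1` (margin_transform @^-1` E k))) //.
  apply: fin_bigcap_measurable => // k _.
  by rewrite -[X in measurable X]setTI; apply: measurable_funPT => //; exact: mpE.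
rewrite h//= -prodEFin (perm_big s)/=; last first.
  by apply: uniq_perm => // [|k]; [exact: fset_uniq|rewrite in_fset].
apply: eq_bigr => k _; rewrite -(pr_margin_transform k (mE k)); apply: prE.
by rewrite -[X in measurable X]setTI; apply: measurable_funPT => //; exact: mpE.
Qed.

Let mV k : measurable_fun setT (fun w => margin_transform (Z k w)).
Proof. by apply: measurableT_comp => //; exact: measurable_margin_transform. Qed.

Let mVi k i : measurable_fun setT (fun w => tnth (margin_transform (Z k w)) i).
Proof. by apply: (measurableT_comp (f := fun x : m.-tuple R => tnth x i)) => //; exact: measurable_tnth. Qed.

Lemma measurable_sample_transform k (E : set (m.-tuple R)) : measurable E ->
  measurable [set w | E (margin_transform (Z k w))].
Proof. by move=> mE; rewrite -[X in measurable X]setTI; exact: mV. Qed.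

Let measurable_tie k l i :
  measurable [set w | tnth (margin_transform (Z k w)) i = tnth (margin_transform (Z l w)) i].
Proof.
have h1 := measurable_set_le (mVi k i) (mVi l i); have h2 := measurable_set_le (mVi l i) (mVi k i).
rewrite (_ : [set w | _] =
  [set w | tnth (margin_transform (Z k w)) i <= tnth (margin_transform (Z l w)) i] `&`
  [set w | tnth (margin_transform (Z l w)) i <= tnth (margin_transform (Z k w)) i]).
  exact: measurableI.
apply/seteqP; split => [w /= ->|w /= [h3 h4]]; first by rewrite lexx.
by apply/eqP; rewrite eq_le h3.
Qed.

(* Both coordinates lie in the same of M strips with probability at most 1 / M. *)
Lemma pr_tie k l i : k != l ->
  pr P [set w | tnth (margin_transform (Z k w)) i = tnth (margin_transform (Z l w)) i] = 0.
Proof.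
move=> kl; have [cA _] := uA; have [[hA1 _] hAm] := is_copula_measure cA.
have A1 : pr (copula_measure A) (@cube R m) = 1 by rewrite /pr hA1.
set T := [set w | _]; have mT : measurable T by exact: measurable_tie.
apply/eqP; rewrite eq_le pr_ge0 andbT; apply/ler_addgt0Pr => e e0; rewrite add0r.
pose M := (Num.truncn e^-1).+1; have M0 : (0 < M)%N by [].
have MR : 0 < M%:R :> R by rewrite ltr0n.
pose c (a : 'I_M) := [set x : m.-tuple R | a%:R / M%:R < tnth x i <= a.+1%:R / M%:R].
have mc a : measurable (c a) by exact: measurable_margin_oc.
have prc a : pr (copula_measure A) (c a) <= M%:R^-1.
  apply: le_trans (margin_oc_le A1 hAm i _) _; first by rewrite ler_pM2r ?invr_gt0// ler_nat.
  by rewrite -mulrBl -natr1 addrAC subrr add0r mul1r.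
pose Q a := [set w | forall j, j \in [:: k; l] -> c a (margin_transform (Z j w))].
have mQ a : measurable (Q a).
  rewrite (_ : Q a = \bigcap_(j in [set` [:: k; l]]) [set w | c a (margin_transform (Z j w))])//.
  by apply: fin_bigcap_measurable => // j _; exact: measurable_sample_transform.
have prQ a : pr P (Q a) <= M%:R^-1 * M%:R^-1.
  rewrite (pr_sample_transform (E := fun=> c a))//; last by rewrite /= inE kl.
  by rewrite big_cons big_seq1 ler_pM ?pr_ge0.
have mfull : measurable [set x : m.-tuple R | 0 < tnth x i <= 1] by exact: measurable_margin_oc.
have full : pr P [set w | 0 < tnth (margin_transform (Z k w)) i <= 1] = 1.
  rewrite (pr_margin_transform k mfull) (margin_oc A1 hAm)//.
  by rewrite clamp_gt1// clamp_lt0// subr0.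
rewrite -(pr_setI1 mT (measurable_sample_transform k mfull) full).
apply: (@le_trans _ _ (\sum_(a < M) pr P (Q a))).
  apply: le_trans (pr_exists_le P mQ).
  apply: le_pr; [|exact: measurable_exists|].
    by apply: measurableI => //; exact: measurable_sample_transform.
  move=> w [Tw w01]; have [|a /(_ ord0)] := @half_open_cell_cover R M M0 1 [tuple tnth (margin_transform (Z k w)) i].
    by move=> j; rewrite (ord1 j) (tnth_nth 0).
  move=> ak; exists (tnth a ord0) => j.
  have ha : c (tnth a ord0) (margin_transform (Z k w)) by exact: ak.
  rewrite !inE => /orP[] /eqP ->; first exact: ha.
  by move: ha; rewrite /c /= Tw.
apply: (@le_trans _ _ (\sum_(a < M) M%:R^-1 * M%:R^-1)); first by apply: ler_sum => a _; exact: prQ.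
rewrite sumr_const card_ord -[leLHS]mulr_natl mulrA mulfV ?gt_eqF// mul1r.
rewrite -[leRHS]invrK lef_pV2 ?posrE ?invr_gt0//; exact: ltW (truncnS_gt _).
Qed.

Lemma ae_no_ties : {ae P, forall w, forall k l i, k != l ->
  tnth (margin_transform (Z k w)) i != tnth (margin_transform (Z l w)) i}.
Proof.
apply: ae_foralln => k; apply: ae_foralln => l; apply: filter_forall => i.
have [->|kl] := eqVneq k l; first exact: aeW.
have mT := measurable_tie k l i.
have : pr P (~` [set w | tnth (margin_transform (Z k w)) i = tnth (margin_transform (Z l w)) i]) = 1.
  by rewrite prC// pr_tie// subr0.
move=> /(ae_pr1 (measurableC mT)); apply: filterS => w /= h _.
by apply/eqP.
Qed.

End sample_transform.

(** * Almost sure rate *)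

Section binomial_tail.
Context {R : realType} d (T : measurableType d) (mu : probability T R).
Variables (n : nat) (E : 'I_n -> set T) (p : R).
Hypothesis mE : forall k, measurable (E k).
Hypothesis p01 : 0 <= p <= 1.
Hypothesis independent : forall b : {ffun 'I_n -> bool},
  pr mu [set w | forall k, (if b k then E k else ~` E k) w] = \prod_k (if b k then p else 1 - p).

Let pattern (b : {ffun 'I_n -> bool}) := [set w | forall k, (if b k then E k else ~` E k) w].

Let mpattern b : measurable (pattern b).
Proof.
apply: (@measurable_forall _ _ _ (fun k => if b k then E k else ~` E k)) => k.
by case: (b k) => //; exact: measurableC.
Qed.

Let tailE a : [set w | a <= \sum_k \1_(E k) w] =
  [set w | exists b : {ffun 'I_n -> bool}, (a <= \sum_k (b k)%:R :> R) /\ pattern b w].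
Proof.
have ind b w : pattern b w -> \sum_k \1_(E k) w = \sum_k (b k)%:R :> R.
  move=> bw; apply: eq_bigr => k _; rewrite indicE; have := bw k; case: (b k) => h.
    by rewrite mem_set.
  by rewrite memNset.
apply/seteqP; split => [w /= aw|w [b [ab bw]]]; last by rewrite /= (ind b).
pose b : {ffun 'I_n -> bool} := [ffun k => `[< E k w >]].
have bw : pattern b w by move=> k; rewrite ffunE; case: asboolP.
by exists b; rewrite -(ind b w bw).
Qed.

Let mtail' (a : R) (b : {ffun 'I_n -> bool}) : measurable [set w | (a <= \sum_k (b k)%:R) /\ pattern b w].
Proof.
have [h|h] := boolP (a <= \sum_k (b k)%:R).
  by rewrite (_ : [set w | _] = pattern b)//; apply/seteqP; split => [w []|].
by rewrite (_ : [set w | _] = set0)//; apply/seteqP; split => [w []|].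
Qed.

Lemma measurable_binomial_tail a : measurable [set w | a <= \sum_k \1_(E k) w :> R].
Proof. by rewrite tailE; exact: (measurable_exists (mtail' a)). Qed.

(* The sum over all patterns of the exponentially tilted products factorizes. *)
Lemma exponential_tail a h : 0 <= h ->
  pr mu [set w | a <= \sum_k \1_(E k) w] <= expR (n%:R * (p * (expR h - 1)) - h * a).
Proof.
move=> h0; have /andP[p0 p1] := p01; rewrite tailE.
apply: le_trans (pr_exists_le mu (mtail' a)) _.
apply: (@le_trans _ _ (\sum_(b : {ffun 'I_n -> bool})
    expR (- (h * a)) * \prod_k (if b k then expR h * p else 1 - p))).
  apply: ler_sum => b _.
  have P0 : 0 <= \prod_k (if b k then p else 1 - p).
    by apply: prodr_ge0 => k _; case: (b k) => //; rewrite subr_ge0.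
  have -> : \prod_k (if b k then expR h * p else 1 - p) =
      expR (h * \sum_k (b k)%:R) * \prod_k (if b k then p else 1 - p).
    rewrite mulr_sumr expR_sum -big_split /=; apply: eq_bigr => k _.
    by case: (b k); rewrite ?mulr1 // mulr0 expR0 mul1r.
  rewrite mulrA -expRD; have [ab|ab] := pselect (a <= \sum_k (b k)%:R).
    have -> : [set w | (a <= \sum_k (b k)%:R) /\ pattern b w] = pattern b.
      by apply/seteqP; split => [w []|].
    by rewrite independent ler_peMl// -[leLHS]expR0 ler_expR addrC -mulrBr mulr_ge0// subr_ge0.
  have -> : [set w | (a <= \sum_k (b k)%:R) /\ pattern b w] = set0.
    by apply/seteqP; split => [w []|].
  by rewrite pr0 mulr_ge0// expR_ge0.
rewrite -mulr_sumr -(bigA_distr_bigA (fun k (c : bool) => if c then expR h * p else 1 - p)) /=.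
under eq_bigr do rewrite big_bool /=.
rewrite prodr_const card_ord [X in _ <= expR X]addrC expRD ler_wpM2l ?expR_ge0//.
rewrite expRM_natl lerXn2r ?nnegrE ?expR_ge0//; first by rewrite addr_ge0 ?subr_ge0// mulr_ge0// expR_ge0.
by apply: le_trans (expR_ge1Dx _); rewrite mulrBr mulr1 (mulrC p); lra.
Qed.

(** From 1 - h <= exp(-h) one gets exp(h) <= 1 / (1 - h), and 1 / (1 - h) is at most 1 + h + 2 h ^ 2
    as long as 2 h <= 1. *)
Let expR_quadratic (h : R) : 0 <= h <= 4^-1 -> expR h - 1 - h <= 2 * h ^+ 2.
Proof.
move=> /andP[h0 h4]; have g0 := expR_gt0 h.
have h1 : expR h * (1 - h) <= 1.
  rewrite -[leRHS](expRxMexpNx_1 h) ler_wpM2l ?expR_ge0//.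
  by apply: le_trans (expR_ge1Dx _).
have h2 : 1 <= (1 + h + 2 * h ^+ 2) * (1 - h).
  have -> : (1 + h + 2 * h ^+ 2) * (1 - h) = 1 + h ^+ 2 * (1 - 2 * h) by ring.
  by rewrite lerDl mulr_ge0 ?sqr_ge0//; lra.
have h3 : expR h <= 1 + h + 2 * h ^+ 2.
  by rewrite -(@ler_pM2r _ (1 - h)); [exact: le_trans h1 h2|lra].
lra.
Qed.

Lemma binomial_tail e : 0 < e <= 1 ->
  pr mu [set w | n%:R * (p + e) <= \sum_k \1_(E k) w] <= expR (- (n%:R * e ^+ 2 / 8)).
Proof.
move=> /andP[e0 e1]; have /andP[p0 p1] := p01.
(* The tilt e / 4 minimizes 2 h ^ 2 - h e, with minimum - e ^ 2 / 8. *)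
have h0 : 0 <= e / 4 by rewrite divr_ge0// ltW.
apply: le_trans (exponential_tail _ h0) _; rewrite ler_expR.
have hq : expR (e / 4) - 1 - e / 4 <= 2 * (e / 4) ^+ 2.
  by apply: expR_quadratic; rewrite h0 /= ler_pdivrMr// mulVf.
have pq : p * (expR (e / 4) - 1 - e / 4) <= 2 * (e / 4) ^+ 2.
  apply: le_trans (_ : p * (2 * (e / 4) ^+ 2) <= _); first exact: ler_wpM2l.
  by rewrite ler_piMl// mulr_ge0// sqr_ge0.
have -> : n%:R * (p * (expR (e / 4) - 1)) - e / 4 * (n%:R * (p + e)) =
   n%:R * (p * (expR (e / 4) - 1 - e / 4) - e / 4 * e) by ring.
have -> : - (n%:R * e ^+ 2 / 8) = n%:R * (- (e ^+ 2 / 8)) by ring.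
rewrite ler_wpM2l//; move: pq; rewrite exprMn; lra.
Qed.

End binomial_tail.

(** * Uniform deviation of the empirical distribution function *)

Section uniform_deviation.
Context {R : realType} (disp : measure_display) (Omega : measurableType disp).
Variables (P : probability Omega R) (m : nat) (nu : probability (m.-tuple R) R).
Hypothesis nu1 : pr nu (@cube R m) = 1.
Hypothesis num : forall j t, 0 <= t <= 1 -> pr nu [set x | tnth x j <= t] = t.
Variable V : nat -> Omega -> m.-tuple R.
Hypothesis mV : forall k, measurable_fun setT (V k).
Hypothesis V01 : forall k w, cube (V k w).
Hypothesis V_iid : forall (s : seq nat) (E : nat -> set (m.-tuple R)), uniq s ->
  (forall k, measurable (E k)) ->
  pr P [set w | forall k, k \in s -> E k (V k w)] = \prod_(k <- s) pr nu (E k).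

Let mVE k (E : set (m.-tuple R)) : measurable E -> measurable [set w | E (V k w)].
Proof. by move=> mE; rewrite -[X in measurable X]setTI; exact: mV. Qed.

Let count (E : set (m.-tuple R)) n w : R := \sum_(k < n) \1_E (V k w).

Let countE (E : set (m.-tuple R)) n w : count E n w = \sum_(k < n) \1_([set w | E (V k w)]) w.
Proof. by apply: eq_bigr => k _; rewrite !indicE; congr (_%:R); apply/idP/idP => /set_mem h; exact/mem_set. Qed.

Let patterns (E : set (m.-tuple R)) n : measurable E -> forall b : {ffun 'I_n -> bool},
  pr P [set w | forall k : 'I_n, (if b k then [set w | E (V k w)] else ~` [set w | E (V k w)]) w] =
  \prod_k (if b k then pr nu E else 1 - pr nu E).
Proof.
(* The product formula takes a set for every natural index; indices from n on get the full space. *)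
move=> mE b; pose G k := if insub k is Some i then (if b i then E else ~` E) else setT.
have mG k : measurable (G k).
  by rewrite /G; case: insub => // i; case: (b i) => //; exact: measurableC.
have GE (i : 'I_n) : G i = if b i then E else ~` E by rewrite /G insubT//= => h; congr (if b _ then _ else _); exact: val_inj.
transitivity (pr P [set w | forall k, k \in iota 0 n -> G k (V k w)]).
  congr pr; apply/seteqP; split => w h k.
    rewrite mem_iota add0n /= => kn; have := h (Ordinal kn); rewrite (GE (Ordinal kn)).
    by case: (b _).
  have := h k; rewrite mem_iota add0n ltn_ord => /(_ isT); rewrite GE.
  by case: (b _).
rewrite V_iid ?iota_uniq// -[X in iota 0 X]subn0 -/(index_iota 0 n) big_mkord; apply: eq_bigr => i _.
by rewrite GE; case: (b i); rewrite ?prC.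
Qed.

Let tail (E : set (m.-tuple R)) n (e : R) : measurable E -> 0 < e <= 1 ->
  measurable [set w | n%:R * (pr nu E + e) <= count E n w] /\
  pr P [set w | n%:R * (pr nu E + e) <= count E n w] <= expR (- (n%:R * e ^+ 2 / 8)).
Proof.
move=> mE e01.
have -> : [set w | n%:R * (pr nu E + e) <= count E n w] =
    [set w | n%:R * (pr nu E + e) <= \sum_(k < n) \1_([set w | E (V k w)]) w].
  by apply/seteqP; split => w /=; rewrite countE.
split; first exact: (measurable_binomial_tail (fun k : 'I_n => mVE k mE)).
apply: (binomial_tail (fun k : 'I_n => mVE k mE)) => //; first by rewrite pr_ge0 pr_le1.
exact: patterns.
Qed.

(** A lower deviation for E is an upper deviation for its complement, so the one-sided tail bound
    serves both sides. *)
Let bad (E : set (m.-tuple R)) n (e : R) :=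
  [set w | n%:R * (pr nu E + e) <= count E n w] `|`
  [set w | n%:R * (pr nu (~` E) + e) <= count (~` E) n w].

Let pr_bad (E : set (m.-tuple R)) n (e : R) : measurable E -> 0 < e <= 1 ->
  measurable (bad E n e) /\ pr P (bad E n e) <= 2 * expR (- (n%:R * e ^+ 2 / 8)).
Proof.
move=> mE e01; have [m1 p1] := tail n mE e01; have [m2 p2] := tail n (measurableC mE) e01.
split; first exact: measurableU.
by apply: le_trans (prU_le _ m1 m2) _; lra.
Qed.

Let not_bad E n e w : measurable E -> (0 < n)%N -> ~ bad E n e w ->
  `|count E n w / n%:R - pr nu E| <= e.
Proof.
move=> mE n0 /not_orP[/negP h1 /negP h2]; have nR0 : 0 < n%:R :> R by rewrite ltr0n.
have cC : count (~` E) n w = n%:R - count E n w.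
  apply/eqP; rewrite eq_sym subr_eq /count -big_split /=; apply/eqP.
  rewrite -[LHS]mulr1 mulr_natl -[X in _ *+ X](card_ord n) -sumr_const; apply: eq_bigr => k _.
  rewrite !indicE in_setC; case: (_ \in _); rewrite ?addr0 ?add0r//.
move: h1 h2; rewrite -!ltNge cC prC// => h1 h2.
rewrite -(ler_pM2r nR0) -[X in _ * X <= _](gtr0_norm nR0) -normrM mulrBl divfK ?gt_eqF//.
by apply/ler_normlP; split; lra.
Qed.

Let grid_point n (g : {ffun 'I_m -> 'I_n.+1}) : m.-tuple R := [tuple (g i)%:R / n%:R | i < m].

Definition large_deviation n (e : R) : set Omega :=
  [set w | exists g : {ffun 'I_m -> 'I_n.+1}, bad (lower_orthant (grid_point g)) n e w].

Lemma measurable_large_deviation n e : 0 < e <= 1 -> measurable (large_deviation n e).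
Proof.
move=> e01; apply: measurable_exists => g.
by have [] := pr_bad n (@measurable_lower_orthant R m (grid_point g)) e01.
Qed.

Lemma pr_large_deviation n e : 0 < e <= 1 ->
  pr P (large_deviation n e) <= n.+1%:R ^+ m * (2 * expR (- (n%:R * e ^+ 2 / 8))).
Proof.
move=> e01; have h g := pr_bad n (@measurable_lower_orthant R m (@grid_point n g)) e01.
apply: le_trans (pr_exists_le P (fun g => proj1 (h g))) _.
apply: (@le_trans _ _ (\sum_(g : {ffun 'I_m -> 'I_n.+1}) (2 * expR (- (n%:R * e ^+ 2 / 8))))).
  by apply: ler_sum => g _; exact: proj2 (h g).
by rewrite sumr_const card_ffun !card_ord -[leLHS]mulr_natl natrX.
Qed.

Lemma empirical_df_error n e w : (0 < n)%N -> ~ large_deviation n e w -> 0 <= e -> forall u,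
  `|empirical_df n (fun k => V k w) u - pr nu (lower_orthant u)| <= e + m%:R / n%:R.
Proof.
move=> n0 nl e0 u; have nR0 : 0 < n%:R :> R by rewrite ltr0n.
have mc := @measurable_cube R m; have mo := @measurable_lower_orthant R m.
have mn : 0 <= m%:R / n%:R :> R by rewrite divr_ge0.
have [/existsP[i ui]|] := boolP [exists i, tnth u i < 0].
  have -> : pr nu (lower_orthant u) = 0.
    rewrite -(pr0 nu); apply: pr_eq_on nu1 _ => //.
    apply/seteqP; split => x [] //= /(_ i) xu /(_ i)/andP[x0 _].
    by move: (le_lt_trans x0 (le_lt_trans xu ui)); rewrite ltxx.
  rewrite /empirical_df big1 ?mul0r ?subrr ?normr0 ?addr_ge0// => k _.
  rewrite indicE memNset// => /(_ i) xu; have /andP[x0 _] := V01 k w i.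
  by move: (le_lt_trans x0 (le_lt_trans xu ui)); rewrite ltxx.
rewrite negb_exists => /forallP u0.
pose v := [tuple Num.min (tnth u i) 1 | i < m].
have vE x : cube x -> lower_orthant u x <-> lower_orthant v x.
  move=> cx; split => h i; have := h i; rewrite tnth_mktuple le_min.
    by move=> ->; case/andP: (cx i).
  by case/andP.
have -> : pr nu (lower_orthant u) = pr nu (lower_orthant v).
  by apply: pr_eq_on nu1 _ => //; apply/seteqP; split => x [xu cx]; split => //; apply/vE.
have -> : empirical_df n (fun k => V k w) u = empirical_df n (fun k => V k w) v.
  rewrite /empirical_df; congr (_ / _); apply: eq_bigr => k _; rewrite !indicE; congr (_%:R).
  congr (nat_of_bool _); apply/idP/idP => /set_mem h; apply/mem_set.
    by apply/vE.
  by apply/vE.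
have v0 i : 0 <= tnth v i by rewrite tnth_mktuple le_min ler01 andbT leNgt; exact: u0.
have v1 i : tnth v i <= 1 by rewrite tnth_mktuple ge_min lexx orbT.
pose a i := Num.truncn (n%:R * tnth v i).
have ha i : (a i)%:R <= n%:R * tnth v i < (a i).+1%:R by apply: truncn_itv; rewrite mulr_ge0.
have an i : (a i <= n)%N.
  by have /andP[h _] := ha i; rewrite -(ler_nat R) (le_trans h)// ler_piMr.
pose lo : {ffun 'I_m -> 'I_n.+1} := [ffun i => inord (a i)].
(* The minimum keeps the upper neighbour on the grid when the coordinate is 1. *)
pose hi : {ffun 'I_m -> 'I_n.+1} := [ffun i => inord (minn (a i).+1 n)].
have loE i : tnth (grid_point lo) i = (a i)%:R / n%:R by rewrite tnth_mktuple ffunE inordK// ltnS.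
have hiE i : tnth (grid_point hi) i = (minn (a i).+1 n)%:R / n%:R.
  by rewrite tnth_mktuple ffunE inordK// ltnS geq_minr.
have df_mono x y : (forall i, tnth x i <= tnth y i) ->
    empirical_df n (fun k => V k w) x <= empirical_df n (fun k => V k w) y.
  move=> xy; rewrite /empirical_df ler_pM2r ?invr_gt0//; apply: ler_sum => k _.
  rewrite !indicE ler_nat; case: (boolP (_ \in lower_orthant x)) => // /set_mem h.
  by rewrite mem_set// => i; exact: le_trans (h i) (xy i).
have grid g : `|empirical_df n (fun k => V k w) (grid_point g) - pr nu (lower_orthant (@grid_point n g))| <= e.
  apply: not_bad => // hb; apply: nl; by exists g.
have lo_v i : tnth (grid_point lo) i <= tnth v i.
  by rewrite loE ler_pdivrMr// mulrC; case/andP: (ha i).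
have v_hi i : tnth v i <= tnth (grid_point hi) i.
  rewrite hiE ler_pdivlMr// mulrC; case: leqP => _; last by rewrite ler_piMr.
  by apply: ltW; case/andP: (ha i).
have n1 : 0 <= n%:R^-1 :> R by rewrite invr_ge0 ltW.
have lipl := @lower_orthant_lipschitz _ _ _ nu1 num (grid_point lo) v _ n1.
have liph := @lower_orthant_lipschitz _ _ _ nu1 num (grid_point hi) v _ n1.
have lohi i : tnth (grid_point hi) i <= tnth (grid_point lo) i + n%:R^-1.
  by rewrite loE hiE -[X in _ + X]mul1r -mulrDl ler_pM2r ?invr_gt0// natr1 ler_nat geq_minl.
have /ler_normlP[l1 l2] : `|pr nu (lower_orthant (grid_point lo)) - pr nu (lower_orthant v)| <= m%:R / n%:R.
  by apply: lipl => i; have := lo_v i; have := v_hi i; have := lohi i => *; apply/ler_normlP; split; lra.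
have /ler_normlP[h1 h2] : `|pr nu (lower_orthant (grid_point hi)) - pr nu (lower_orthant v)| <= m%:R / n%:R.
  by apply: liph => i; have := lo_v i; have := v_hi i; have := lohi i => *; apply/ler_normlP; split; lra.
have d1 := df_mono _ _ lo_v; have d2 := df_mono _ _ v_hi.
have /ler_normlP[g1 g2] := grid lo; have /ler_normlP[g3 g4] := grid hi.
by apply/ler_normlP; split; lra.
Qed.

End uniform_deviation.

(** * Estimates for powers and exponentials *)

Section powers.
Context {R : realType}.

Lemma le_powR_near (kappa M : R) : 0 < kappa -> \forall n \near \oo, M <= n.+1%:R `^ kappa.
Proof.
move=> k0; pose a : R := Num.max M 0 `^ kappa^-1.
exists (Num.truncn a).+1 => // n /= hn.
have M0 : 0 <= Num.max M 0 by rewrite le_max lexx orbT.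
apply: (@le_trans _ _ (a `^ kappa)).
  by rewrite /a -powRrM mulVf ?gt_eqF// powRr1// le_max lexx.
apply: ge0_ler_powR; rewrite ?nnegrE ?powR_ge0 ?ltW//.
by rewrite (le_lt_trans (ltW (truncnS_gt a)))// ltr_nat ltnS.
Qed.

Lemma powRN_cvg0 (kappa : R) : 0 < kappa -> n.+1%:R `^ (- kappa) @[n --> \oo] --> (0 : R).
Proof.
move=> k0; apply/cvgr0Pnorm_le => e e0; have := le_powR_near e^-1 k0.
apply: filterS => n hn; rewrite ger0_norm ?powR_ge0// powRN.
by rewrite invf_ple ?posrE ?powR_gt0.
Qed.

Lemma sum_inv_sqr_le (N : nat) : \sum_(i < N) (i.+1%:R ^+ 2)^-1 <= 2 :> R.
Proof.
(* Strengthened so that the induction telescopes: 1 / x ^ 2 is at most 2 (1 / x - 1 / (x + 1)) for x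
   >= 1. *)
suff h : \sum_(i < N) (i.+1%:R ^+ 2)^-1 <= 2 * (1 - N.+1%:R^-1) :> R.
  by apply: le_trans h _; rewrite ler_piMr// gerBl.
elim: N => [|N IH]; first by rewrite big_ord0 invr1 subrr mulr0.
rewrite big_ord_recr /= (le_trans (lerD IH (lexx _)))//.
rewrite -[N.+2%:R]natr1; set x : R := N.+1%:R; have x1 : 1 <= x by rewrite /x ler1n.
have -> : 2 * (1 - (x + 1)^-1) = 2 * (1 - x^-1) + 2 * (x^-1 * (x + 1)^-1).
  by field; rewrite !gt_eqF//; lra.
rewrite lerD2l -[leLHS]mul1r ler_pdivrMr; last by rewrite exprn_gt0//; lra.
have -> : 2 * (x^-1 * (x + 1)^-1) * x ^+ 2 = 2 * x / (x + 1).
  by field; rewrite !gt_eqF//; lra.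
by rewrite ler_pdivlMr; lra.
Qed.

(** With delta (q + 1) >= m + 2, the term of order q + 1 of the exponential series already dominates
    a multiple of x ^ (m + 2) at x = n + 1. This absorbs the m-th power and leaves the summable
    factor 1 / x ^ 2; the constant 2 ^ m comes from n + 2 <= 2 x. *)
Lemma expRN_powR_le (delta : R) (m : nat) : 0 < delta -> exists2 K, 0 <= K &
  forall n, n.+2%:R ^+ m * expR (- (n.+1%:R `^ delta / 8)) <= K * (n.+1%:R ^+ 2)^-1.
Proof.
move=> d0; pose q := Num.truncn (m.+2%:R / delta).
have hq : m.+2%:R <= delta * q.+1%:R.
  by rewrite -ler_pdivrMl// mulrC ltW// truncnS_gt.
exists (2 ^+ m * (8 ^+ q.+1 * q.+1`!%:R)); first by rewrite !mulr_ge0 ?exprn_ge0.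
move=> n; set x : R := n.+1%:R; have x1 : 1 <= x by rewrite /x ler1n.
have x0 : 0 < x by lra.
have h1 : n.+2%:R ^+ m <= 2 ^+ m * x ^+ m.
  rewrite -exprMn lerXn2r ?nnegrE//; first by lra.
  by rewrite -[n.+2%:R]natr1 -/x; lra.
have y0 : 0 <= x `^ delta / 8 by rewrite divr_ge0 ?powR_ge0.
have h2 : expR (- (x `^ delta / 8)) <= 8 ^+ q.+1 * q.+1`!%:R * (x ^+ m.+2)^-1.
  have xq : x ^+ m.+2 <= (x `^ delta) ^+ q.+1.
    rewrite -[leRHS]powR_mulrn ?powR_ge0// -powRrM -[leLHS]powR_mulrn; last exact: ltW.
    exact: ler_powR.
  have := expR_ge1Dxn q y0; set f : R := q.+1`!%:R => h.
  have f0 : 0 < f by rewrite /f ltr0n fact_gt0.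
  have e8 : x ^+ m.+2 / (8 ^+ q.+1 * f) <= expR (x `^ delta / 8).
    apply: le_trans h; rewrite exprMn exprVn invfM mulrA.
    apply: (@le_trans _ _ ((x `^ delta) ^+ q.+1 / 8 ^+ q.+1 / f)); last by rewrite lerDr.
    by rewrite ler_pM2r ?invr_gt0// ler_pM2r// invr_gt0 exprn_gt0.
  rewrite expRN -[leRHS]invrK lef_pV2 ?posrE ?expR_gt0//; last first.
    by rewrite invr_gt0 mulr_gt0 ?invr_gt0 ?exprn_gt0// mulr_gt0 ?exprn_gt0.
  by rewrite invfM invrK mulrC.
apply: le_trans (ler_pM _ (expR_ge0 _) h1 h2) _; first exact: exprn_ge0.
rewrite le_eqVlt; apply/orP; left; apply/eqP.
rewrite !exprS; field; rewrite ?expf_eq0 ?gt_eqF ?andbF//.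
Qed.

End powers.

Section borel_cantelli_quadratic.
Context {R : realType} d (T : measurableType d) (P : probability T R).

Lemma ae_eventually_not (F : (set T)^nat) K : (forall n, measurable (F n)) -> 0 <= K ->
  (forall n, pr P (F n) <= K * (n.+1%:R ^+ 2)^-1) ->
  {ae P, forall w, exists N, forall n, (N <= n)%N -> ~ F n w}.
Proof.
move=> mF K0 FK; exists (lim_sup_set F); split.
- by apply: bigcapT_measurable => n; exact: bigcup_measurable.
- apply: lim_sup_set_cvg0 => //.
  apply: (@le_lt_trans _ _ (K * 2)%:E); last by rewrite ltry.
  apply: lime_le; first by apply: is_cvg_nneseries => n _ _; exact: measure_ge0.
  apply: nearW => N; rewrite big_mkord.
  rewrite (eq_bigr (fun i : 'I_N => (pr P (F i))%:E)); last by move=> i _; exact: prE.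
  rewrite sumEFin lee_fin.
  apply: (@le_trans _ _ (\sum_(i < N) K * (i.+1%:R ^+ 2)^-1)); first by apply: ler_sum => i _; exact: FK.
  by rewrite -mulr_sumr ler_wpM2l// sum_inv_sqr_le.
- move=> w nw n _; apply: contrapT => h; apply: nw; exists n => j nj Fj; apply: h; by exists j.
Qed.

End borel_cantelli_quadratic.

(** * Strong consistency of the estimator *)

Theorem theorem6p4 (R : realType) (d : nat) (d_gt0 : (0 < d)%N)
    (disp : measure_display) (Omega : measurableType disp)
    (P : probability Omega R)
    (XY : {RV P >-> d.+1.-tuple R}) (Z : nat -> {RV P >-> d.+1.-tuple R})
    (A : d.+1.-tuple R -> R) (s : R) :
  random_sample XY Z ->
  continuous_df XY ->
  underlying_copula XY A ->
  0 < s < (2 * d)%:R^-1 ->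
  let N (n : nat) := Num.truncn (n%:R `^ s) in
  let A_hat (n : nat) (w : Omega) := empirical_copula n (fun k => Z k w) in
  let zeta_hat (n : nat) (w : Omega) := zeta1 (checkerboard (N n) (A_hat n w)) in
  {ae P, forall w, zeta_hat n w @[n --> \oo] --> zeta1 A}.
Proof.
move=> hZ cXY uA /andP[s0 sd] N A_hat zeta_hat.
have [cA _] := uA; have [[hA1 _] hAm] := is_copula_measure cA.
have A1 : pr (copula_measure A) (@cube R d.+1) = 1 by rewrite /pr hA1.
pose V k w := margin_transform XY (Z k w).
have mV k : measurable_fun setT (V k).
  by apply: measurableT_comp => //; exact: measurable_margin_transform.
have V01 k w : cube (V k w) by exact: margin_transform_cube.
have V_iid := pr_sample_transform hZ cXY uA.
have dR : 0 < d%:R :> R by rewrite ltr0n.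
have sd2 : s * d%:R < 2^-1.
  by move: sd; rewrite natrM invfM -ltr_pdivlMr.
(* The midpoint between s d and 1/2: below 1/2 for the summability of the tail bounds, above s d for
   the product with N ^ d to vanish. *)
pose gamma := (s * d%:R + 2^-1) / 2.
have sd0 : 0 < s * d%:R by rewrite mulr_gt0.
have gE : gamma * 2 = s * d%:R + 2^-1 by rewrite divfK.
have g0 : 0 < gamma by lra.
(* Index n stands for sample size n + 1, here and in F. *)
pose e n : R := n.+1%:R `^ (- gamma).
have e01 n : 0 < e n <= 1.
  rewrite powR_gt0//= -(powRr0 n.+1%:R); apply: ler_powR; first by rewrite ler1n.
  by rewrite oppr_le0 ltW.
have delta0 : 0 < 1 - 2 * gamma by lra.
have [K K0 hK] := expRN_powR_le d.+1 delta0.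
pose F n := large_deviation (copula_measure A) V n.+1 (e n).
have FK n : pr P (F n) <= 2 * K * (n.+1%:R ^+ 2)^-1.
  apply: le_trans (pr_large_deviation mV V_iid _ (e01 n)) _.
  (* As gamma < 1/2, the exponent of the tail bound is a positive power of the sample size, which
     beats the (n + 2) ^ (d + 1) points of the grid. *)
  have -> : n.+1%:R * e n ^+ 2 = n.+1%:R `^ (1 - 2 * gamma).
    rewrite /e -powR_mulrn ?powR_ge0// -powRrM -[X in X * _]powRr1// -powRD.
      by congr (_ `^ _); ring.
    by rewrite pnatr_eq0 implybT.
  rewrite mulrCA -mulrA ler_wpM2l//; exact: hK.
have K2 : 0 <= 2 * K by rewrite mulr_ge0.
have mF n : measurable (F n) by exact: (measurable_large_deviation mV V_iid _ (e01 n)).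
have aeF := ae_eventually_not mF K2 FK.
have aeT := ae_no_ties hZ cXY uA.
move: aeF aeT; apply: filterS2 => w [n0 hn0] nt.
(* On this sample path no large deviation occurs from sample size n0 + 1 on, so the sequence is
   considered from there. *)
rewrite -(cvg_shiftn n0.+1).
pose k n := (n + n0)%N.
have V_ties n i (a b : 'I_n) : tnth (V a w) i = tnth (V b w) i -> a = b.
  move=> ab; apply: val_inj; apply/eqP; apply: contraT => /(nt _ _ i).
  by rewrite -/(V a w) -/(V b w) ab eqxx.
have Z_ties n i (a b : 'I_n) : tnth (Z a w) i = tnth (Z b w) i -> a = b.
  by move=> ab; apply: (V_ties n i); rewrite !tnth_mktuple ab.
(* The margins need not be strictly increasing, but equal transformed values of two distinct
   observations are excluded by the absence of ties. *)
have order_ZV n i (a b : 'I_n) : (tnth (Z a w) i <= tnth (Z b w) i) = (tnth (V a w) i <= tnth (V b w) i).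
  apply/idP/idP; first exact: le_margin_transform.
  move=> ab; rewrite leNgt; apply/negP => ba.
  have := le_margin_transform XY (ltW ba) => ba'.
  have E : a = b by apply: (V_ties n i); apply/eqP; rewrite eq_le ab.
  by move: ba; rewrite E ltxx.
pose m : R := d.+1%:R.
pose err n := e (k n) + m / (k n).+1%:R.
have err_ok n u : `|empirical_df (k n).+1 (fun l => V l w) u - pr (copula_measure A) (lower_orthant u)| <= err n.
  apply: (empirical_df_error A1 hAm V01) => //; last by have /andP[/ltW] := e01 (k n).
  by apply: hn0; rewrite leq_addl.
have C_ok n u : cube u -> `|A_hat (k n).+1 w u - A u| <= d.+2%:R * err n + m / (k n).+1%:R.
  exact: (empirical_copula_error cA (ltn0Sn _) (@Z_ties _) (@order_ZV _) (fun l => V01 l w) (err_ok n)).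
have -> : (fun n => zeta_hat (n + n0.+1)%N w) = (fun n => zeta1 (checkerboard (N (k n).+1) (A_hat (k n).+1 w))).
  by apply/funext => n; rewrite /zeta_hat /k addnS.
apply: (zeta1_checkerboard_cvg cA _ _ _ C_ok).
- by move=> n; rewrite truncn_gt0 -[leLHS](powRr0 (k n).+1%:R); apply: ler_powR; rewrite ?ler1n// ltW.
- move=> l; have [M _ hM] := le_powR_near l%:R s0; exists M => // n /= Mn.
  by rewrite truncn_ge_nat ?powR_ge0// hM//= /k (leq_trans Mn)// leq_addr.
- by move=> n; apply: empirical_copula_is_copula => //; exact: Z_ties.
(* All terms m / n of the error are absorbed into m e, since 1 / n <= n ^ (- gamma) for gamma <= 1;
   C collects the resulting factors of e. *)
pose C : R := d.+2%:R * (1 + m) + m.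
have m0 : 0 <= m by rewrite /m ler0n.
have C0 : 0 <= C by rewrite addr_ge0 ?mulr_ge0 ?addr_ge0.
have kappa0 : 0 < gamma - s * d%:R by lra.
have bound n : 0 <= (N (k n).+1)%:R ^+ d * (d.+2%:R * err n + m / (k n).+1%:R) <=
    C * (k n).+1%:R `^ (- (gamma - s * d%:R)).
  set x : R := (k n).+1%:R; have x1 : 1 <= x by rewrite /x ler1n.
  have x0 : 0 < x by lra.
  have ek0 : 0 <= e (k n) by have /andP[/ltW] := e01 (k n).
  have mx : 0 <= m / x by rewrite divr_ge0// ltW.
  have ix : x^-1 <= e (k n).
    rewrite -powR_inv1 ?(ltW x0)// /e -/x; apply: ler_powR => //; lra.
  have mxe : m / x <= m * e (k n) by rewrite ler_wpM2l.
  have Nd : (N (k n).+1)%:R ^+ d <= x `^ (s * d%:R).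
    rewrite powRrM powR_mulrn ?powR_ge0// lerXn2r ?nnegrE ?powR_ge0//.
    by have /andP[] := truncn_itv (powR_ge0 x s).
  have tot : d.+2%:R * err n + m / x <= C * e (k n).
    have h : d.+2%:R * err n <= d.+2%:R * ((1 + m) * e (k n)).
      by rewrite ler_wpM2l// mulrDl mul1r lerD2l.
    by rewrite /C [leRHS]mulrDl -mulrA; exact: lerD.
  have tot0 : 0 <= d.+2%:R * err n + m / x by rewrite addr_ge0// mulr_ge0// addr_ge0.
  rewrite mulr_ge0 ?exprn_ge0//=.
  apply: le_trans (ler_pM _ tot0 Nd tot) _; first exact: exprn_ge0.
  rewrite mulrCA ler_wpM2l// /e -/x -powRD; last by rewrite (gt_eqF x0) implybT.
  by rewrite opprB.
apply: (@squeeze_cvgr _ _ _ _ (cst 0) (fun n => C * (k n).+1%:R `^ (- (gamma - s * d%:R)))).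
- by apply: nearW => n; exact: bound.
- exact: cvg_cst.
rewrite -[X in _ --> X](mulr0 C); apply: cvgMr.
by have := powRN_cvg0 kappa0; rewrite -(cvg_shiftn n0).
Qed.
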